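(* Let $(M,\omega)$ be a closed symplectic manifold and $h:|K|\to M$ a smooth triangulation. Given $\varepsilon>0$, there exists an integer $\ell\geq 1$ such that the piecewise constant $2$-form $\mathcal{C}_{\mathcal{S}_\ell(K)}(\omega)$ is $\varepsilon$-close to $\omega$ in the $C^0$-norm, i.e. $\|\mathcal{C}_{\mathcal{S}_\ell(K)}(\omega)-h^*\omega\|<\varepsilon$.
   Context: A smooth (Whitehead) triangulation of $M$ is a homeomorphism $h:|K|\to M$ from the body of a simplicial complex $K$ (of affine simplices in some $\mathbb{R}^N$), whose restriction to each closed simplex is a smooth embedding. A Whitney $2$-form on a simplicial complex $L$ is a collection $\alpha=(\alpha_\sigma)_{\sigma\in L}$ of smooth $2$-forms on the simplices with $\alpha_{\sigma_1}|_{\sigma_1\cap\sigma_2}=\alpha_{\sigma_2}|_{\sigma_1\cap\sigma_2}$; it is piecewise constant if each $\alpha_\sigma$ is constant in affine coordinates. $h^*\omega=((h|_\sigma)^*\omega)_\sigma$. For a subdivision $L$ of $K$, $\mathcal{C}_L(\omega)$ denotes the unique piecewise constant $2$-form on $L$ whose restriction to each $2$-simplex $\tau$ of $L$ is the constant $2$-form $\omega_\tau$ with $\int_\tau\omega_\tau=\int_\tau h^*\omega$. Crystalline subdivision $\mathcal{S}_\ell(K)$: choose an ordering $v_0,\dots,v_p$ of the vertices of $K$. For a top-dimensional simplex $\sigma=\langle v_{i_0},\dots,v_{i_m}\rangle$, $i_0<\dots<i_m$ ($m=\dim K$), let $f$ be the affine map with $f(v_{i_0})=(1,1,\dots,1)$,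 $f(v_{i_1})=(0,1,\dots,1)$, ..., $f(v_{i_m})=(0,\dots,0)$. Divide $[0,1]^m$ into $\ell^m$ equal cubes and each small cube (rescaled and translated to $[0,1]^m$) into the $m!$ simplices $\{0\le x_{\tau(1)}\le\dots\le x_{\tau(m)}\le1\}$, $\tau$ a permutation. The induced subdivisions of the $f(\sigma)$'s pull back to subdivisions of the $\sigma$'s that fit together to give $\mathcal{S}_\ell(K)$. $C^0$-norm: fix a Euclidean norm $\|\cdot\|$ on the vector bundle $\Lambda^2(T^*M)$, transported to each simplex by $h$. For Whitney $2$-forms $\alpha,\beta$ on a subdivision $L$ of $K$, $\|\alpha-\beta\|<\varepsilon$ means $\|(\alpha_\sigma)_x-(\beta_\sigma)_x\|<\varepsilon$ for all simplices $\sigma$ of $L$ of dimension $\dim M$ and all $x\in\sigma$. *)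

(* Defs.v *)
From HB Require Import structures.
From mathcomp Require Import all_boot all_order all_algebra fingroup perm.
From mathcomp Require Import finmap.
From mathcomp Require Import all_classical all_reals all_analysis.

Set Implicit Arguments.
Unset Strict Implicit.
Unset Printing Implicit Defensive.

Import Order.TTheory GRing.Theory Num.Theory.
Import numFieldNormedType.Exports.

Local Open Scope classical_set_scope.
Local Open Scope ring_scope.

Fixpoint Ck_on (R : realType) (V W : normedModType R) (k : nat)
    (U : set V) (f : V -> W) : Prop :=
  match k with
  | 0 => forall x, U x -> {for x, continuous f}
  | k'.+1 => (forall x, U x -> differentiable f x) /\
             (forall v, Ck_on k' U ('D_v f))
  end.

(* meant for open [U] only *)
Definition smooth_on (R : realType) (V W : normedModType R)
    (U : set V) (f : V -> W) : Prop := forall k, Ck_on k U f.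

(* [cpsi] is the inverse of [cphi]; the values of [cphi] and [cpsi] outside
   [cdom] and [cimg] are irrelevant. *)
Record chart (R : realType) (M : topologicalType) (n : nat) := Chart {
  cdom : set M;
  cimg : set 'rV[R]_n;
  cphi : M -> 'rV[R]_n;
  cpsi : 'rV[R]_n -> M;
  open_cdom : open cdom;
  open_cimg : open cimg;
  cphi_img : forall p, cdom p -> cimg (cphi p);
  cpsi_dom : forall x, cimg x -> cdom (cpsi x);
  cphiK : forall p, cdom p -> cpsi (cphi p) = p;
  cpsiK : forall x, cimg x -> cphi (cpsi x) = x;
  cphi_continuous : {within cdom, continuous cphi};
  cpsi_continuous : {within cimg, continuous cpsi}
}.

Definition transition (R : realType) (M : topologicalType) (n : nat)
  (c c' : chart R M n) : 'rV[R]_n -> 'rV[R]_n := cphi c' \o cpsi c.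

Definition smooth_atlas (R : realType) (M : topologicalType) (n : nat)
    (A : set (chart R M n)) : Prop :=
  (forall p : M, exists2 c, A c & cdom c p) /\
  (forall c c', A c -> A c' ->
     smooth_on (cphi c @` (cdom c `&` cdom c')) (transition c c')).

(* There is no boundary since charts take values in open subsets of R^n. *)
Definition closed_manifold (R : realType) (M : topologicalType) (n : nat)
    (A : set (chart R M n)) : Prop :=
  [/\ hausdorff_space M, @second_countable M, compact [set: M]
    & smooth_atlas A].

(* Bilinear forms on R^n are given by their Gram matrices. *)
Definition form_eval (R : realType) (n : nat) (B : 'M[R]_n)
  (u v : 'rV[R]_n) : R := (u *m B *m v^T) 0 0.

Definition alternating (R : realType) (n : nat) (B : 'M[R]_n) : Prop :=
  B^T = - B.

(* The pull-back of [B] by the linear map u |-> u *m J. *)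
Definition form_pull (R : realType) (n m : nat) (J : 'M[R]_(n, m))
  (B : 'M[R]_m) : 'M[R]_n := J *m B *m J^T.

(* A 2-form is given by its coordinate expressions [w c x], for [x] in the
   image of the chart [c]. *)
Definition two_form (R : realType) (M : topologicalType) (n : nat)
    (A : set (chart R M n)) (w : chart R M n -> 'rV[R]_n -> 'M[R]_n) : Prop :=
  [/\ forall c, A c -> smooth_on (cimg c) (w c),
      forall c x, A c -> cimg c x -> alternating (w c x)
    & forall c c' p, A c -> A c' -> cdom c p -> cdom c' p ->
        w c (cphi c p) =
        form_pull ('J (transition c c') (cphi c p)) (w c' (cphi c' p))].

Definition ext_deriv (R : realType) (n : nat) (w : 'rV[R]_n -> 'M[R]_n)
    (x u1 u2 u3 : 'rV[R]_n) : R :=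
  form_eval ('D_u1 w x) u2 u3 + form_eval ('D_u2 w x) u3 u1
  + form_eval ('D_u3 w x) u1 u2.

Definition symplectic_form (R : realType) (M : topologicalType) (n : nat)
    (A : set (chart R M n)) (w : chart R M n -> 'rV[R]_n -> 'M[R]_n) : Prop :=
  [/\ two_form A w,
      forall c x, A c -> cimg c x ->
        forall u1 u2 u3, ext_deriv (w c) x u1 u2 u3 = 0
    & forall c x, A c -> cimg c x ->
        forall u, (forall v, form_eval (w c x) u v = 0) -> u = 0].

(* A Euclidean norm on the bundle of alternating 2-forms: [g c x] is the
   coordinate expression of the inner product in the fibre. *)
Definition euclidean_structure (R : realType) (M : topologicalType) (n : nat)
    (A : set (chart R M n))
    (g : chart R M n -> 'rV[R]_n -> 'M[R]_n -> 'M[R]_n -> R) : Prop :=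
  [/\ forall c x, A c -> cimg c x ->
        forall (a : R) (B1 B2 B3 : 'M[R]_n),
        alternating B1 -> alternating B2 -> alternating B3 ->
        g c x (a *: B1 + B2) B3 = a * g c x B1 B3 + g c x B2 B3,
      forall c x, A c -> cimg c x -> forall B1 B2 : 'M[R]_n,
        alternating B1 -> alternating B2 -> g c x B1 B2 = g c x B2 B1,
      forall c x, A c -> cimg c x -> forall B : 'M[R]_n,
        alternating B -> B != 0 -> 0 < g c x B B,
      forall c, A c -> forall B1 B2 : 'M[R]_n,
        alternating B1 -> alternating B2 ->
        {within cimg c, continuous (fun x => g c x B1 B2)}
    & forall c c' p, A c -> A c' -> cdom c p -> cdom c' p ->
        let J := 'J (transition c c') (cphi c p) in
        forall B1 B2 : 'M[R]_n, alternating B1 -> alternating B2 ->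
        g c (cphi c p) (form_pull J B1) (form_pull J B2) =
        g c' (cphi c' p) B1 B2].

(* A simplex in R^N is represented by its finite set of vertices. *)
Definition simplex (R : realType) (N : nat) := {fset 'rV[R]_N}.

Definition hull (R : realType) (N : nat) (s : simplex R N) : set 'rV[R]_N :=
  [set x | exists a : 'rV[R]_N -> R,
    [/\ forall v, v \in s -> 0 <= a v,
        \sum_(v <- s) a v = 1 & x = \sum_(v <- s) a v *: v]].

(* The vector space of vectors parallel to the affine span of [s]. *)
Definition direction (R : realType) (N : nat) (s : simplex R N) :
    set 'rV[R]_N :=
  [set u | exists a : 'rV[R]_N -> R,
    \sum_(v <- s) a v = 0 /\ u = \sum_(v <- s) a v *: v].

Definition affinely_independent (R : realType) (N : nat) (s : simplex R N) :
    Prop :=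
  forall a : 'rV[R]_N -> R,
    \sum_(v <- s) a v = 0 -> \sum_(v <- s) a v *: v = 0 ->
    forall v, v \in s -> a v = 0.

Definition simplicial_complex (R : realType) (N : nat)
    (K : set (simplex R N)) : Prop :=
  [/\ forall s, K s -> s != fset0 /\ affinely_independent s,
      forall s t, K s -> t != fset0 -> (t `<=` s)%fset -> K t
    & forall s t, K s -> K t -> hull s `&` hull t = hull (s `&` t)%fset].

Definition body (R : realType) (N : nat) (K : set (simplex R N)) :
  set 'rV[R]_N := \bigcup_(s in K) hull s.

Definition vertex_ordering (R : realType) (N : nat) (K : set (simplex R N))
    (vs : seq 'rV[R]_N) : Prop :=
  uniq vs /\ forall v, v \in vs <-> K [fset v]%fset.

(* [F] extends [f] smoothly from a neighbourhood of [x] in the closed simplex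
   [s] to a neighbourhood of [x] in the ambient space; the differential of
   [f] at [x] is then the restriction of ['d F x] to [direction s]. *)
Definition smooth_extension (R : realType) (N : nat) (W : normedModType R)
    (s : simplex R N) (x : 'rV[R]_N) (f F : 'rV[R]_N -> W) : Prop :=
  exists U : set 'rV[R]_N, [/\ open U, U x, smooth_on U F
    & forall y, U y -> hull s y -> F y = f y].

Definition smooth_embedding (R : realType) (M : topologicalType) (n N : nat)
    (A : set (chart R M n)) (s : simplex R N) (h : 'rV[R]_N -> M) : Prop :=
  [/\ {within hull s, continuous h},
      set_inj (hull s) h,
      forall x c, hull s x -> A c -> cdom c (h x) ->
        exists F, smooth_extension s x (cphi c \o h) F
    & forall x c F, hull s x -> A c -> cdom c (h x) ->
        smooth_extension s x (cphi c \o h) F ->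
        forall u, direction s u -> 'd F x u = 0 -> u = 0].

Definition homeomorphism_from (T M : topologicalType) (B : set T)
    (h : T -> M) : Prop :=
  {within B, continuous h} /\
  exists g : M -> T,
    [/\ continuous g, forall p, B (g p), forall p, h (g p) = p
      & forall x, B x -> g (h x) = x].

Definition smooth_triangulation (R : realType) (M : topologicalType)
    (n N : nat) (A : set (chart R M n)) (K : set (simplex R N))
    (h : 'rV[R]_N -> M) : Prop :=
  [/\ simplicial_complex K, homeomorphism_from (body K) h
    & forall s, K s -> smooth_embedding A s h].

(* [al s x u v] is the value at the point [x] of the 2-form on the simplex
   [s] on the vectors [u] and [v]; only the values for [s] in the complex,
   [x] in [hull s] and [u], [v] in [direction s] are relevant. *)
Definition whitney_data (R : realType) (N : nat) :=
  simplex R N -> 'rV[R]_N -> 'rV[R]_N -> 'rV[R]_N -> R.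

Definition whitney_form (R : realType) (N : nat) (L : set (simplex R N))
    (al : whitney_data R N) : Prop :=
  [/\ forall s x, L s -> hull s x -> forall (a : R) u1 u2 v,
        direction s u1 -> direction s u2 -> direction s v ->
        al s x (a *: u1 + u2) v = a * al s x u1 v + al s x u2 v,
      forall s x, L s -> hull s x -> forall u v,
        direction s u -> direction s v -> al s x u v = - al s x v u,
      forall s x, L s -> hull s x -> forall u v,
        direction s u -> direction s v ->
        exists F : 'rV[R]_N -> R^o,
          smooth_extension s x (fun y => al s y u v) F
    & forall s1 s2 x, L s1 -> L s2 -> hull (s1 `&` s2)%fset x ->
        forall u v, direction (s1 `&` s2)%fset u ->
        direction (s1 `&` s2)%fset v -> al s1 x u v = al s2 x u v].

Definition piecewise_constant (R : realType) (N : nat)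
    (L : set (simplex R N)) (al : whitney_data R N) : Prop :=
  forall s x y, L s -> hull s x -> hull s y ->
    forall u v, direction s u -> direction s v -> al s x u v = al s y u v.

(* The integral over the 2-simplex [t] with vertices [a], [b], [c], oriented
   by this ordering. *)
Definition integral2 (R : realType) (N : nat) (al : whitney_data R N)
    (t : simplex R N) (a b c : 'rV[R]_N) : R :=
  \int[@lebesgue_measure R]_(p in `[0, 1])
    \int[@lebesgue_measure R]_(q in `[0, 1 - p])
      al t (a + p *: (b - a) + q *: (c - a)) (b - a) (c - a).

(* [h^* w]: the defining value depends neither on the chart [c] around [h x]
   nor on the smooth extension [F]. *)
Definition pullback (R : realType) (M : topologicalType) (n N : nat)
    (A : set (chart R M n)) (w : chart R M n -> 'rV[R]_n -> 'M[R]_n)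
    (h : 'rV[R]_N -> M) : whitney_data R N :=
  fun s x u v => get [set r : R | exists c F,
    [/\ A c, cdom c (h x), smooth_extension s x (cphi c \o h) F
      & r = form_eval (w c (cphi c (h x))) ('d F x u) ('d F x v)]].

Definition is_constant_approximation (R : realType) (M : topologicalType)
    (n N : nat) (A : set (chart R M n))
    (w : chart R M n -> 'rV[R]_n -> 'M[R]_n) (h : 'rV[R]_N -> M)
    (L : set (simplex R N)) (al : whitney_data R N) : Prop :=
  [/\ whitney_form L al, piecewise_constant L al
    & forall t a b c, L t -> #|` t| = 3%N -> t = [fset a; b; c]%fset ->
        integral2 al t a b c = integral2 (pullback A w h) t a b c].

(* C_L(w): the form with the above property is unique up to the irrelevant
   values of [whitney_data]. *)
Definition constant_approximation (R : realType) (M : topologicalType)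
    (n N : nat) (A : set (chart R M n))
    (w : chart R M n -> 'rV[R]_n -> 'M[R]_n) (h : 'rV[R]_N -> M)
    (L : set (simplex R N)) : whitney_data R N :=
  get [set al | is_constant_approximation A w h L al].

(* The norm at [h x] of the form [B] on the tangent space of M which
   corresponds to [be] under the differential of [h] restricted to [s], for
   [s] of dimension n; it does not depend on [c] and [F]. *)
Definition transported_norm (R : realType) (M : topologicalType) (n N : nat)
    (A : set (chart R M n))
    (g : chart R M n -> 'rV[R]_n -> 'M[R]_n -> 'M[R]_n -> R)
    (h : 'rV[R]_N -> M) (s : simplex R N) (x : 'rV[R]_N)
    (be : 'rV[R]_N -> 'rV[R]_N -> R) : R :=
  get [set r : R | exists c F B,
    [/\ A c /\ cdom c (h x), smooth_extension s x (cphi c \o h) F,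
        alternating B,
        forall u v, direction s u -> direction s v ->
          form_eval B ('d F x u) ('d F x v) = be u v
      & r = Num.sqrt (g c (cphi c (h x)) B B)]].

Definition C0_close (R : realType) (M : topologicalType) (n N : nat)
    (A : set (chart R M n))
    (g : chart R M n -> 'rV[R]_n -> 'M[R]_n -> 'M[R]_n -> R)
    (h : 'rV[R]_N -> M) (L : set (simplex R N)) (al be : whitney_data R N)
    (eps : R) : Prop :=
  forall s x, L s -> #|` s| = n.+1 -> hull s x ->
    transported_norm A g h s x (fun u v => al s x u v - be s x u v) < eps.

(* The vertices (for 0 <= i <= m) of the simplex
   0 <= x_(t 0) <= ... <= x_(t m.-1) <= 1 of the unit cube. *)
Definition cube_simplex_vertex (R : realType) (m : nat) (t : 'S_m) (i : nat) :
  'rV[R]_m := \row_j (i <= (t^-1)%g j)%N%:R.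

(* The same in the cube with lower corner k / l and edges of length 1 / l. *)
Definition small_cube_simplex_vertex (R : realType) (m l : nat)
    (k : {ffun 'I_m -> 'I_l}) (t : 'S_m) (i : nat) : 'rV[R]_m :=
  l%:R^-1 *: ((\row_j (k j : nat)%:R) + cube_simplex_vertex R t i).

(* The inverse of the affine map f sending the vertices ws_0, ..., ws_m of a
   simplex to (1, ..., 1), (0, 1, ..., 1), ..., (0, ..., 0). *)
Definition uncrystal (R : realType) (N m : nat) (ws : seq 'rV[R]_N)
    (y : 'rV[R]_m) : 'rV[R]_N :=
  ws`_m + \sum_(j < m) y 0 j *: (ws`_j - ws`_j.+1).

Lemma uncrystal_vertex (R : realType) (N m : nat) (ws : seq 'rV[R]_N)
    (i : nat) : (i <= m)%N ->
  uncrystal ws (cube_simplex_vertex R (1%g : 'S_m) i) = ws`_i.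
Proof.
move=> im; rewrite /uncrystal.
under eq_bigr do rewrite mxE invg1 perm1.
rewrite -(big_mkord xpredT
  (fun j => (i <= j)%N%:R *: (ws`_j - ws`_j.+1))).
rewrite (@big_cat_nat _ _ _ i) //=.
rewrite big_nat big1 ?add0r; last first.
  by move=> j /andP[_ ji]; rewrite leqNgt ji scale0r.
rewrite big_nat.
under eq_bigr => j /andP[ij _] do rewrite ij scale1r -opprB.
by rewrite -big_nat sumrN telescope_sumr // opprB addrC subrK.
Qed.

(* The simplices of S_l(K): those simplices of the crystalline subdivision of
   the cube which lie in f(s), for s a top-dimensional simplex of K whose
   vertices are listed in the chosen order. *)
Definition crystalline_subdivision (R : realType) (N : nat)
    (vs : seq 'rV[R]_N) (l : nat) (K : set (simplex R N)) :
    set (simplex R N) :=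
  [set r | r != fset0 /\
    exists (s : simplex R N) (m : nat) (k : {ffun 'I_m -> 'I_l}) (t : 'S_m),
    let ws := [seq v <- vs | v \in s] in
    [/\ K s, forall s', K s' -> (#|` s'| <= #|` s|)%N, #|` s| = m.+1,
        forall v, v \in r -> exists2 i, (i <= m)%N &
          v = uncrystal ws (small_cube_simplex_vertex R k t i)
      & hull r `<=` hull s]].

(* Main.v *)
Require Import Defs.
From mathcomp Require Import all_boot all_order all_algebra fingroup perm.
From mathcomp Require Import finmap.
From mathcomp Require Import all_classical all_reals all_analysis.
From mathcomp Require Import measurable_realfun ring lra.
Set Implicit Arguments.
Unset Strict Implicit.
Unset Printing Implicit Defensive.
Import Order.TTheory GRing.Theory Num.Theory.
Import numFieldNormedType.Exports.
Local Open Scope classical_set_scope.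
Local Open Scope ring_scope.
Import Defs.

(** The pull-back of a closed form satisfies Stokes' theorem on tetrahedra, so
   its integrals over the triangles of a simplex form an additive 2-cocycle on
   the vertices; such a cocycle is the family of integrals of a unique constant
   form, which gives the existence and uniqueness of C_L(w). A simplex of the
   l-th crystalline subdivision has the edges E_j / l of the original simplex
   along a path through its vertices, where the E_j do not depend on l. Hence
   C_L(w) - h^* w on (E_j, E_k) is l^2 times the difference, on pairs of edges
   of the small simplex, between h^* w at a point and its average over a
   triangle: the factors l^2 cancel and continuity makes the difference small.
   The frames E_j vary continuously through h and stay uniformly invertible, so
   smallness on (E_j, E_k) is smallness in norm, uniformly by compactness. *)

(** * Integrals over triangles *)

(** [pullback], [constant_approximation] and [transported_norm] are values of [get], and [h] is
    smooth only through extensions around each point. Integrals over a simplex become computable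
    once it lies in the domain of one chart and one extension. Refinement therefore serves twice:
    for large [l] the small simplices are in reach of Stokes' theorem, and on them the form is
    nearly constant. As the existence of C_L(w) is obtained from the cocycle identity on every
    simplex of L, the estimate at one simplex needs all of them to be small; compactness of closed
    simplices and finiteness of K provide a single [l].

    Stokes' theorem is the divergence theorem on the standard tetrahedron, for the field whose
    components are the values of the form on pairs of edges; it reduces to Fubini and the
    fundamental theorem of calculus. The standard triangle has area one half, so twice an integral
    over it is a mean value. The edge vectors along the path of a small simplex run through all E_j
    / l, each once, in the order given by the permutation; this makes the comparison between the two
    families of vectors work in both directions with constants independent of [l]. *)

Lemma continuous_pair (T U V : topologicalType) (f : T -> U) (g : T -> V) x :
  {for x, continuous f} -> {for x, continuous g} ->
  {for x, continuous (fun t => (f t, g t))}.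
Proof. by move=> cf cg; exact: cvg_pair. Qed.

(** The product sigma-algebra is generated by rectangles, so an open set is written as a countable
    union of open squares with rational centre and radius. Fubini in [tri_swap] depends on it. *)
Lemma open_prod_measurable (R : realType) (U : set (R * R)) :
  open U -> measurable (U : set (measurableTypeR R * measurableTypeR R)).
Proof.
move=> oU.
pose I := (rat * rat * rat)%type.
pose F (i : I) : set (R * R) := ball (ratr i.1.1 : R) (ratr i.2) `*` ball (ratr i.1.2 : R) (ratr
  i.2).
have -> : U = \bigcup_(i in [set i : I | F i `<=` U]) F i.
  apply/seteqP; split=> [[x y] Uxy|z [i /= Fi Fz]]; last exact: Fi.
  have /nbhs_ballP[e /= e0 Ue] : nbhs (x, y) U by apply: open_nbhs_nbhs.
  have e4 : 0 < e / 4 by rewrite divr_gt0.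
  (* The centre is taken within [e / 4] of [(x, y)]: a radius above [e / 4] puts the point into the
     square, one below [e / 2] keeps the square in the [e]-ball. *)
  have [|r] := @rat_in_itvoo R (e / 4) (e / 2); first by lra.
  rewrite in_itv /= => /andP[r1 r2].
  have [|a] := @rat_in_itvoo R (x - e / 4) (x + e / 4); first by lra.
  rewrite in_itv /= => /andP[a1 a2].
  have [|b] := @rat_in_itvoo R (y - e / 4) (y + e / 4); first by lra.
  rewrite in_itv /= => /andP[b1 b2].
  exists (a, b, r).
    move=> [x' y'] [/= Hx Hy]; apply: Ue; split => /=.
      move: Hx; rewrite /ball /= !ltr_norml => /andP[Hx1 Hx2].
      by apply/andP; split; lra.
    move: Hy; rewrite /ball /= !ltr_norml => /andP[Hx1 Hx2].
    by apply/andP; split; lra.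
  by split; rewrite /F /ball /= !ltr_norml; apply/andP; split; lra.
rewrite bigcup_mkcond; apply: countable_bigcupT_measurable => [|i].
  exact: countableP.
case: ifP => // _; apply: measurableX; rewrite ball_itv; exact: measurable_itv.
Qed.

Lemma continuous_prod_measurable_fun (R : realType) (f : R * R -> R) :
  continuous f ->
  measurable_fun [set: measurableTypeR R * measurableTypeR R] (f : _ -> measurableTypeR R).
Proof.
move=> /continuousP cf; apply: (measurability _ (RGenOpens.measurableE R)).
move=> _ [_ [a [b ->] <-]]; rewrite setTI; apply: open_prod_measurable.
exact/cf/interval_open.
Qed.

Local Notation mu := (@lebesgue_measure _).

(** The size [c] is a parameter because the slices of the standard tetrahedron are triangles of
    varying size. *)
Definition tri (R : realType) (c : R) (f : R -> R -> R) : R :=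
  \int[@lebesgue_measure R]_(p in `[0, c]) \int[@lebesgue_measure R]_(q in `[0, c - p]) f p q.

Section tri_swap.
Variables (R : realType) (c : R).
Let T : set (R * R) := [set z | [/\ 0 <= z.1, 0 <= z.2 & z.1 + z.2 <= c]].

Let mT : measurable (T : set (measurableTypeR R * measurableTypeR R)).
Proof.
rewrite (_ : T = ~` (((fun z : R * R => z.1) @^-1` [set x | x < 0]) `|`
   ((fun z : R * R => z.2) @^-1` [set x | x < 0]) `|`
   ((fun z : R * R => z.1 + z.2) @^-1` [set x | x > c]))); last first.
  apply/seteqP; split => [z [/= z1 z2 z3]|z /= zT].
    by move=> [[|]|] /=; rewrite ltNge ?z1 ?z2 ?z3.
  split; rewrite leNgt; apply: contra_notN zT => ?; by [left;left|left;right|right].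
apply: measurableC; apply: open_prod_measurable; apply: openU; first apply: openU.
- by apply: open_comp => [z _|]; [exact: cvg_fst|exact: open_lt].
- by apply: open_comp => [z _|]; [exact: cvg_snd|exact: open_lt].
- apply: open_comp => [z _|]; last exact: open_gt.
  by apply: cvgD; [exact: cvg_fst|exact: cvg_snd].
Qed.

Let intE (f : R -> R -> R) : continuous (fun z : R * R => f z.1 z.2) ->
  (\int[mu]_x \int[mu]_y ((fun z => f z.1 z.2) \_ T (x, y))%:E =
   \int[mu]_(p in `[0%R, c]) (\int[mu]_(q in `[0, c - p]) f p q)%R%:E)%E.
Proof.
move=> cf; rewrite [RHS]integral_mkcond; apply: eq_integral => p _.
rewrite [RHS]patchE; case: ifPn => [|/negP] pc; last first.
  apply: integral0_eq => y _; rewrite patchE memNset// => -[/= p0 y0 pyc].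
  by apply: pc; rewrite inE/= in_itv/= p0/=; lra.
move: pc; rewrite inE/= in_itv/= => /andP[p0 pc].
rewrite fineK; last first.
  apply: integrable_fin_num => //; apply: continuous_compact_integrable.
    exact: segment_compact.
  apply: continuous_subspaceT => q /=.
  apply: (@continuous_comp _ _ _ (fun q => (p, q)) (fun z => f z.1 z.2)); last exact: cf.
  by apply: continuous_pair; [exact: cvg_cst|exact: cvg_id].
rewrite [RHS]integral_mkcond; apply: eq_integral => q _.
rewrite [RHS]patchE patchE; case: ifPn; case: ifPn => //; rewrite ?inE ?notin_setE /T /= in_itv/=.
  by move=> H [_ H1 H2]; exfalso; apply: H; rewrite H1/=; lra.
by move=> /andP[H1 H2] H; exfalso; apply: H; split => //; lra.
Qed.

(** Both sides are integrals over the plane of [f] cut off outside [T], which is symmetric in the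
    two coordinates. Fubini applies because the cut-off function is bounded and [T] has finite
    measure. *)
Lemma tri_swap (f : R -> R -> R) :
  continuous (fun z : R * R => f z.1 z.2) ->
  tri c f = tri c (fun p q => f q p).
Proof.
move=> cf.
have [M M0 fM] : exists2 M : R, 0 <= M & forall z, T z -> `|f z.1 z.2| <= M.
  have : compact (`[0, c] `*` `[0, c] : set (R * R)) by apply: compact_setX; exact: segment_compact.
  have cc : {within `[0, c] `*` `[0, c], continuous (fun z : R * R => f z.1 z.2)}
    by exact: continuous_subspaceT.
  move=> /(continuous_compact cc)/compact_bounded[M [_ bM]].
  exists (`|M| + 1) => [|z [z1 z2 z12]]; first by rewrite addr_ge0.
  apply: (bM (`|M| + 1)); first by rewrite (le_lt_trans (ler_norm _)) // ltrDl.
  by exists z => //; split; rewrite /= in_itv/=; apply/andP; split; lra.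
pose g (z : measurableTypeR R * measurableTypeR R) : \bar R := ((fun z => f z.1 z.2) \_ T z)%:E.
have mg : measurable_fun [set: measurableTypeR R * measurableTypeR R] g.
  apply/measurable_EFinP.
  apply/(measurable_restrictT _ mT).
  apply: measurable_funTS.
  exact: continuous_prod_measurable_fun.
have ig : (mu \x mu)%E.-integrable [set: measurableTypeR R * measurableTypeR R] g.
  rewrite (_ : g = (EFin \o (fun z => f z.1 z.2)) \_ T); last first.
    by apply/funext => z; rewrite /g !patchE; case: ifP.
  apply: (integrable_mkcond _ mT).1; apply: measurable_bounded_integrable => //.
  - apply: (@le_lt_trans _ _ ((mu \x mu)%E (`[0, c] `*` `[0,
    c] : set (measurableTypeR R * measurableTypeR R)))).
      apply: le_measure; rewrite ?inE //; first by apply: measurableX; exact: measurable_itv.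
      by move=> z [z1 z2 z12]; split; rewrite /= in_itv/=; apply/andP; split; lra.
    rewrite product_measure1E; [|exact: measurable_itv|exact: measurable_itv].
    pose I0 : set R := `[0, c]%classic;
      change ((@lebesgue_measure R I0 * @lebesgue_measure R I0 < +oo)%E).
    by rewrite /I0 !lebesgue_measure_itv /= lte_fin; case: ifP => _;
      rewrite ?mule0 ?ltry// -EFinM ltry.
  - by apply: measurable_funTS; exact: continuous_prod_measurable_fun.
  - by exists M; split; [exact: num_real|move=> x Mx z zT; apply: (le_trans (fM _ zT)); exact: ltW].
have cf' : continuous (fun z : R * R => f z.2 z.1).
  move=> z; apply: (@continuous_comp _ _ _ (fun z => (z.2, z.1)) (fun z => f z.1 z.2));
    last exact: cf.
  by apply: continuous_pair; [exact: cvg_snd|exact: cvg_fst].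
rewrite /tri {1}/Rintegral -(intE cf) [in RHS]/Rintegral -(intE cf').
rewrite (Fubini ig); congr fine; apply: eq_integral => y _; apply: eq_integral => x _.
congr EFin; rewrite !patchE.
have -> : ((x, y) \in T) = ((y, x) \in T) => //.
by apply/idP/idP; rewrite !inE /T/= => -[? ? ?]; split => //; lra.
Qed.

End tri_swap.

Section one_variable.
Variable R : realType.
Implicit Types (f F : R -> R) (a b c : R).

Lemma continuous_integrable f a b : continuous f ->
  (@lebesgue_measure R).-integrable `[a, b] (EFin \o f).
Proof.
move=> cf; apply: continuous_compact_integrable; first exact: segment_compact.
exact: continuous_subspaceT.
Qed.

Lemma Rintegral_FTC f F a b : a <= b -> continuous f ->
  (forall x, a <= x <= b -> is_derive x 1 F (f x)) ->
  \int[mu]_(x in `[a, b]) f x = F b - F a.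
Proof.
rewrite le_eqVlt => /predU1P[-> _ _|ab cf dF].
  by rewrite set_itv1 Rintegral_set1 subrr.
have cF x : a <= x <= b -> {for x, continuous F}.
  move=> xab; apply: differentiable_continuous; apply/derivable1_diffP.
  by have := dF _ xab => -[].
rewrite /Rintegral (@continuous_FTC2 _ _ F) //.
- exact: continuous_subspaceT.
- split=> [x||].
  + by rewrite in_itv/= => /andP[ax xb]; have [|] := dF x; rewrite ?(ltW ax) ?(ltW xb).
  + by apply: cvg_at_right_filter; apply: cF; rewrite ?lexx (ltW ab).
  + by apply: cvg_at_left_filter; apply: cF; rewrite ?lexx (ltW ab).
- move=> x; rewrite in_itv/= => /andP[ax xb]; rewrite derive1E.
  by have [|] := dF x; rewrite ?(ltW ax) ?(ltW xb).
Qed.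

Lemma exists_primitive f a b : continuous f ->
  exists F, forall x, a <= x <= b -> is_derive x 1 F (f x).
Proof.
(* Integrating from [a - 1] makes [a] an interior point, so the derivative is two-sided at the
   endpoints as well. *)
move=> cf; exists (fun x => \int[mu]_(t in `[a - 1, x]) f t) => x /andP[ax xb].
have x1 : x < x + 1 by rewrite ltrDl.
have ax1 : a - 1 < x by lra.
have [d e] := continuous_FTC1_closed x1 (continuous_integrable (a - 1) (x + 1) cf) ax1 (cf x).
by apply: DeriveDef; [exact: d|rewrite -derive1E; exact: e].
Qed.

Lemma Rintegral_reflect f c : 0 <= c -> continuous f ->
  \int[mu]_(x in `[0, c]) f (c - x) = \int[mu]_(x in `[0, c]) f x.
Proof.
move=> c0 cf; have [F dF] := exists_primitive 0 c cf.
rewrite (Rintegral_FTC c0 cf dF).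
transitivity (- F (c - c) - - F (c - 0)); last by rewrite subrr subr0 opprK addrC.
apply: (@Rintegral_FTC _ (fun x => - F (c - x))) => //.
- move=> x; apply: continuous_comp; last exact: cf.
  by apply: cvgB; [exact: cvg_cst|exact: cvg_id].
- move=> x /andP[x0 xc].
  have H : is_derive (c - x) 1 F (f (c - x)) by apply: dF; apply/andP; split; lra.
  have Hc : is_derive x 1 (fun x => c - x) (- 1).
    have -> : (-1 : R) = 0 - 1 by rewrite sub0r.
    exact: is_deriveB.
  apply: is_derive_eq.
  by rewrite mulrN1 opprK.
Qed.

Lemma Rintegral_rescale f c : 0 <= c -> continuous f ->
  \int[mu]_(x in `[0, c]) f x = c * \int[mu]_(x in `[0, 1]) f (c * x).
Proof.
move=> c0 cf; have [F dF] := exists_primitive 0 c cf.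
have cfc : continuous (fun x => f (c * x)).
  move=> x; apply: continuous_comp; last exact: cf.
  by apply: cvgM; [exact: cvg_cst|exact: cvg_id].
rewrite (Rintegral_FTC c0 cf dF) -RintegralZl //; last exact: continuous_integrable.
transitivity (F (c * 1) - F (c * 0)); first by rewrite mulr1 mulr0.
symmetry; apply: (@Rintegral_FTC _ (fun x => F (c * x))) => //.
  by move=> x; apply: cvgM; [exact: cvg_cst|exact: cfc].
move=> x /andP[x0 x1].
have H : is_derive (c * x) 1 F (f (c * x)).
  by apply: dF; rewrite mulr_ge0//= ler_piMr.
have Hc : is_derive x 1 (fun x => c * x) c.
  have := @is_deriveZ R R R id c x 1 1 _; rewrite /GRing.scale /= mulr1; exact.
have := @is_derive1_comp R F (fun x => c * x) x _ _ H Hc; rewrite mulrC; exact.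
Qed.

End one_variable.

Lemma Rintegral_cst01 (R : realType) (k : R) :
  \int[@lebesgue_measure R]_(t in `[0, 1]) k = k.
Proof.
rewrite Rintegral_cst //= lebesgue_measure_itv /= lte_fin ltr01 /=.
by rewrite oppr0 addr0 mulr1.
Qed.

Lemma continuous_parametric_integral (R : realType) (T : topologicalType)
    (f : T -> R -> R) : continuous (fun z : T * R => f z.1 z.2) ->
  continuous (fun x => \int[@lebesgue_measure R]_(t in `[0, 1]) f x t).
Proof.
move=> cf x.
have cfx y : continuous (f y).
  move=> t; apply: (@continuous_comp _ _ _ (fun t => (y, t)) (fun z => f z.1 z.2)); last exact: cf.
  by apply: continuous_pair; [exact: cvg_cst|exact: cvg_id].
apply/cvgrPdist_le => e e0.
(* Compactness of the interval makes the estimate uniform in [t] for [y] near [x]. *)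
have : compact (`[0, 1]%classic : set R) by exact: segment_compact.
move/compact_near_coveringP => /(_ _ (nbhs x) (fun y t => `|f x t - f y t| <= e)) H.
have {}H : \forall y \near x, `[0, 1] `<=` (fun t => `|f x t - f y t| <= e).
  apply: H => t _.
  have := cf (x, t) => /= /cvgrPdist_le/(_ (e / 2))[|/= [A B] [/= xA tB] AB];
    first by rewrite divr_gt0.
  have /cvgrPdist_le/(_ (e / 2))[|/= r r0 rB] := cfx x t; first by rewrite divr_gt0.
  exists (B `&` ball t r, A) => /=; first by split=> //; apply: filterI => //; exact: nbhsx_ballx.
  move=> [t' y] /= [[Bt' rt'] Ay].
  have H1 := AB (y, t') (conj Ay Bt'); have H2 := rB _ rt'; rewrite /= in H1.
  rewrite [leRHS](splitr e) (le_trans _ (lerD H2 H1)) //.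
  rewrite (_ : f x t' - f y t' = (f x t - f y t') - (f x t - f x t')); last by ring.
  by rewrite [leRHS]addrC ler_normB.
apply: filterS H => y H.
rewrite -RintegralB //; [|exact: continuous_integrable..].
have ci : (@lebesgue_measure R).-integrable `[0, 1] (EFin \o (fun t => f x t - f y t)).
  apply: continuous_integrable => t; apply: cvgB; exact: cfx.
rewrite (le_trans (le_normr_Rintegral _ ci)) //.
rewrite -(Rintegral_cst01 e).
apply: le_Rintegral => //; last exact: continuous_integrable (@cst_continuous _ _ _).
by apply: continuous_integrable => t; apply: cvg_norm; apply: cvgB; exact: cfx.
Qed.

Section continuity.
Variables (R : realType) (T : topologicalType).
Implicit Types a b c : T -> R.

Lemma continuous_app2 (f : R -> R -> R) a b :
  continuous (fun z : R * R => f z.1 z.2) -> continuous a -> continuous b ->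
  continuous (fun t => f (a t) (b t)).
Proof.
move=> cf ca cb t.
apply: (@continuous_comp _ _ _ (fun t => (a t, b t)) (fun z => f z.1 z.2)); last exact: cf.
by apply: continuous_pair; [exact: ca|exact: cb].
Qed.

Lemma continuous_app3 (f : R -> R -> R -> R) a b c :
  continuous (fun z : R * R * R => f z.1.1 z.1.2 z.2) ->
  continuous a -> continuous b -> continuous c ->
  continuous (fun t => f (a t) (b t) (c t)).
Proof.
move=> cf ca cb cc t.
apply: (@continuous_comp _ _ _ (fun t => (a t, b t, c t)) (fun z => f z.1.1 z.1.2 z.2));
  last exact: cf.
by apply: continuous_pair; [apply: continuous_pair; [exact: ca|exact: cb]|exact: cc].
Qed.

Lemma continuous_add a b : continuous a -> continuous b -> continuous (fun t => a t + b t).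
Proof. by move=> ca cb t; apply: cvgD; [exact: ca|exact: cb]. Qed.

Lemma continuous_sub a b : continuous a -> continuous b -> continuous (fun t => a t - b t).
Proof. by move=> ca cb t; apply: cvgB; [exact: ca|exact: cb]. Qed.

Lemma continuous_mul a b : continuous a -> continuous b -> continuous (fun t => a t * b t).
Proof. by move=> ca cb t; apply: cvgM; [exact: ca|exact: cb]. Qed.

Lemma continuous_fst_comp (U V : topologicalType) (a : T -> U * V) :
  continuous a -> continuous (fun t => (a t).1).
Proof. by move=> ca t; apply: (@continuous_comp _ _ _ a fst); [exact: ca|exact: cvg_fst]. Qed.

Lemma continuous_snd_comp (U V : topologicalType) (a : T -> U * V) :
  continuous a -> continuous (fun t => (a t).2).
Proof. by move=> ca t; apply: (@continuous_comp _ _ _ a snd); [exact: ca|exact: cvg_snd]. Qed.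

End continuity.

(** Continuity of a function of several variables is looked up in uncurried form. The [change] cases
    undo eta-reductions that hide the variable of integration. *)
Ltac cts := cbv beta; repeat match goal with
  | |- continuous (fun t => t) => (move=> ?; exact: cvg_id)
  | |- continuous id => (move=> ?; exact: cvg_id)
  | |- continuous (fun t => ?a) => exact: cst_continuous
  | |- continuous (fun t => _ + - _) => apply: continuous_sub
  | |- continuous (fun t => _ + _) => apply: continuous_add
  | |- continuous (fun t => _ * _) => apply: continuous_mul
  | |- continuous ( *%R ?a) => change (continuous (fun t => a * t))
  | |- continuous ( +%R ?a) => change (continuous (fun t => a + t))
  | |- continuous (fun t => fst _) => apply: continuous_fst_comp
  | |- continuous (fun t => snd _) => apply: continuous_snd_comp
  | |- continuous (fst) => apply: continuous_fst_comp
  | |- continuous (snd) => apply: continuous_snd_comp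
  | H : continuous (fun z => ?f z.1.1 z.1.2 z.2) |- continuous (fun t => ?f _ _ _) => apply:
    (continuous_app3 H)
  | H : continuous (fun z => ?f z.1 z.2) |- continuous (?f ?p) => change (continuous (fun t => f
    p t))
  | H : continuous (fun z => ?f z.1.1 z.1.2 z.2) |- continuous (?f ?p ?q) => change (continuous
    (fun t => f p q t))
  | H : continuous (fun z => ?f z.1 z.2) |- continuous (fun t => ?f _ _) => apply:
    (continuous_app2 H)
  end.

Section triangle.
Variable R : realType.
Implicit Types (f g : R -> R -> R) (c p q k : R).

Lemma eq_tri c f g :
  (forall p q, 0 <= p -> 0 <= q -> p + q <= c -> f p q = g p q) -> tri c f = tri c g.
Proof.
move=> fg; apply: eq_Rintegral => p; rewrite inE/= in_itv/= => /andP[p0 pc].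
apply: eq_Rintegral => q; rewrite inE/= in_itv/= => /andP[q0 qc].
by apply: fg => //; lra.
Qed.

(* Rescaled to a fixed interval, the integral over [0 <= q <= c - p] is visibly
   continuous in [p]. *)
Definition fiber c f p := (c - p) * \int[@lebesgue_measure R]_(s in `[0, 1]) f p ((c - p) * s).

Lemma fiberE c f p : continuous (fun z : R * R => f z.1 z.2) -> p <= c ->
  fiber c f p = \int[@lebesgue_measure R]_(q in `[0, c - p]) f p q.
Proof.
by move=> cf pc; rewrite Rintegral_rescale ?subr_ge0//; cts.
Qed.

Lemma continuous_fiber c f : continuous (fun z : R * R => f z.1 z.2) ->
  continuous (fiber c f).
Proof.
move=> cf; apply: continuous_mul; first by cts.
by apply: (@continuous_parametric_integral _ _ (fun p s => f p ((c - p) * s))); cts.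
Qed.

Lemma triE c f : continuous (fun z : R * R => f z.1 z.2) ->
  tri c f = \int[@lebesgue_measure R]_(p in `[0, c]) fiber c f p.
Proof.
move=> cf; apply: eq_Rintegral => p; rewrite inE/= in_itv/= => /andP[p0 pc].
by rewrite fiberE.
Qed.

Lemma triD c f g : continuous (fun z : R * R => f z.1 z.2) ->
  continuous (fun z : R * R => g z.1 z.2) ->
  tri c (fun p q => f p q + g p q) = tri c f + tri c g.
Proof.
move=> cf cg; rewrite !triE; try by [exact: cf|exact: cg|cts].
rewrite -RintegralD //; [|exact/continuous_integrable/continuous_fiber..].
apply: eq_Rintegral => p _; rewrite /fiber -mulrDr RintegralD //;
  by apply: continuous_integrable; cts.
Qed.

Lemma triZ c k f : continuous (fun z : R * R => f z.1 z.2) ->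
  tri c (fun p q => k * f p q) = k * tri c f.
Proof.
move=> cf; rewrite !triE; try by [exact: cf|cts].
rewrite -RintegralZl //; [|exact/continuous_integrable/continuous_fiber].
apply: eq_Rintegral => p _; rewrite /fiber RintegralZl //; last by apply: continuous_integrable;
  cts.
by rewrite mulrCA.
Qed.

Lemma triB c f g : continuous (fun z : R * R => f z.1 z.2) ->
  continuous (fun z : R * R => g z.1 z.2) ->
  tri c (fun p q => f p q - g p q) = tri c f - tri c g.
Proof.
move=> cf cg; transitivity (tri c (fun p q => f p q + -1 * g p q)).
  by apply: eq_tri => p q _ _ _; rewrite mulN1r.
rewrite triD; [|exact: cf|by cts].
by rewrite triZ; [rewrite mulN1r|exact: cg].
Qed.

Lemma tri_cst c k : 0 <= c -> tri c (fun _ _ => k) = k * (c ^+ 2 / 2) :> R.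
Proof.
move=> c0; rewrite triE; last by cts.
transitivity (\int[@lebesgue_measure R]_(p in `[0, c]) (k * (c - p))).
  apply: eq_Rintegral => p _; by rewrite /fiber Rintegral_cst01 mulrC.
transitivity (- (k / 2) * ((c - c) * (c - c)) - - (k / 2) * ((c - 0) * (c - 0))); last by field.
apply: (@Rintegral_FTC _ _ (fun p => - (k / 2) * ((c - p) * (c - p)))) => //; first by cts.
by move=> p _; apply: is_derive_eq; rewrite /GRing.scale /=; field.
Qed.

Lemma le_tri c f g : continuous (fun z : R * R => f z.1 z.2) ->
  continuous (fun z : R * R => g z.1 z.2) ->
  (forall p q, 0 <= p -> 0 <= q -> p + q <= c -> f p q <= g p q) -> tri c f <= tri c g.
Proof.
move=> cf cg fg; rewrite !triE //.
apply: le_Rintegral => //; [exact/continuous_integrable/continuous_fiber..|].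
move=> p /=; rewrite in_itv/= => /andP[p0 pc]; rewrite !fiberE//.
apply: le_Rintegral => //; [apply: continuous_integrable; cts..|].
by move=> q /=; rewrite in_itv/= => /andP[q0 qc]; apply: fg => //; lra.
Qed.

(** A cyclic permutation of the vertices of the triangle preserves the area: it is [tri_swap]
    followed by a reflection of each fibre. *)
Lemma tri_rot f : continuous (fun z : R * R => f z.1 z.2) ->
  tri 1 (fun p q => f (1 - p - q) p) = tri 1 f.
Proof.
move=> cf; rewrite [RHS](tri_swap _ cf).
apply: eq_Rintegral => p; rewrite inE/= in_itv/= => /andP[p0 pc].
by rewrite -[RHS]Rintegral_reflect ?subr_ge0 //; cts.
Qed.

End triangle.

Lemma addr3_eq_of_sub (V : zmodType) (a1 a2 a3 b1 b2 b3 c1 c2 c3 : V) :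
  a1 - b1 = c1 -> a2 - b2 = c2 -> a3 - b3 = c3 -> c1 + c2 + c3 = 0 ->
  a1 + a2 + a3 = b1 + b2 + b3.
Proof.
move=> <- <- <- E; apply/eqP; rewrite -subr_eq0 !opprD addrACA.
by rewrite (addrACA a1) E.
Qed.

(** * Divergence theorem on the standard tetrahedron *)

Section divergence.
Variable R : realType.
Local Notation cont3 f := (continuous (fun t : R * R * R => f t.1.1 t.1.2 t.2)).
Implicit Types (d : R -> R -> R -> R) (x y z a b : R).
Variables P Q S d1 d2 d3 : R -> R -> R -> R.
Hypotheses (cP : cont3 P) (cQ : cont3 Q) (cS : cont3 S).
Hypotheses (c1 : cont3 d1) (c2 : cont3 d2) (c3 : cont3 d3).
Hypothesis h1 : forall y z : R, 0 <= y -> 0 <= z -> y + z <= 1 ->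
  \int[@lebesgue_measure R]_(x in `[0, 1 - y - z]) d1 x y z = P (1 - y - z) y z - P 0 y z.
Hypothesis h2 : forall x z : R, 0 <= x -> 0 <= z -> x + z <= 1 ->
  \int[@lebesgue_measure R]_(y in `[0, 1 - x - z]) d2 x y z = Q x (1 - x - z) z - Q x 0 z.
Hypothesis h3 : forall x y : R, 0 <= x -> 0 <= y -> x + y <= 1 ->
  \int[@lebesgue_measure R]_(z in `[0, 1 - x - y]) d3 x y z = S x y (1 - x - y) - S x y 0.
Hypothesis d0 : forall x y z : R, 0 <= x -> 0 <= y -> 0 <= z -> x + y + z <= 1 ->
  d1 x y z + d2 x y z + d3 x y z = 0.

Let K d x y := fiber (1 - x) (d x) y.

Let cK d : cont3 d -> continuous (fun z : R * R => K d z.1 z.2).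
Proof.
move=> cd; apply: continuous_mul; first by cts.
apply: (@continuous_parametric_integral _ _ (fun (z : R * R) s => d z.1 z.2 ((1 - z.1 - z.2) * s))).
by cts.
Qed.

Let KE d x y : cont3 d -> x + y <= 1 ->
  K d x y = \int[@lebesgue_measure R]_(z in `[0, 1 - x - y]) d x y z.
Proof.
move=> cd xy; rewrite /K fiberE //; last by lra.
by cts.
Qed.

Local Notation cont2 f := (continuous (fun t : R * R => f t.1 t.2)).

Let cont3_slant d : cont3 d -> cont2 (fun x y => d x y (1 - x - y)).
Proof. by move=> cd; cts. Qed.

Let cont3_slant2 d : cont3 d -> cont2 (fun x z => d x (1 - x - z) z).
Proof. by move=> cd; cts. Qed.

Let cont3_slant1 d : cont3 d -> cont2 (fun y z => d (1 - y - z) y z).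
Proof. by move=> cd; cts. Qed.

Let cont3_3 d a : cont3 d -> cont2 (fun x y => d x y a).
Proof. by move=> cd; cts. Qed.

Let cont3_2 d a : cont3 d -> cont2 (fun x z => d x a z).
Proof. by move=> cd; cts. Qed.

Let cont3_1 d a : cont3 d -> cont2 (fun y z => d a y z).
Proof. by move=> cd; cts. Qed.

Let cont3_int d x y a b : cont3 d ->
  (@lebesgue_measure R).-integrable `[a, b] (EFin \o (fun z => d x y z)).
Proof. by move=> cd; apply: continuous_integrable; cts. Qed.

(** Here [d1], [d2], [d3] stand for the partial derivatives of [P], [Q], [S] along their own axes,
    and the left-hand side is the flux through the slanted face. That face is a graph over each
    coordinate plane; [tri_rot] and [tri_swap] identify the three parametrizations with the one by
    [(1 - p - q, p, q)]. *)
Lemma simplex_divergence :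
  tri 1 (fun p q => P (1 - p - q) p q + Q (1 - p - q) p q + S (1 - p - q) p q) =
  tri 1 (fun p q => P 0 p q) + tri 1 (fun p q => Q p 0 q) + tri 1 (fun p q => S p q 0).
Proof.
have E3 : tri 1 (fun x y => S x y (1 - x - y)) - tri 1 (fun x y => S x y 0) = tri 1 (K d3).
  rewrite -(@triB R 1 (fun x y => S x y (1 - x - y)) (fun x y => S x y 0));
    [|exact: cont3_slant|exact: cont3_3].
  by apply: eq_tri => x y x0 y0 xy; rewrite (KE c3 xy) (h3 x0 y0 xy).
have E2 : tri 1 (fun x z => Q x (1 - x - z) z) - tri 1 (fun x z => Q x 0 z) = tri 1 (K d2).
  rewrite -(@triB R 1 (fun x z => Q x (1 - x - z) z) (fun x z => Q x 0 z));
    [|exact: cont3_slant2|exact: cont3_2].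
  apply: eq_Rintegral => x; rewrite inE/= in_itv/= => /andP[x0 x1].
  (* In the slice of fixed [x] the innermost variable changes from [y] to [z], the order of
     integration in [K]. *)
  transitivity (tri (1 - x) (fun z y => d2 x y z)).
    apply: eq_Rintegral => z; rewrite inE/= in_itv/= => /andP[z0 z1].
    by rewrite -(h2 x0 z0) // addrC -lerBrDr.
  rewrite (@tri_swap R (1 - x) (fun z y => d2 x y z)); last by cts.
  apply: eq_Rintegral => y; rewrite inE/= in_itv/= => /andP[y0 y1].
  by rewrite (KE c2) // addrC -lerBrDr.
have E1 : tri 1 (fun y z => P (1 - y - z) y z) - tri 1 (fun y z => P 0 y z) = tri 1 (K d1).
  rewrite -(@triB R 1 (fun y z => P (1 - y - z) y z) (fun y z => P 0 y z));
    [|exact: cont3_slant1|exact: cont3_1].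
  (* Passing between the orders [y, z, x] and [x, y, z] takes two exchanges: the outer one here, and
     one in the slice of fixed [y] below. *)
  rewrite [RHS](@tri_swap R 1 (K d1)); last exact: cK.
  apply: eq_Rintegral => y; rewrite inE/= in_itv/= => /andP[y0 y1].
  transitivity (tri (1 - y) (fun z x => d1 x y z)).
    apply: eq_Rintegral => z; rewrite inE/= in_itv/= => /andP[z0 z1].
    by rewrite -(h1 y0 z0) // addrC -lerBrDr.
  rewrite (@tri_swap R (1 - y) (fun z x => d1 x y z)); last by cts.
  apply: eq_Rintegral => x; rewrite inE/= in_itv/= => /andP[x0 x1].
  have xy : x + y <= 1 by rewrite -lerBrDr.
  rewrite (KE c1 xy) (addrAC 1 (- x)).
  by [].
have E0 : tri 1 (K d1) + tri 1 (K d2) + tri 1 (K d3) = 0.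
  rewrite -(@triD R 1 (K d1) (K d2)); [|exact: cK..].
  rewrite -(@triD R 1 (fun x y => K d1 x y + K d2 x y) (K d3));
    [|apply: continuous_add; exact: cK|exact: cK].
  rewrite -[RHS](mul0r (1 ^+ 2 / 2)) -(tri_cst 0 ler01).
  apply: eq_tri => x y x0 y0 xy; rewrite (KE c1 xy) (KE c2 xy) (KE c3 xy).
  rewrite -RintegralD; [|by []|exact: cont3_int..].
  rewrite -RintegralD; [|by []| |exact: cont3_int]; last first.
    by apply: continuous_integrable; cts.
  transitivity (\int[@lebesgue_measure R]_(z in `[0, 1 - x - y]) (0 : R)).
    apply: eq_Rintegral => z; rewrite inE/= in_itv/= => /andP[z0 z1].
    by rewrite d0 // addrC -lerBrDr opprD addrA.
  by rewrite Rintegral_cst //= mul0r.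
rewrite (@triD R 1 (fun p q => P (1 - p - q) p q + Q (1 - p - q) p q)
  (fun p q => S (1 - p - q) p q)); [|apply: continuous_add|]; try exact: cont3_slant1.
rewrite (@triD R 1 (fun p q => P (1 - p - q) p q)); try exact: cont3_slant1.
clear d0 h1 h2 h3.
have -> : tri 1 (fun p q => S (1 - p - q) p q) = tri 1 (fun x y => S x y (1 - x - y)).
  rewrite -[RHS](tri_rot (cont3_slant cS)).
  by apply: eq_tri => p q _ _ _; congr S; ring.
have -> : tri 1 (fun p q => Q (1 - p - q) p q) = tri 1 (fun x z => Q x (1 - x - z) z).
  rewrite (tri_swap _ (cont3_slant1 cQ)) -[RHS](tri_rot (cont3_slant2 cQ)).
  by apply: eq_tri => p q _ _ _; rewrite addrAC; congr Q; ring.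
exact: (addr3_eq_of_sub E1 E2 E3 E0).
Qed.

End divergence.

(** * Stokes' theorem on a tetrahedron *)

(* Composing with the retraction [(clamp1, clamp2, clamp3)] onto the standard
   simplex turns an integrand which is only known to be continuous there into a
   continuous function on the whole space. *)
Section clamp.
Variable R : realType.
Implicit Types (a b t x y z : R).

Definition clamp b t : R := Num.max 0 (Num.min b t).

Lemma clamp_ge0 b t : 0 <= clamp b t.
Proof. by rewrite /clamp le_max lexx. Qed.

Lemma clamp_le b t : 0 <= b -> clamp b t <= b.
Proof. by move=> b0; rewrite /clamp ge_max b0 ge_min lexx. Qed.

Lemma clamp_id b t : 0 <= t -> t <= b -> clamp b t = t.
Proof. by move=> t0 tb; rewrite /clamp (min_idPr tb) (max_idPr t0). Qed.

Lemma continuous_clamp (T : topologicalType) (f g : T -> R) :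
  continuous f -> continuous g -> continuous (fun u => clamp (f u) (g u)).
Proof.
move=> cf cg t; apply: (@continuous_max _ _ (fun=> 0) (f \min g)); first exact: cvg_cst.
by apply: continuous_min; [exact: cf|exact: cg].
Qed.

Definition clamp1 x := clamp 1 x.
Definition clamp2 x y := clamp (1 - clamp1 x) y.
Definition clamp3 x y z := clamp (1 - clamp1 x - clamp2 x y) z.

Lemma clamp1_le x : clamp1 x <= 1.
Proof. exact: clamp_le. Qed.

Lemma clamp2_le x y : clamp1 x + clamp2 x y <= 1.
Proof. by rewrite addrC -lerBrDr clamp_le // subr_ge0 clamp1_le. Qed.

Lemma clamp3_le x y z : clamp1 x + clamp2 x y + clamp3 x y z <= 1.
Proof. by rewrite addrC -lerBrDr opprD addrA clamp_le // -addrA -opprD subr_ge0 clamp2_le. Qed.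

Lemma clamp_simplex x y z : 0 <= x -> 0 <= y -> 0 <= z -> x + y + z <= 1 ->
  [/\ clamp1 x = x, clamp2 x y = y & clamp3 x y z = z].
Proof.
move=> x0 y0 z0 xyz.
have e1 : clamp1 x = x by apply: clamp_id => //; lra.
have e2 : clamp2 x y = y by rewrite /clamp2 e1 clamp_id //; lra.
by split=> //; rewrite /clamp3 e1 e2 clamp_id //; lra.
Qed.

Lemma continuous_clamp1 : continuous clamp1.
Proof. by apply: continuous_clamp; cts. Qed.

Lemma continuous_clamp2 : continuous (fun z : R * R => clamp2 z.1 z.2).
Proof.
apply: continuous_clamp; last by cts.
apply: continuous_sub; first by cts.
move=> z; apply: (@continuous_comp _ _ _ fst clamp1); first exact: cvg_fst.
exact: continuous_clamp1.
Qed.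

Lemma continuous_clamp3 : continuous (fun z : R * R * R => clamp3 z.1.1 z.1.2 z.2).
Proof.
apply: continuous_clamp; last by cts.
apply: continuous_sub; last first.
  by apply: (continuous_app2 continuous_clamp2); cts.
apply: continuous_sub; first by cts.
move=> z; apply: (@continuous_comp _ _ _ (fun z : R * R * R => z.1.1) clamp1);
  last exact: continuous_clamp1.
by have c11 : continuous (fun t : R * R * R => t.1.1) by [cts]; exact: c11.
Qed.

End clamp.

Section simplex_points.
Variable R : realDomainType.
Implicit Types x y z : R.

Definition in_simplex x y z := [/\ 0 <= x, 0 <= y, 0 <= z & x + y + z <= 1].

Lemma in_simplex1 x y z : 0 <= x -> 0 <= y -> 0 <= z -> x <= 1 - y - z -> in_simplex x y z.
Proof. by move=> ? ? ? ?; split=> //; lra. Qed.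

Lemma in_simplex2 x y z : 0 <= x -> 0 <= y -> 0 <= z -> y <= 1 - x - z -> in_simplex x y z.
Proof. by move=> ? ? ? ?; split=> //; lra. Qed.

Lemma in_simplex3 x y z : 0 <= x -> 0 <= y -> 0 <= z -> z <= 1 - x - y -> in_simplex x y z.
Proof. by move=> ? ? ? ?; split=> //; lra. Qed.

Lemma slack_ge0 x y : x + y <= 1 -> 0 <= 1 - x - y.
Proof. lra. Qed.

End simplex_points.

(** Brings directional derivatives in [V] within reach of the fundamental theorem of calculus and
    the mean value theorem on the real line. *)
Lemma is_derive_line (R : realType) (V W : normedModType R) (f : V -> W) (x e : V) (t : R) :
  derivable f (x + t *: e) e ->
  is_derive t (1 : R) (fun s : R => f (x + s *: e)) ('D_e f (x + t *: e)).
Proof.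
move=> df.
have E : (fun h : R => h^-1 *: (((fun s : R => f (x + s *: e)) \o shift t) (h *: (1 : R)) - f (x
  + t *: e))) =
         (fun h : R => h^-1 *: ((f \o shift (x + t *: e)) (h *: e) - f (x + t *: e))).
  apply/funext => h /=; congr (_ *: (f _ - _)).
  by rewrite [h *: (1 : R)]mulr1 scalerDl addrCA.
by apply: DeriveDef; rewrite /derivable /derive E.
Qed.

Lemma slanted_face (R : pzRingType) (V : lmodType R) (x0 e1 e2 e3 : V) (p q : R) :
  x0 + e1 + p *: (e2 - e1) + q *: (e3 - e1) =
  x0 + (1 - p - q) *: e1 + p *: e2 + q *: e3.
Proof.
rewrite !scalerBl !scalerBr scale1r !addrA.
by rewrite [LHS](ACl (1*2*4*6*3*5)).
Qed.

Lemma addr3_cancel (V : zmodType) (a b c : V) : a + b + c - a + - b - c = 0.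
Proof. by rewrite -!addrA -!opprD !addrA subrr. Qed.

(** [2 * tri 1 f] is the mean value of [f], the triangle having area one half. *)
Lemma tri_bound (R : realType) (f : R -> R -> R) (k d : R) :
  continuous (fun z : R * R => f z.1 z.2) ->
  (forall p q, 0 <= p -> 0 <= q -> p + q <= 1 -> `|f p q - k| <= d) ->
  `|2 * tri 1 f - k| <= d.
Proof.
move=> cf fk.
have cc (a : R) : continuous (fun z : R * R => (fun _ _ => a) z.1 z.2 : R) by exact: cst_continuous.
have lo := @le_tri R 1 (fun _ _ => k - d) f (cc (k - d)) cf.
have hi := @le_tri R 1 f (fun _ _ => k + d) cf (cc (k + d)).
rewrite !tri_cst ?ler01 // expr1n in lo hi.
have {}lo : (k - d) * (1 / 2) <= tri 1 f.
  by apply: lo => p q p0 q0 pq; have /ler_normlP[+ _] := fk p q p0 q0 pq;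
    rewrite opprB lerBlDr lerBlDl addrC.
have {}hi : tri 1 f <= (k + d) * (1 / 2).
  by apply: hi => p q p0 q0 pq; have /ler_normlP[_ +] := fk p q p0 q0 pq; rewrite lerBlDl.
move: (tri 1 f) lo hi => T lo hi; rewrite ler_norml; apply/andP; split; lra.
Qed.

Section cocycle.
Variables (R : realType) (V : normedModType R) (B : set V).
Variable be : V -> V -> V -> R.
Hypothesis be_lin : forall x, B x -> forall a u1 u2 v,
  be x (a *: u1 + u2) v = a * be x u1 v + be x u2 v.
Hypothesis be_alt : forall x, B x -> forall u v, be x u v = - be x v u.
Hypothesis be_cont : forall u v x, B x -> {for x, continuous (fun y => be y u v)}.
Hypothesis be_der : forall u v e x, B x -> derivable (fun y => be y u v) x e.
Hypothesis be_cder : forall u v e x, B x ->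
  {for x, continuous ('D_e (fun y => be y u v))}.
Hypothesis be_closed : forall x, B x -> forall u1 u2 u3,
  'D_u1 (fun y => be y u2 u3) x + 'D_u2 (fun y => be y u3 u1) x
  + 'D_u3 (fun y => be y u1 u2) x = 0.

Let beBl x u1 u2 v : B x -> be x (u1 - u2) v = be x u1 v - be x u2 v.
Proof. by move=> Bx; rewrite addrC -scaleN1r be_lin // mulN1r addrC. Qed.

Let beBr x u v1 v2 : B x -> be x u (v1 - v2) = be x u v1 - be x u v2.
Proof.
move=> Bx; rewrite be_alt // beBl // opprB.
by rewrite [be x u v1]be_alt // [be x u v2]be_alt // opprK addrC.
Qed.

Let be0 x u : B x -> be x u u = 0.
Proof. by move=> Bx; have := be_alt Bx u u; lra. Qed.

(** The slanted face of the tetrahedron is spanned by [u2 - u1] and [u3 - u1]; the form on it is the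
    sum of the three components, which is the flux density in [simplex_divergence]. *)
Let be_face x u1 u2 u3 : B x ->
  be x (u2 - u1) (u3 - u1) = be x u2 u3 + be x u3 u1 + be x u1 u2.
Proof.
move=> Bx.
rewrite beBr // !beBl // be0 // [be _ u3 u1]be_alt // [be _ u2 u1]be_alt //.
by rewrite subr0 !opprK; ring.
Qed.

Definition tri_int (a b c : V) : R :=
  tri 1 (fun p q => be (a + p *: (b - a) + q *: (c - a)) (b - a) (c - a)).

Variables (x0 x1 x2 x3 : V).
Let pt (x y z : R) := x0 + x *: (x1 - x0) + y *: (x2 - x0) + z *: (x3 - x0).
Hypothesis B_pt : forall x y z : R, in_simplex x y z -> B (pt x y z).

Let cpt (x y z : R) := pt (clamp1 x) (clamp2 x y) (clamp3 x y z).

Let B_cpt x y z : B (cpt x y z).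
Proof. by apply: B_pt; split; rewrite ?clamp_ge0 ?clamp3_le. Qed.

Let cptE (x y z : R) : in_simplex x y z -> cpt x y z = pt x y z.
Proof. by move=> [a b c d]; rewrite /cpt; have [-> -> ->] := clamp_simplex a b c d. Qed.

Let cpt_cont (f : V -> R) : (forall x, B x -> {for x, continuous f}) ->
  continuous (fun t : R * R * R => f (cpt t.1.1 t.1.2 t.2)).
Proof.
move=> cf t; apply: (@continuous_comp _ _ _ (fun t : R * R * R => cpt t.1.1 t.1.2 t.2) f);
  last by apply: cf; exact: B_cpt.
have cc (f' : R * R * R -> R) (v : V) : continuous f' -> {for t, continuous (fun t => f' t *: v)}.
  by move=> cf'; apply: cvgZr_tmp; exact: cf'.
apply: cvgD; last by apply: cc; exact: continuous_clamp3.
apply: cvgD; last by apply: cc; apply: (continuous_app2 (@continuous_clamp2 R)); cts.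
apply: cvgD; first exact: cvg_cst.
apply: cc => {}t; apply: (@continuous_comp _ _ _ (fun z : R * R * R => z.1.1) (@clamp1 R));
  last exact: continuous_clamp1.
by have c11 : continuous (fun t : R * R * R => t.1.1) by [cts]; exact: c11.
Qed.

Let e1 := x1 - x0.
Let e2 := x2 - x0.
Let e3 := x3 - x0.
Let F u v (x y z : R) := be (cpt x y z) u v.
Let G e u v (x y z : R) := 'D_e (fun y => be y u v) (cpt x y z).

Let cF u v : continuous (fun t : R * R * R => F u v t.1.1 t.1.2 t.2).
Proof. by apply: (cpt_cont (f := fun x => be x u v)) => x; exact: be_cont. Qed.

Let cG e u v : continuous (fun t : R * R * R => G e u v t.1.1 t.1.2 t.2).
Proof. by apply: (cpt_cont (f := 'D_e (fun y => be y u v))) => x; exact: be_cder. Qed.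

Let lineE e u v w (t : R) : B (w + t *: e) ->
  is_derive t (1 : R) (fun s => be (w + s *: e) u v) ('D_e (fun y => be y u v) (w + t *: e)).
Proof. by move=> Bw; exact: (is_derive_line (f := fun y => be y u v) (@be_der u v e _ Bw)). Qed.

Let face123 : tri_int x1 x2 x3 =
  tri 1 (fun p q => F e2 e3 (1 - p - q) p q + F e3 e1 (1 - p - q) p q + F e1 e2 (1 - p - q) p q).
Proof.
apply: eq_tri => p q p0 q0 pq.
have pq1 : in_simplex (1 - p - q) p q by apply: in_simplex1 => //; exact: slack_ge0.
have Bp := B_pt pq1; rewrite /F (cptE pq1) {pq1}.
have -> : x2 - x1 = e2 - e1 by rewrite /e2 /e1 opprB addrA subrK.
have -> : x3 - x1 = e3 - e1 by rewrite /e3 /e1 opprB addrA subrK.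
have -> : x1 + p *: (e2 - e1) + q *: (e3 - e1) = pt (1 - p - q) p q.
  by rewrite -[x1 in LHS](subrK x0) -/e1 [e1 + x0]addrC slanted_face.
exact: be_face.
Qed.

Let face023 : tri_int x0 x2 x3 = tri 1 (fun p q => F e2 e3 0 p q).
Proof.
apply: eq_tri => p q p0 q0 pq.
have pq1 : in_simplex 0 p q by exact: (in_simplex1 (lexx _) p0 q0 (slack_ge0 pq)).
by rewrite /F (cptE pq1) /pt scale0r addr0.
Qed.

Let face013 : tri_int x0 x1 x3 = - tri 1 (fun p q => F e3 e1 p 0 q).
Proof.
rewrite -mulN1r -triZ; last by cbv beta; apply: (continuous_app3 (f := F e3 e1) (@cF e3 e1)); cts.
apply: eq_tri => p q p0 q0 pq.
have pq1 : in_simplex p 0 q by exact: (in_simplex2 p0 (lexx _) q0 (slack_ge0 pq)).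
have := B_pt pq1; rewrite /F (cptE pq1) /pt scale0r addr0 => Bp.
by rewrite (be_alt Bp) mulN1r.
Qed.

Let face012 : tri_int x0 x1 x2 = tri 1 (fun p q => F e1 e2 p q 0).
Proof.
apply: eq_tri => p q p0 q0 pq.
have pq1 : in_simplex p q 0 by exact: (in_simplex3 p0 q0 (lexx _) (slack_ge0 pq)).
by rewrite /F (cptE pq1) /pt scale0r addr0.
Qed.

Let h1 y z : 0 <= y -> 0 <= z -> y + z <= 1 ->
    \int[@lebesgue_measure R]_(x in `[0, 1 - y - z]) G e1 e2 e3 x y z
    = F e2 e3 (1 - y - z) y z - F e2 e3 0 y z.
Proof.
move=> y0 z0 yz; have s0 := slack_ge0 yz.
have sa : in_simplex (1 - y - z) y z by apply: in_simplex1.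
have sb : in_simplex 0 y z by apply: in_simplex1.
rewrite /F (cptE sa) (cptE sb) {sa sb}.
pose w := x0 + y *: e2 + z *: e3.
have E x : pt x y z = w + x *: e1 by rewrite /pt -/e1 -/e2 -/e3 /w -!addrA; congr (_ + _);
  rewrite addrC -!addrA.
rewrite !E; apply: (@Rintegral_FTC _ _ (fun x => be (w + x *: e1) e2 e3)); first exact: s0.
  by apply: (continuous_app3 (f := G e1 e2 e3) (@cG e1 e2 e3)); cts.
move=> x /andP[xx0 xx1].
have sx : in_simplex x y z by apply: in_simplex1.
by rewrite /G (cptE sx) E; apply: lineE; rewrite -E; exact: B_pt.
Qed.

Let h2 x z : 0 <= x -> 0 <= z -> x + z <= 1 ->
    \int[@lebesgue_measure R]_(y in `[0, 1 - x - z]) G e2 e3 e1 x y z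
    = F e3 e1 x (1 - x - z) z - F e3 e1 x 0 z.
Proof.
move=> xx0 z0 xz; have s0 := slack_ge0 xz.
have sa : in_simplex x (1 - x - z) z by apply: in_simplex2.
have sb : in_simplex x 0 z by apply: in_simplex2.
rewrite /F (cptE sa) (cptE sb) {sa sb}.
pose w := x0 + x *: e1 + z *: e3.
have E y : pt x y z = w + y *: e2 by rewrite /pt -/e1 -/e2 -/e3 /w addrAC.
rewrite !E; apply: (@Rintegral_FTC _ _ (fun y => be (w + y *: e2) e3 e1)); first exact: s0.
  by apply: (continuous_app3 (f := G e2 e3 e1) (@cG e2 e3 e1)); cts.
move=> y /andP[y0 y1].
have sx : in_simplex x y z by apply: in_simplex2.
by rewrite /G (cptE sx) E; apply: lineE; rewrite -E; exact: B_pt.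
Qed.

Let h3 x y : 0 <= x -> 0 <= y -> x + y <= 1 ->
    \int[@lebesgue_measure R]_(z in `[0, 1 - x - y]) G e3 e1 e2 x y z
    = F e1 e2 x y (1 - x - y) - F e1 e2 x y 0.
Proof.
move=> xx0 y0 xy; have s0 := slack_ge0 xy.
have sa : in_simplex x y (1 - x - y) by apply: in_simplex3.
have sb : in_simplex x y 0 by apply: in_simplex3.
rewrite /F (cptE sa) (cptE sb) {sa sb}.
pose w := x0 + x *: e1 + y *: e2.
have E z : pt x y z = w + z *: e3 by rewrite /pt -/e1 -/e2 -/e3 /w.
rewrite !E; apply: (@Rintegral_FTC _ _ (fun z => be (w + z *: e3) e1 e2)); first exact: s0.
  by apply: (continuous_app3 (f := G e3 e1 e2) (@cG e3 e1 e2)); cts.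
move=> z /andP[z0 z1].
have sx : in_simplex x y z by apply: in_simplex3.
by rewrite /G (cptE sx) E; apply: lineE; rewrite -E; exact: B_pt.
Qed.

(** Stokes' theorem in the guise of the divergence theorem for the field with components [F e2 e3],
    [F e3 e1], [F e1 e2]: its divergence vanishes by [be_closed]. The face [x0 x1 x3] carries a
    minus sign since its parametrization has the order [e1, e3]. *)
Lemma tri_int_cocycle :
  tri_int x1 x2 x3 - tri_int x0 x2 x3 + tri_int x0 x1 x3 - tri_int x0 x1 x2 = 0.
Proof.
have d0 (x y z : R) : 0 <= x -> 0 <= y -> 0 <= z -> x + y + z <= 1 ->
    G e1 e2 e3 x y z + G e2 e3 e1 x y z + G e3 e1 e2 x y z = 0.
  by move=> _ _ _ _; exact: be_closed.
rewrite face123.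
rewrite (simplex_divergence (@cF e2 e3) (@cF e3 e1) (@cF e1 e2)
  (@cG e1 e2 e3) (@cG e2 e3 e1) (@cG e3 e1 e2) h1 h2 h3 d0).
rewrite face023 face013 face012.
exact: addr3_cancel.
Qed.

Lemma tri_int_bound (k d : R) :
  (forall p q : R, in_simplex p q 0 -> `|be (pt p q 0) (x1 - x0) (x2 - x0) - k| <= d) ->
  `|2 * tri_int x0 x1 x2 - k| <= d.
Proof.
move=> kd; rewrite face012.
have cf : continuous (fun z : R * R => F e1 e2 z.1 z.2 0).
  by apply: (continuous_app3 (f := F e1 e2) (@cF e1 e2)); cts.
apply: tri_bound cf _ => p q p0 q0 pq.
have pq1 : in_simplex p q 0 by exact: (in_simplex3 p0 q0 (lexx _) (slack_ge0 pq)).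
by rewrite /F (cptE pq1); exact: kd.
Qed.

End cocycle.

(** * Constant forms with prescribed integrals *)

Section hull.
Variables (R : realType) (N : nat).
Implicit Types (r s t : simplex R N) (a b : 'rV[R]_N -> R) (u v x : 'rV[R]_N).

Lemma big_fset_eq1 r v (F : 'rV[R]_N -> R) : v \in r ->
  \sum_(j <- r) (j == v)%:R * F j = F v.
Proof.
move=> vr; rewrite (bigD1_seq v) ?fset_uniq //= eqxx mul1r big1 ?addr0 // => j /negbTE ->.
by rewrite mul0r.
Qed.

Lemma big_fset_scale1 r v (V : lmodType R) (F : 'rV[R]_N -> V) : v \in r ->
  \sum_(j <- r) (j == v)%:R *: F j = F v.
Proof.
move=> vr; rewrite (bigD1_seq v) ?fset_uniq //= eqxx scale1r big1 ?addr0 // => j /negbTE ->.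
by rewrite scale0r.
Qed.

Lemma big_fset_sub (V : nmodType) t r (F : 'rV[R]_N -> V) : (t `<=` r)%fset ->
  (forall v, v \in r -> v \notin t -> F v = 0) ->
  \sum_(v <- r) F v = \sum_(v <- t) F v.
Proof.
move=> tr F0; rewrite (bigID (fun v => v \in t)) /= addrC big_seq_cond big1 ?add0r; last first.
  by move=> v /andP[vr vt]; exact: F0.
rewrite -big_filter; apply: perm_big; apply: uniq_perm; rewrite ?filter_uniq ?fset_uniq //.
move=> v; rewrite mem_filter andb_idr // => vt; exact: (fsubsetP tr).
Qed.

Lemma vertex_hull r v : v \in r -> hull r v.
Proof.
move=> vr; exists (fun j => (j == v)%:R); split=> [j _||]; first exact: ler0n.
  by under eq_bigr do rewrite -[_%:R]mulr1; rewrite (big_fset_eq1 (fun=> 1)).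
by rewrite big_fset_scale1.
Qed.

Lemma vertex_sub_coef r v v' : v \in r -> v' \in r ->
  \sum_(j <- r) ((j == v')%:R - (j == v)%:R) = 0 :> R /\
  v' - v = \sum_(j <- r) ((j == v')%:R - (j == v)%:R) *: j.
Proof.
move=> vr v'r; split.
  rewrite sumrB; under eq_bigr do rewrite -[_%:R]mulr1.
  under [X in _ - X]eq_bigr do rewrite -[_%:R]mulr1.
  by rewrite !(big_fset_eq1 (fun=> 1)) // subrr.
by under eq_bigr do rewrite scalerBl; rewrite sumrB !big_fset_scale1.
Qed.

Lemma direction_sub r v v' : v \in r -> v' \in r -> direction r (v' - v).
Proof.
move=> vr v'r; exists (fun j => (j == v')%:R - (j == v)%:R).
exact: vertex_sub_coef.
Qed.

Definition extend0 t a := fun v => if v \in t then a v else 0.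

Lemma sum_extend0Z t r a (V : lmodType R) (F : 'rV[R]_N -> V) : (t `<=` r)%fset ->
  \sum_(v <- r) extend0 t a v *: F v = \sum_(v <- t) a v *: F v.
Proof.
move=> tr; rewrite (big_fset_sub tr) => [|v _ /negbTE tv]; last by rewrite /extend0 tv scale0r.
by rewrite big_seq [RHS]big_seq; apply: eq_bigr => v; rewrite /extend0 => ->.
Qed.

Lemma sum_extend0 t r a : (t `<=` r)%fset ->
  \sum_(v <- r) extend0 t a v = \sum_(v <- t) a v.
Proof.
move=> tr; have := sum_extend0Z (V := R^o) a (fun=> 1) tr; rewrite /GRing.scale/=.
by under eq_bigr do rewrite mulr1; under [in RHS]eq_bigr do rewrite mulr1.
Qed.

Lemma hull_face t r : (t `<=` r)%fset -> hull t `<=` hull r.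
Proof.
move=> tr x [a [a0 a1 ->]]; exists (extend0 t a).
split=> [v vr||]; first by rewrite /extend0; case: ifP => // /a0.
  by rewrite sum_extend0.
by rewrite sum_extend0Z.
Qed.

(** Vertices may coincide, hence coefficients that are sums of indicators: degenerate triangles and
    tetrahedra occur in the cocycle identity and in [triangle_hull]. *)
Lemma tetrahedron_hull r x0 x1 x2 x3 (p q z : R) :
  x0 \in r -> x1 \in r -> x2 \in r -> x3 \in r -> in_simplex p q z ->
  hull r (x0 + p *: (x1 - x0) + q *: (x2 - x0) + z *: (x3 - x0)).
Proof.
move=> r0 r1 r2 r3 [p_ge0 q_ge0 z_ge0 pqz].
exists (fun j => (1 - p - q - z) * (j == x0)%:R + p * (j == x1)%:R
  + q * (j == x2)%:R + z * (j == x3)%:R).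
have S v : v \in r -> \sum_(j <- r) (j == v)%:R = 1 :> R.
  by move=> vr; rewrite -[RHS](big_fset_eq1 (fun=> 1) vr); apply: eq_bigr => j _; rewrite mulr1.
split=> [v _||].
- by rewrite !addr_ge0 // mulr_ge0 ?ler0n //; lra.
- by rewrite !big_split /= -!mulr_sumr !S // !mulr1; lra.
- under eq_bigr do rewrite !scalerDl -!scalerA.
  rewrite !big_split /= -!scaler_sumr !big_fset_scale1 //.
  rewrite !scalerBl !scalerBr scale1r !addrA.
  by rewrite [RHS](ACl (1*5*2*6*3*7*4)).
Qed.

Lemma triangle_hull r x0 x1 x2 (p q : R) : x0 \in r -> x1 \in r -> x2 \in r ->
  0 <= p -> 0 <= q -> p + q <= 1 -> hull r (x0 + p *: (x1 - x0) + q *: (x2 - x0)).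
Proof.
move=> r0 r1 r2 p0 q0 pq.
have pq0 : in_simplex p q 0 by exact: (in_simplex3 p0 q0 (lexx _) (slack_ge0 pq)).
by have := tetrahedron_hull r0 r1 r2 r0 pq0; rewrite scale0r addr0.
Qed.

Lemma hull_fset0 x : ~ hull fset0 x.
Proof. by case=> a [_ /esym/eqP]; rewrite big_seq_fset0 oner_eq0. Qed.

End hull.

Section constant_form.
Variables (R : realType) (N : nat) (Phi : 'rV[R]_N -> 'rV[R]_N -> 'rV[R]_N -> R).
Implicit Types (r s t : simplex R N) (a b : 'rV[R]_N -> R) (u v x : 'rV[R]_N).

Definition coefficients r u : 'rV[R]_N -> R :=
  xget (fun=> 0) [set a | \sum_(v <- r) a v = 0 /\ u = \sum_(v <- r) a v *: v].

(** Coefficients with sum zero give [u] as the sum of the [a j *: (j - o)], and the form sought must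
    take the value [2 * Phi o j k] on [j - o] and [k - o]. *)
Definition bilin_sum r (o : 'rV[R]_N) a b : R :=
  \sum_(j <- r) \sum_(k <- r) a j * b k * (2 * Phi o j k).

(* The factor 2 is the inverse of the area of the standard triangle; the choice
   of the base vertex is immaterial by [bilin_sum_base] below. *)
Definition constant_form : whitney_data R N := fun r _ u v =>
  bilin_sum r (head 0 (enum_fset r)) (coefficients r u) (coefficients r v).

Definition cocycle_on r := forall p0 p1 p2 p3,
  p0 \in r -> p1 \in r -> p2 \in r -> p3 \in r ->
  Phi p1 p2 p3 - Phi p0 p2 p3 + Phi p0 p1 p3 - Phi p0 p1 p2 = 0.

Definition degenerate0_on r := forall p q, p \in r -> q \in r ->
  [/\ Phi p q q = 0, Phi p p q = 0 & Phi p q p = 0].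

Variable r : simplex R N.
Hypotheses (r0 : r != fset0) (indep : affinely_independent r).
Hypotheses (coc : cocycle_on r) (deg : degenerate0_on r).

Lemma coefficientsE u a : \sum_(v <- r) a v = 0 -> u = \sum_(v <- r) a v *: v ->
  {in r, coefficients r u =1 a}.
Proof.
move=> a0 ua.
have [b0 ub] : [set a | \sum_(v <- r) a v = 0 /\ u = \sum_(v <- r) a v *: v] (coefficients r u).
  by apply: xgetPex; exists a.
move=> v vr; apply/eqP; rewrite -subr_eq0; apply/eqP.
apply: (indep (a := fun v => coefficients r u v - a v)) => //.
  by rewrite sumrB b0 a0 subrr.
by under eq_bigr do rewrite scalerBl; rewrite sumrB -ub -ua subrr.
Qed.

Lemma eq_bilin_sum o a a' b b' : {in r, a =1 a'} -> {in r, b =1 b'} ->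
  bilin_sum r o a b = bilin_sum r o a' b'.
Proof.
move=> aa bb; rewrite /bilin_sum big_seq [RHS]big_seq; apply: eq_bigr => j jr.
rewrite big_seq [RHS]big_seq; apply: eq_bigr => k kr.
by rewrite aa // bb.
Qed.

(* By the cocycle identity a change of base vertex changes [Phi o j k] by a
   function of [j] plus a function of [k]. *)
Lemma bilin_sum_base o o' a b : o \in r -> o' \in r ->
  \sum_(v <- r) a v = 0 -> \sum_(v <- r) b v = 0 ->
  bilin_sum r o a b = bilin_sum r o' a b.
Proof.
move=> or o'r a0 b0; apply/eqP; rewrite -subr_eq0; apply/eqP.
have -> : bilin_sum r o a b - bilin_sum r o' a b =
    \sum_(j <- r) \sum_(k <- r) a j * b k * (2 * (Phi o o' k - Phi o o' j)).
  rewrite /bilin_sum -sumrB big_seq [RHS]big_seq; apply: eq_bigr => j jr.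
  rewrite -sumrB big_seq [RHS]big_seq; apply: eq_bigr => k kr.
  have := coc or o'r jr kr; nra.
have -> : \sum_(j <- r) \sum_(k <- r) a j * b k * (2 * (Phi o o' k - Phi o o' j)) =
    (\sum_(j <- r) a j) * (\sum_(k <- r) b k * (2 * Phi o o' k))
    - (\sum_(j <- r) a j * (2 * Phi o o' j)) * (\sum_(k <- r) b k).
  rewrite !mulr_suml -sumrB; apply: eq_bigr => j _.
  by rewrite !mulr_sumr -sumrB; apply: eq_bigr => k _; ring.
by rewrite a0 b0 mul0r mulr0 subrr.
Qed.

Let head_mem : head 0 (enum_fset r) \in r.
Proof.
have r_gt0 : (0 < size (enum_fset r))%N by have := r0; rewrite -cardfs_gt0.
by have := mem_nth 0 r_gt0; rewrite nth0.
Qed.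

Lemma constant_formE o u v x a b : o \in r ->
  \sum_(v <- r) a v = 0 -> u = \sum_(v <- r) a v *: v ->
  \sum_(v <- r) b v = 0 -> v = \sum_(v <- r) b v *: v ->
  constant_form r x u v = bilin_sum r o a b.
Proof.
move=> or a0 ua b0 vb; rewrite /constant_form (bilin_sum_base (o' := o)) //.
- by apply: eq_bilin_sum; exact: coefficientsE.
- by rewrite -[RHS]a0 big_seq [RHS]big_seq; apply: eq_bigr => w; exact: coefficientsE.
- by rewrite -[RHS]b0 big_seq [RHS]big_seq; apply: eq_bigr => w; exact: coefficientsE.
Qed.

Lemma constant_form_linear x (k : R) u1 u2 v :
  direction r u1 -> direction r u2 -> direction r v ->
  constant_form r x (k *: u1 + u2) v =
  k * constant_form r x u1 v + constant_form r x u2 v.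
Proof.
move=> [a1 [a10 ->]] [a2 [a20 ->]] [b [b0 ->]].
have E a u : \sum_(v <- r) a v = 0 -> u = \sum_(v <- r) a v *: v ->
    constant_form r x u (\sum_(v <- r) b v *: v) = bilin_sum r (head 0 (enum_fset r)) a b.
  by move=> a0 ->; exact: constant_formE.
rewrite (E a1 _ a10 erefl) (E a2 _ a20 erefl) (E (fun v => k * a1 v + a2 v)).
- rewrite /bilin_sum mulr_sumr -big_split; apply: eq_bigr => j _ /=.
  by rewrite mulr_sumr -big_split; apply: eq_bigr => l _ /=; ring.
- by rewrite big_split /= -mulr_sumr a10 a20 mulr0 addr0.
- rewrite scaler_sumr -big_split; apply: eq_bigr => j _ /=.
  by rewrite scalerA scalerDl.
Qed.

Lemma constant_form_alternating x u v : direction r u -> direction r v ->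
  constant_form r x u v = - constant_form r x v u.
Proof.
move=> [a [a0 ->]] [b [b0 ->]]; set o := head 0 (enum_fset r).
rewrite (constant_formE x head_mem a0 erefl b0 erefl) (constant_formE x head_mem b0 erefl a0 erefl).
rewrite /bilin_sum exchange_big -sumrN big_seq [RHS]big_seq; apply: eq_bigr => j jr /=.
rewrite -sumrN big_seq [RHS]big_seq; apply: eq_bigr => k kr.
(* The cocycle identity on [o, k, j, k] loses its degenerate terms and leaves the antisymmetry of
   [Phi o]. *)
have := coc head_mem kr jr kr; rewrite -/o.
have [-> _ _] := deg head_mem kr; have [_ _ ->] := deg kr jr => E.
have -> : Phi o k j = - Phi o j k by lra.
by ring.
Qed.

Lemma constant_form_vertices x p q1 q2 : p \in r -> q1 \in r -> q2 \in r ->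
  constant_form r x (q1 - p) (q2 - p) = 2 * Phi p q1 q2.
Proof.
move=> pr q1r q2r.
have [E1 E1'] := vertex_sub_coef pr q1r; have [E2 E2'] := vertex_sub_coef pr q2r.
rewrite (constant_formE x pr E1 E1' E2 E2').
transitivity (\sum_(j <- r) (j == q1)%:R * (\sum_(k <- r) (k == q2)%:R * (2 * Phi p j k))).
  rewrite /bilin_sum big_seq [RHS]big_seq; apply: eq_bigr => j jr.
  rewrite mulr_sumr big_seq [RHS]big_seq; apply: eq_bigr => k kr.
  (* With [p] as base vertex, the terms that come from the coefficient [-1] at [p] are
     degenerate. *)
  case: (eqVneq j p) => [->|_]; last rewrite subr0.
    by have [_ -> _] := deg pr kr; rewrite !mulr0.
  case: (eqVneq k p) => [->|_]; last by rewrite subr0 -mulrA.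
  by have [_ _ ->] := deg pr jr; rewrite !mulr0.
by rewrite (big_fset_eq1 (fun j => \sum_(k <- r) _)) // (big_fset_eq1 (fun k => 2 * Phi p q1 k)).
Qed.

End constant_form.

(** * Existence of the constant approximation *)

Section approximation.
Variables (R : realType) (N : nat).
Implicit Types (r s t : simplex R N) (u v x y p : 'rV[R]_N).

Lemma Ck_on_cst (V W : normedModType R) k (U : set V) (a : W) : Ck_on k U (cst a).
Proof.
elim: k a => [|k IH] a /=; first by move=> x _; exact: cvg_cst.
split=> [x _|v]; first exact: differentiable_cst.
rewrite (_ : 'D_v (cst a) = cst 0 :> (V -> W)) //.
by apply/funext => y; rewrite derive_cst.
Qed.

Variable al : whitney_data R N.

(** The form is evaluated on the triangle itself rather than on a simplex containing it, so one
    function of three points serves all simplices and [constant_form] agrees on common faces. *)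
Definition periods (p0 p1 p2 : 'rV[R]_N) : R := integral2 al [fset p0; p1; p2]%fset p0 p1 p2.

Lemma integral2_const (be : whitney_data R N) t (a b c : 'rV[R]_N) (k : R) :
  (forall p q : R, 0 <= p -> 0 <= q -> p + q <= 1 ->
    be t (a + p *: (b - a) + q *: (c - a)) (b - a) (c - a) = k) ->
  integral2 be t a b c = k / 2.
Proof.
move=> E; transitivity (tri 1 (fun _ _ => k)); first exact: eq_tri.
by rewrite tri_cst ?ler01 // expr1n mul1r.
Qed.

Variable L : set (simplex R N).
Hypothesis L0 : forall r, L r -> r != fset0.
Hypothesis L_indep : forall r, L r -> affinely_independent r.
Hypothesis L_coc : forall r, L r -> cocycle_on periods r.
Hypothesis L_deg : forall r, L r -> degenerate0_on periods r.

Lemma constant_form_whitney : whitney_form L (constant_form periods).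
Proof.
split.
- move=> r x Lr _ k u1 u2 v; apply: constant_form_linear; [exact: L0|exact: L_indep|exact: L_coc].
- move=> r x Lr _ u v; apply: constant_form_alternating;
  [exact: L0|exact: L_indep|exact: L_coc|exact: L_deg].
- move=> r x Lr hx u v _ _; exists (cst (constant_form periods r x u v)).
  by exists setT; split => // [|k]; [exact: openT|exact: Ck_on_cst].
- move=> s1 s2 x Ls1 Ls2 hx u v [a [a0 ->]] [b [b0 ->]].
  have s0 : (s1 `&` s2)%fset != fset0.
    by apply/eqP => s0; apply: (@hull_fset0 R N x); rewrite -s0.
  have /fset0Pn[p0] := s0; rewrite in_fsetI => /andP[p01 p02].
  pose t := (s1 `&` s2)%fset.
  have t1 : (t `<=` s1)%fset by exact: fsubsetIl.
  have t2 : (t `<=` s2)%fset by exact: fsubsetIr.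
  (* With the base vertex and the coefficients taken from the common face, the value involves the
     face only. *)
  have E s : L s -> (t `<=` s)%fset -> p0 \in s ->
      constant_form periods s x (\sum_(v <- t) a v *: v) (\sum_(v <- t) b v *: v)
      = bilin_sum periods t p0 a b.
    move=> Ls ts os; rewrite (@constant_formE _ _ _ _ (L0 Ls) (L_indep Ls) (L_coc Ls) p0 _ _ x
      (extend0 t a) (extend0 t b)) //;
      rewrite ?sum_extend0 ?sum_extend0Z //.
    rewrite /bilin_sum (big_fset_sub ts); last first.
      by move=> j _ /negbTE jt; rewrite big1 // => k _; rewrite /extend0 jt !mul0r.
    rewrite big_seq [RHS]big_seq; apply: eq_bigr => j jt.
    rewrite (big_fset_sub ts); last first.
      by move=> k _ /negbTE kt; rewrite /extend0 kt mulr0 mul0r.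
    rewrite big_seq [RHS]big_seq; apply: eq_bigr => k kt.
    by rewrite /extend0 jt kt.
  by rewrite !E.
Qed.

Lemma constant_form_integral2 t a b c : L t -> t = [fset a; b; c]%fset ->
  integral2 (constant_form periods) t a b c = integral2 al t a b c.
Proof.
move=> Lt tE.
have [at_ bt ct] : [/\ a \in t, b \in t & c \in t] by rewrite tE !inE !eqxx ?orbT.
rewrite (@integral2_const _ _ _ _ _ (2 * periods a b c)); last first.
  move=> p q _ _ _; apply: constant_form_vertices => //;
   [exact: L0|exact: L_indep|exact: L_coc|exact: L_deg].
by rewrite /periods -tE mulrAC divff ?mul1r.
Qed.

End approximation.

(** * Uniqueness of the constant approximation *)

Section uniqueness.
Variables (R : realType) (N : nat) (L : set (simplex R N)).
Variables (om al : whitney_data R N).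
Hypothesis L_face : forall r t, L r -> t != fset0 -> (t `<=` r)%fset -> L t.
Hypothesis L_deg : forall r, L r -> degenerate0_on (periods om) r.
Hypotheses (al_whitney : whitney_form L al) (al_const : piecewise_constant L al).
Hypothesis al_int : forall t a b c, L t -> #|` t| = 3%N -> t = [fset a; b; c]%fset ->
  integral2 al t a b c = integral2 om t a b c.

(** Two edges with a common origin span a 2-face of [r], which belongs to [L]. On it the form is a
    constant fixed by its integral, and compatibility on faces carries this value over to [r].
    Coinciding vertices are covered by [L_deg]. *)
Lemma constant_approximation_vertices r x a b c : L r -> hull r x ->
  a \in r -> b \in r -> c \in r ->
  al r x (b - a) (c - a) = 2 * periods om a b c.
Proof.
move=> Lr rx ar br cr; have [lin alt _ comp] := al_whitney.
have dba := direction_sub ar br; have dca := direction_sub ar cr.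
have al0 v : direction r v -> al r x 0 v = 0.
  move=> dv; have d0 : direction r 0 by rewrite -(subrr a); exact: direction_sub.
  have := lin r x Lr rx 1 0 0 v d0 d0 dv; rewrite scaler0 addr0 mul1r => E; lra.
case: (eqVneq b a) => [->|ba].
  have [_ -> _] := L_deg Lr ar cr; rewrite subrr mulr0; exact: al0.
case: (eqVneq c a) => [->|ca].
  have [_ _ ->] := L_deg Lr ar br; rewrite subrr mulr0 alt //; first by rewrite al0 ?oppr0.
  by rewrite -(subrr a); exact: direction_sub.
case: (eqVneq c b) => [->|cb].
  have [-> _ _] := L_deg Lr ar br; rewrite mulr0.
  have := alt r x Lr rx (b - a) (b - a) dba dba => E; lra.
pose t : simplex R N := [fset a; b; c]%fset.
have tr : (t `<=` r)%fset.
  by apply/fsubsetP => v; rewrite !inE => /orP[/orP[]|] /eqP ->.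
have [at_ bt ct] : [/\ a \in t, b \in t & c \in t] by rewrite /t !inE !eqxx ?orbT.
have Lt : L t by apply: (L_face Lr) => //; apply/fset0Pn; exists a.
have t3 : #|` t| = 3%N.
  by rewrite /t fsetUC cardfsU1 cardfs2 !inE (negbTE ca) (negbTE cb) eq_sym ba.
have := al_int Lt t3 erefl; rewrite -/(periods om a b c).
rewrite (@integral2_const _ _ al t a b c (al r x (b - a) (c - a))) => [E|p q p0 q0 pq].
  by rewrite -E mulrC divfK.
have ty := triangle_hull at_ bt ct p0 q0 pq.
set y := (X in hull t X) in ty *.
have rt : (r `&` t)%fset = t by apply/fsetIidPr.
rewrite -(comp r t y Lr Lt) ?rt //; try exact: direction_sub.
by apply: al_const => //; exact: (hull_face tr).
Qed.

End uniqueness.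

(** * Pull-backs of closed forms *)

Section schwarz.
Variables (R : realType) (V : normedModType R).

(** Two applications of the mean value theorem: along [u] to the increment of [f] by [s *: e], then
    along [e] to ['D_u f]. *)
Lemma mixed_difference (f : V -> R) (U : set V) (x e u : V) (s : R) : 0 < s ->
  (forall y, U y -> derivable f y u) -> (forall y, U y -> derivable ('D_u f) y e) ->
  (forall a b : R, 0 <= a <= s -> 0 <= b <= s -> U (x + a *: e + b *: u)) ->
  exists a b : R, [/\ 0 <= a <= s, 0 <= b <= s &
    f (x + s *: e + s *: u) - f (x + s *: u) - f (x + s *: e) + f x =
    s ^+ 2 * 'D_e ('D_u f) (x + a *: e + b *: u)].
Proof.
move=> s0 df ddf HU.
have ss : 0 <= s <= s by rewrite lexx ltW.
have zs : 0 <= (0 : R) <= s by rewrite lexx ltW.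
pose g (b : R) := f (x + s *: e + b *: u) - f (x + b *: u).
have dg b : 0 <= b <= s -> is_derive b 1 g ('D_u f (x + s *: e + b *: u) - 'D_u f (x + b *: u)).
  move=> bs; have H1 := is_derive_line (df _ (HU s b ss bs)).
  have H2 : is_derive b (1 : R) (fun b => f (x + b *: u)) ('D_u f (x + b *: u)).
    by apply: is_derive_line; apply: df; rewrite -[x in x + _](addr0) -(scale0r e); exact: HU.
  exact: is_deriveB.
have cg : {within `[0, s], continuous g}.
  apply: derivable_within_continuous => b; rewrite in_itv/= => bs.
  by have [] := dg b bs.
have dg' : forall b, b \in `]0, s[ ->
  is_derive b 1 g ('D_u f (x + s *: e + b *: u) - 'D_u f (x + b *: u)).
  by move=> b; rewrite in_itv/= => /andP[b0 bs]; apply: dg; rewrite !ltW.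
have [b] := MVT s0 dg' cg; rewrite in_itv/= subr0 => /andP[b0 bs] gE.
have {b0 bs}bs : 0 <= b <= s by rewrite !ltW.
pose k (a : R) := 'D_u f (x + b *: u + a *: e).
have U' a : 0 <= a <= s -> U (x + b *: u + a *: e) by move=> sa; rewrite addrAC; exact: HU.
have dk a : 0 <= a <= s -> is_derive a 1 k ('D_e ('D_u f) (x + b *: u + a *: e)).
  by move=> sa; apply: is_derive_line; apply: ddf; exact: U'.
have ck : {within `[0, s], continuous k}.
  apply: derivable_within_continuous => a; rewrite in_itv/= => sa.
  by have [] := dk a sa.
have dk' : forall a, a \in `]0, s[ -> is_derive a 1 k ('D_e ('D_u f) (x + b *: u + a *: e)).
  by move=> a; rewrite in_itv/= => /andP[a0 sa]; apply: dk; rewrite !ltW.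
have [a] := MVT s0 dk' ck; rewrite in_itv/= subr0 => /andP[a0 sa] kE.
exists a, b; split=> //; first by rewrite !ltW.
transitivity (g s - g 0); first by rewrite /g scale0r !addr0; ring.
rewrite gE [x + s *: e + _]addrAC.
have -> : 'D_u f (x + b *: u + s *: e) - 'D_u f (x + b *: u) = k s - k 0.
  by rewrite /k scale0r addr0.
by rewrite kE [x + _ + _]addrAC -mulrA mulrC expr2.
Qed.

(** The second difference is symmetric in [e] and [u], so by [mixed_difference] the two mixed
    derivatives agree at two points arbitrarily close to [x]; continuity at [x] concludes. *)
Lemma mixed_derivatives_eq (f : V -> R) (U : set V) (x e u : V) : open U -> U x ->
  (forall y, U y -> derivable f y u) -> (forall y, U y -> derivable ('D_u f) y e) ->
  (forall y, U y -> derivable f y e) -> (forall y, U y -> derivable ('D_e f) y u) ->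
  {for x, continuous ('D_e ('D_u f))} -> {for x, continuous ('D_u ('D_e f))} ->
  'D_e ('D_u f) x = 'D_u ('D_e f) x.
Proof.
move=> oU Ux d1 d2 d3 d4 c1 c2; apply/eqP; rewrite -subr_eq0 -normr_le0.
apply/ler_addgt0Pl => eps eps0; rewrite addr0.
have [r /= r0 rP] : nbhs_ball x (U `&` [set y | `|'D_e ('D_u f) x - 'D_e ('D_u f) y| <= eps / 2] `&`
    [set y | `|'D_u ('D_e f) x - 'D_u ('D_e f) y| <= eps / 2]).
  apply/nbhs_ballP; apply: filterI; first apply: filterI.
  - exact: open_nbhs_nbhs.
  - by move/cvgrPdist_le : c1; apply; rewrite divr_gt0.
  - by move/cvgrPdist_le : c2; apply; rewrite divr_gt0.
have [s s0 H] : exists2 s : R, 0 < s & forall a b : R, 0 <= a <= s -> 0 <= b <= s ->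
    ball x r (x + a *: e + b *: u).
  have D0 : 0 < `|e| + `|u| + 1 by rewrite ltr_wpDl ?addr_ge0.
  (* This side length keeps the whole parallelogram in the ball of radius [r]; the summand 1 covers
     [e = u = 0]. *)
  pose s := r / (2 * (`|e| + `|u| + 1)).
  have s0 : 0 < s by rewrite divr_gt0 // mulr_gt0.
  exists s => // a b /andP[a0 sa] /andP[b0 sb].
  rewrite -ball_normE /= -addrA opprD addNKr normrN.
  rewrite (le_lt_trans (ler_normD _ _)) // !normrZ !ger0_norm //.
  apply: (@le_lt_trans _ _ (s * (`|e| + `|u|))); first by rewrite mulrDr lerD // ler_wpM2r.
  apply: (@lt_le_trans _ _ (s * (`|e| + `|u| + 1))); first by rewrite ltr_pM2l // ltrDl.
  by rewrite /s invfM mulrA -mulrA mulVf ?gt_eqF // mulr1 ler_pdivrMr // ler_pMr ?ler1n.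
have [a1 [b1 [ha1 hb1 E1]]] := mixed_difference s0 d1 d2 (fun a b ha hb => (rP _ (H a b ha
  hb)).1.1).
have H' (a b : R) : 0 <= a <= s -> 0 <= b <= s -> U (x + a *: u + b *: e).
  by move=> ha hb; rewrite addrAC; exact: (rP _ (H b a hb ha)).1.1.
have [a2 [b2 [ha2 hb2 E2]]] := mixed_difference s0 d3 d4 H'.
have [[_ B1] _] := rP _ (H _ _ ha1 hb1).
have [_ B2] := rP _ (H _ _ hb2 ha2).
rewrite /= in B1 B2.
have E : 'D_e ('D_u f) (x + a1 *: e + b1 *: u) = 'D_u ('D_e f) (x + b2 *: e + a2 *: u).
  apply: (@mulfI _ (s ^+ 2)); first by rewrite expf_neq0 // gt_eqF.
  apply: etrans (esym E1) _; rewrite (addrAC x (b2 *: e)); apply: etrans E2.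
  by rewrite (addrAC x (s *: u)); congr (_ + _); exact: addrAC.
rewrite E in B1; rewrite distrC in B2.
by apply: le_trans (ler_distD _ _ _) _; rewrite [leRHS](splitr eps); exact: lerD B1 B2.
Qed.

End schwarz.

Section form_eval.
Variables (R : realType) (n : nat).
Implicit Types (B : 'M[R]_n) (u v : 'rV[R]_n).

Lemma form_evalE B u v : form_eval B u v = \sum_i \sum_j u 0 i * B i j * v 0 j.
Proof.
rewrite /form_eval mxE exchange_big /=; apply: eq_bigr => j _.
by rewrite !mxE mulr_suml.
Qed.

Lemma form_evalDl B u1 u2 v (a : R) :
  form_eval B (a *: u1 + u2) v = a * form_eval B u1 v + form_eval B u2 v.
Proof. by rewrite /form_eval !mulmxDl -!scalemxAl !mxE. Qed.

Lemma form_evalC B u v : form_eval B u v = form_eval B^T v u.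
Proof.
have E : v *m B^T *m u^T = (u *m B *m v^T)^T by rewrite !trmx_mul trmxK mulmxA.
by rewrite /form_eval E [RHS]mxE.
Qed.

Lemma alternatingE B u v : alternating B -> form_eval B u v = - form_eval B v u.
Proof. by move=> aB; rewrite form_evalC aB /form_eval mulmxN mulNmx mxE. Qed.

Lemma form_eval_pull m (J : 'M[R]_(m, n)) B (u v : 'rV[R]_m) :
  form_eval (form_pull J B) u v = form_eval B (u *m J) (v *m J).
Proof. by rewrite /form_eval /form_pull trmx_mul !mulmxA. Qed.

(* [p_i] is a first and [s_ij] a second derivative of a map, with [s_ij] the
   derivative of [p_j] in the direction [i]. *)
Lemma closed_cancel B p1 p2 p3 s12 s21 s13 s31 s23 s32 (c1 c2 c3 : R) :
  alternating B -> s21 = s12 -> s31 = s13 -> s32 = s23 -> c1 + c2 + c3 = 0 ->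
  (c1 + form_eval B s12 p3 + form_eval B p2 s13)
  + (c2 + form_eval B s23 p1 + form_eval B p3 s21)
  + (c3 + form_eval B s31 p2 + form_eval B p1 s32) = 0.
Proof.
move=> aB -> -> -> <-.
rewrite (alternatingE p2 s13 aB) (alternatingE p3 s12 aB) (alternatingE p1 s23 aB).
ring.
Qed.

Variables (V : normedModType R).
Implicit Types (x e : V).

Lemma is_derive_form_eval (B : V -> 'M[R]_n) (p q : V -> 'rV[R]_n) x e dB dp dq :
  is_derive x e B dB -> is_derive x e p dp -> is_derive x e q dq ->
  is_derive x e (fun y => form_eval (B y) (p y) (q y))
    (form_eval dB (p x) (q x) + form_eval (B x) dp (q x) + form_eval (B x) (p x) dq).
Proof.
have coord m l (M : V -> 'M[R]_(m, l)) dM i j : is_derive x e M dM ->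
    is_derive x e (fun y => M y i j) (dM i j).
  move=> [dM1 dME]; have := dM1; rewrite derivable_mxP => /(_ i j) dMij.
  by apply: DeriveDef => //; rewrite -dME derive_mx // mxE.
move=> HB Hp Hq.
rewrite (_ : (fun y => _) = \sum_i \sum_j (fun y => p y 0 i * B y i j * q y 0 j)); last first.
  apply/funext => y; rewrite form_evalE fct_sumE; apply: eq_bigr => i _.
  by rewrite fct_sumE.
rewrite !form_evalE -!big_split /=.
apply: is_derive_sum => i; rewrite -!big_split /=; apply: is_derive_sum => j.
have Hpi := coord _ _ _ _ 0 i Hp; have Hqj := coord _ _ _ _ 0 j Hq.
have HBij := coord _ _ _ _ i j HB.
apply: is_derive_eq; rewrite /GRing.scale /=; ring.
Qed.

End form_eval.

Lemma continuous_bigsum (R : realType) (T : topologicalType) (W : normedModType R)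
    (I : Type) (r : seq I) (F : I -> T -> W) x :
  (forall i, {for x, continuous (F i)}) ->
  {for x, continuous (fun y => \sum_(i <- r) F i y)}.
Proof.
by move=> cF; apply: (@cvg_big _ _ +%R) => [|i _]; [exact: add_continuous|exact: cF].
Qed.

Lemma continuous_form_eval (R : realType) n (T : topologicalType) (B : T -> 'M[R]_n) (p q : T ->
  'rV[R]_n) x :
  {for x, continuous B} -> {for x, continuous p} -> {for x, continuous q} ->
  {for x, continuous (fun y => form_eval (B y) (p y) (q y))}.
Proof.
move=> cB cp cq.
have coord m l (M : T -> 'M[R]_(m, l)) i j : {for x, continuous M} ->
    {for x, continuous (fun y => M y i j)}.
  move=> cM; apply: (@continuous_comp _ _ _ M (fun A : 'M[R]_(m, l) => A i j)) => //.
  exact: coord_continuous.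
rewrite (_ : (fun y => _) = (fun y => \sum_i \sum_j (p y 0 i * B y i j * q y 0 j))); last first.
  by apply/funext => y; rewrite form_evalE.
apply: (@continuous_bigsum R T R^o) => i; apply: (@continuous_bigsum R T R^o) => j.
by apply: cvgM; [apply: cvgM|]; exact: coord.
Qed.

Lemma near_eq_continuous (T U : topologicalType) (f g : T -> U) x :
  (\forall y \near x, f y = g y) -> {for x, continuous f} -> {for x, continuous g}.
Proof.
move=> E cf; have fg : f x = g x := nbhs_singleton E.
suff : g @ x --> f x by rewrite fg.
by apply: cvg_trans cf; exact: near_eq_cvg.
Qed.

(** * Regularity and closedness of a pulled-back form *)

Section pulled_back_form.
Variables (R : realType) (n : nat) (V : normedModType R).
Variables (U : set V) (O : set 'rV[R]_n) (F : V -> 'rV[R]_n) (W : 'rV[R]_n -> 'M[R]_n).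
Hypotheses (oU : open U) (FU : forall x, U x -> O (F x)).
Hypotheses (sF : smooth_on U F) (sW : smooth_on O W).
Hypothesis W_alt : forall y, O y -> alternating (W y).
Hypothesis W_closed : forall y, O y -> forall u1 u2 u3, ext_deriv W y u1 u2 u3 = 0.

Definition pulled_form (x u v : V) : R := form_eval (W (F x)) ('d F x u) ('d F x v).

Let dF x : U x -> differentiable F x.
Proof. by have [H _] := sF 1; exact: H. Qed.

Let dW y : O y -> differentiable W y.
Proof. by have [H _] := sW 1; exact: H. Qed.

Let dDF u x : U x -> differentiable ('D_u F) x.
Proof. by have [_ H] := sF 2; have [H' _] := H u; exact: H'. Qed.

Let cDF u x : U x -> {for x, continuous ('D_u F)}.
Proof. by move=> Ux; apply: differentiable_continuous; exact: dDF. Qed.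

Let cDDF e u x : U x -> {for x, continuous ('D_e ('D_u F))}.
Proof. by have [_ H] := sF 2; have [_ H'] := H u; exact: H'. Qed.

Let cDW e y : O y -> {for y, continuous ('D_e W)}.
Proof. by have [_ H] := sW 1; exact: H. Qed.

Let cF x : U x -> {for x, continuous F}.
Proof. by move=> Ux; apply: differentiable_continuous; exact: dF. Qed.

Let nearU x : U x -> \forall y \near x, U y.
Proof. by move=> Ux; exact: open_nbhs_nbhs. Qed.

Let pulled_formE u v x : U x -> pulled_form x u v = form_eval (W (F x)) ('D_u F x) ('D_v F x).
Proof. by move=> Ux; rewrite /pulled_form !deriveE //; exact: dF. Qed.

Let near_pulled_form u v x : U x ->
  \forall y \near x, pulled_form y u v = form_eval (W (F y)) ('D_u F y) ('D_v F y).
Proof. by move=> Ux; apply: filterS (nearU Ux) => y Uy; exact: pulled_formE. Qed.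

Lemma pulled_form_linear x a u1 u2 v :
  pulled_form x (a *: u1 + u2) v = a * pulled_form x u1 v + pulled_form x u2 v.
Proof. by rewrite /pulled_form linearP form_evalDl. Qed.

Lemma pulled_form_alt x u v : U x -> pulled_form x u v = - pulled_form x v u.
Proof. by move=> Ux; apply: alternatingE; apply: W_alt; exact: FU. Qed.

Lemma pulled_form_continuous u v x : U x -> {for x, continuous (fun y => pulled_form y u v)}.
Proof.
move=> Ux.
have E : \forall y \near x, form_eval (W (F y)) ('D_u F y) ('D_v F y) = pulled_form y u v.
  by apply: filterS (near_pulled_form u v Ux) => y ->.
apply: (near_eq_continuous E).
apply: continuous_form_eval; [|exact: cDF..].
apply: (@continuous_comp _ _ _ F W); first exact: cF.
by apply: differentiable_continuous; apply: dW; exact: FU.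
Qed.

Let dpull e u v x := form_eval ('D_('D_e F x) W (F x)) ('D_u F x) ('D_v F x)
  + form_eval (W (F x)) ('D_e ('D_u F) x) ('D_v F x)
  + form_eval (W (F x)) ('D_u F x) ('D_e ('D_v F) x).

Let is_derive_pulled_form e u v x : U x ->
  is_derive x e (fun y => pulled_form y u v) (dpull e u v x).
Proof.
move=> Ux.
have E : \forall y \near x, form_eval (W (F y)) ('D_u F y) ('D_v F y) = pulled_form y u v.
  by apply: filterS (near_pulled_form u v Ux) => y ->.
apply: (near_eq_is_derive E).
apply: is_derive_form_eval.
- have d : differentiable (W \o F) x by apply: differentiable_comp; [exact: dF|exact/dW/FU].
  apply: DeriveDef; first exact: diff_derivable.
  rewrite [LHS]deriveE // [RHS]deriveE; last exact/dW/FU.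
  rewrite diff_comp /=; [|exact: dF|exact/dW/FU].
  by rewrite [in RHS]deriveE //; exact: dF.
- by apply/derivableP; apply: diff_derivable; exact: dDF.
- by apply/derivableP; apply: diff_derivable; exact: dDF.
Qed.

Lemma pulled_form_derivable u v e x : U x -> derivable (fun y => pulled_form y u v) x e.
Proof. by move=> Ux; have [] := is_derive_pulled_form e u v Ux. Qed.

Lemma pulled_form_continuous_derive u v e x : U x ->
  {for x, continuous ('D_e (fun y => pulled_form y u v))}.
Proof.
move=> Ux.
have dE y : U y -> 'D_e (fun y => pulled_form y u v) y = dpull e u v y.
  by move=> Uy; have [] := is_derive_pulled_form e u v Uy.
have E : \forall y \near x, dpull e u v y = 'D_e (fun y => pulled_form y u v) y.
  by apply: filterS (nearU Ux) => y Uy; rewrite dE.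
apply: (near_eq_continuous E).
have cWF : {for x, continuous (W \o F)}.
  apply: (@continuous_comp _ _ _ F W); first exact: cF.
  by apply: differentiable_continuous; apply: dW; exact: FU.
apply: cvgD; first apply: cvgD.
- apply: (@continuous_form_eval R n V (fun y => 'D_('D_e F y) W (F y)) ('D_u F) ('D_v F));
  [|exact: cDF..].
  (* The direction of this derivative of [W] moves with [y]; expanding it in the standard basis
     leaves derivatives in fixed directions, whose continuity is known. *)
  pose S y := \sum_(i < n) ('D_e F y) 0 i *: 'D_(delta_mx 0 i) W (F y).
  have SE y : U y -> 'D_('D_e F y) W (F y) = S y.
    move=> Uy; rewrite deriveE; last exact/dW/FU.
    rewrite [X in 'd _ _ X]row_sum_delta linear_sum; apply: eq_bigr => i _.
    by rewrite linearZ -deriveE //; exact/dW/FU.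
  have SE' : \forall y \near x, S y = 'D_('D_e F y) W (F y).
    by apply: filterS (nearU Ux) => y Uy; rewrite SE.
  apply: (near_eq_continuous SE').
  apply: continuous_bigsum => i; apply: cvgZ.
    apply: (@continuous_comp _ _ _ ('D_e F) (fun A : 'rV[R]_n => A 0 i)); first exact: cDF.
    exact: coord_continuous.
  apply: (@continuous_comp _ _ _ F ('D_(delta_mx 0 i) W)); first exact: cF.
  by apply: cDW; exact: FU.
- apply: (@continuous_form_eval R n V (W \o F) ('D_e ('D_u F)) ('D_v F));
    [exact: cWF|exact: cDDF|exact: cDF].
- apply: (@continuous_form_eval R n V (W \o F) ('D_u F) ('D_e ('D_v F)));
    [exact: cWF|exact: cDF|exact: cDDF].
Qed.

Let coordD v i y : U y -> 'D_v (fun z => F z 0 i) y = ('D_v F y) 0 i.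
Proof. by move=> Uy; rewrite derive_mx ?mxE //; exact/diff_derivable/dF. Qed.

Let derivable_coord v i y : U y -> derivable (fun z => F z 0 i) y v.
Proof.
move=> Uy; have /derivable_mxP : derivable F y v by exact/diff_derivable/dF.
exact.
Qed.

Let near_coordD v i y : U y -> \forall z \near y, ('D_v F z) 0 i = 'D_v (fun z => F z 0 i) z.
Proof. by move=> Uy; apply: filterS (nearU Uy) => z Uz; rewrite coordD. Qed.

Let coordDD e u i y : U y -> is_derive y e ('D_u (fun z => F z 0 i)) (('D_e ('D_u F) y) 0 i).
Proof.
move=> Uy; apply: (near_eq_is_derive (near_coordD u i Uy)).
have d : derivable ('D_u F) y e by exact/diff_derivable/dDF.
apply: DeriveDef; first by have /derivable_mxP := d; exact.
by rewrite [in RHS]derive_mx // mxE.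
Qed.

(** [mixed_derivatives_eq] concerns real functions, so it is applied to each coordinate of [F]. *)
Let derive2_sym e u x : U x -> 'D_e ('D_u F) x = 'D_u ('D_e F) x.
Proof.
move=> Ux; apply/rowP => i.
have E v w y : U y -> 'D_v ('D_w (fun z => F z 0 i)) y = ('D_v ('D_w F) y) 0 i.
  by move=> Uy; have [] := coordDD v w i Uy.
have cE v w : {for x, continuous ('D_v ('D_w (fun z => F z 0 i)))}.
  have H : \forall y \near x, ('D_v ('D_w F) y) 0 i = 'D_v ('D_w (fun z => F z 0 i)) y.
    by apply: filterS (nearU Ux) => y Uy; rewrite E.
  apply: (near_eq_continuous H).
  apply: (@continuous_comp _ _ _ ('D_v ('D_w F)) (fun A : 'rV[R]_n => A 0 i)); first exact: cDDF.
  exact: coord_continuous.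
apply: etrans (esym (E e u x Ux)) _; apply: etrans _ (E u e x Ux).
apply: (mixed_derivatives_eq oU Ux).
- by move=> y; exact: derivable_coord.
- by move=> y Uy; have [] := coordDD e u i Uy.
- by move=> y; exact: derivable_coord.
- by move=> y Uy; have [] := coordDD u e i Uy.
- exact: cE.
- exact: cE.
Qed.

(** In the cyclic sum the terms with second derivatives of [F] cancel in pairs by their symmetry;
    what remains is the exterior derivative of [W] on the image vectors. *)
Lemma pulled_form_closed x u1 u2 u3 : U x ->
  'D_u1 (fun y => pulled_form y u2 u3) x + 'D_u2 (fun y => pulled_form y u3 u1) x
  + 'D_u3 (fun y => pulled_form y u1 u2) x = 0.
Proof.
move=> Ux.
have [_ ->] := is_derive_pulled_form u1 u2 u3 Ux.
have [_ ->] := is_derive_pulled_form u2 u3 u1 Ux.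
have [_ ->] := is_derive_pulled_form u3 u1 u2 Ux.
rewrite /dpull; apply: closed_cancel.
- by apply: W_alt; exact: FU.
- exact: derive2_sym.
- exact: derive2_sym.
- exact: derive2_sym.
- by have := W_closed (FU Ux) ('D_u1 F x) ('D_u2 F x) ('D_u3 F x).
Qed.

End pulled_back_form.

(** * Smooth extensions *)

Section directional.
Variables (R : realType) (N : nat) (W : normedModType R).

Lemma hull_segment (s : simplex R N) x v (t : R) : hull s x -> v \in s ->
  0 <= t <= 1 -> hull s (t *: (v - x) + x).
Proof.
move=> [a [a0 a1 ->]] vs /andP[t0 t1].
exists (fun j => t * (j == v)%:R + (1 - t) * a j); split.
- by move=> j js; rewrite addr_ge0 // mulr_ge0 ?ler0n ?subr_ge0 ?a0.
- rewrite big_split /= -!mulr_sumr a1.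
  have -> : \sum_(j <- s) (j == v)%:R = 1 :> R.
    by rewrite -[RHS](big_fset_eq1 (fun=> 1) vs); apply: eq_bigr => j _; rewrite mulr1.
  by rewrite !mulr1 subrKC.
- under [RHS]eq_bigr do rewrite scalerDl -!scalerA.
  rewrite big_split /= -!scaler_sumr big_fset_scale1 //.
  by rewrite scalerBr scalerBl scale1r -addrA; congr (_ + _); rewrite addrC.
Qed.

Lemma eq_linear_direction (f g : {linear 'rV[R]_N -> W}) (s : simplex R N) x :
  (forall v, v \in s -> f (v - x) = g (v - x)) ->
  forall a : 'rV[R]_N -> R, \sum_(v <- s) a v = 0 ->
  f (\sum_(v <- s) a v *: v) = g (\sum_(v <- s) a v *: v).
Proof.
move=> fg a a0.
have -> : \sum_(v <- s) a v *: v = \sum_(v <- s) a v *: (v - x).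
  under [RHS]eq_bigr do rewrite scalerBr.
  by rewrite sumrB -scaler_suml a0 scale0r subr0.
rewrite !linear_sum big_seq [RHS]big_seq; apply: eq_bigr => v vs.
by rewrite !linearZ fg.
Qed.

(** [f] and [g] agree on the simplex only, and [x] may lie on its boundary. The segments from [x] to
    the vertices stay in the simplex, so the one-sided derivatives along the vectors [v - x] agree,
    and these span [direction s]. *)
Lemma eq_diff_direction (s : simplex R N) x (f g : 'rV[R]_N -> W) :
  hull s x -> differentiable f x -> differentiable g x ->
  (\forall y \near x, hull s y -> f y = g y) ->
  forall u, direction s u -> 'd f x u = 'd g x u.
Proof.
move=> sx df dg fg.
have fgx : f x = g x by exact: (nbhs_singleton fg).
have Hv v : v \in s -> 'd f x (v - x) = 'd g x (v - x).
  move=> vs; rewrite -(deriveE _ df) -(deriveE _ dg).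
  have cvgq (k : 'rV[R]_N -> W) : differentiable k x ->
      h^-1 *: (k (h *: (v - x) + x) - k x) @[h --> (0 : R)^'+] --> 'D_(v - x) k x.
    move=> dk; have dk' : derivable k x (v - x) by exact: diff_derivable.
    by apply: cvg_dnbhs_at_right; exact: dk'.
  apply: (cvg_unique _ (cvgq f df)); first exact: norm_hausdorff.
  apply: cvg_trans (cvgq g dg); apply: near_eq_cvg.
  have c0 : h *: (v - x) + x @[h --> (0 : R)] --> x.
    suff : h *: (v - x) + x @[h --> (0 : R)] --> 0 *: (v - x) + x by rewrite scale0r add0r.
    by apply: cvgD; [apply: cvgZr_tmp; exact: cvg_id|exact: cvg_cst].
  have fg' : \forall h \near (0 : R), hull s (h *: (v - x) + x) ->
    f (h *: (v - x) + x) = g (h *: (v - x) + x).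
    exact: (c0 _ fg).
  have {}fg' : \forall h \near (0 : R)^'+, hull s (h *: (v - x) + x) ->
    f (h *: (v - x) + x) = g (h *: (v - x) + x).
    by apply: (cvg_within _ fg').
  near=> h.
  have hx : hull s (h *: (v - x) + x).
    apply: hull_segment => //; apply/andP; split; near: h.
      by apply: nbhs_right_ge.
    by apply: nbhs_right_le.
  have -> : f (h *: (v - x) + x) = g (h *: (v - x) + x) by move: hx; near: h.
  by rewrite fgx.
move=> u [a [a0 ->]].
exact: (@eq_linear_direction ('d f x) ('d g x) s x Hv a a0).
Unshelve. all: by end_near. Qed.

End directional.

Lemma diff_comp_jacobian (R : realType) (V : normedModType R) (n m : nat)
    (F : V -> 'rV[R]_n) (T : 'rV[R]_n -> 'rV[R]_m) x u :
  differentiable F x -> differentiable T (F x) ->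
  'd (T \o F) x u = 'd F x u *m 'J T (F x).
Proof.
move=> dF dT.
by rewrite (diff_comp dF dT) -(deriveEjacobian _ dT) (deriveE _ dT).
Qed.

Section extensions.
Variables (R : realType) (N : nat).

Lemma smooth_extension_value (W : normedModType R) (s : simplex R N) x (f F : 'rV[R]_N -> W) :
  hull s x -> smooth_extension s x f F -> F x = f x.
Proof. by move=> sx [U [_ Ux _]]; exact. Qed.

Lemma smooth_extension_diff (W : normedModType R) (s : simplex R N) x (f F : 'rV[R]_N -> W) :
  smooth_extension s x f F -> differentiable F x.
Proof. by move=> [U [_ Ux sF _]]; have [H _] := sF 1; exact: H. Qed.

Lemma smooth_extension_near (W : normedModType R) (s : simplex R N) x (f F : 'rV[R]_N -> W) :
  smooth_extension s x f F -> \forall y \near x, hull s y -> F y = f y.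
Proof.
move=> [U [oU Ux _ FE]]; apply: filterS (open_nbhs_nbhs _) => [y Uy|]; last by split; [exact: oU|].
exact: FE.
Qed.

Variables (M : topologicalType) (n : nat) (A : set (chart R M n)) (h : 'rV[R]_N -> M).
Hypothesis hA : smooth_atlas A.

Lemma transition_differentiable c c' p : A c -> A c' -> cdom c p -> cdom c' p ->
  differentiable (transition c c') (cphi c p).
Proof.
move=> Ac Ac' cp c'p; have [_ /(_ c c' Ac Ac' 1) [H _]] := hA.
by apply: H; exists p.
Qed.

Variable s : simplex R N.
Hypothesis ch : {within hull s, continuous h}.

Lemma near_cdom (c : chart R M n) x : hull s x -> cdom c (h x) ->
  \forall y \near x, hull s y -> cdom c (h y).
Proof.
move=> sx chx; have /subspace_continuousP/(_ x sx) := ch.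
apply; apply: open_nbhs_nbhs; split; [exact: open_cdom|exact: chx].
Qed.

Lemma smooth_extension_transition c c' F F' x u :
  hull s x -> A c -> A c' -> cdom c (h x) -> cdom c' (h x) ->
  smooth_extension s x (cphi c \o h) F -> smooth_extension s x (cphi c' \o h) F' ->
  direction s u ->
  'd F' x u = 'd F x u *m 'J (transition c c') (cphi c (h x)).
Proof.
move=> sx Ac Ac' chx c'hx eF eF' su.
have Fx := smooth_extension_value sx eF; rewrite /= in Fx.
have dF := smooth_extension_diff eF; have dF' := smooth_extension_diff eF'.
have dT := transition_differentiable Ac Ac' chx c'hx.
have dT' : differentiable (transition c c') (F x) by rewrite Fx.
have dTF : differentiable (transition c c' \o F) x by exact: differentiable_comp.
have E : \forall y \near x, hull s y -> F' y = (transition c c' \o F) y.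
  near=> y => sy /=.
  have -> : F' y = (cphi c' \o h) y by move: sy; near: y; exact: smooth_extension_near eF'.
  have -> : F y = (cphi c \o h) y by move: sy; near: y; exact: smooth_extension_near eF.
  by rewrite /transition /= cphiK //; move: sy; near: y; exact: near_cdom.
apply: etrans (eq_diff_direction sx dF' dTF E su) _.
rewrite -Fx; exact: (diff_comp_jacobian u dF dT').
Unshelve. all: by end_near. Qed.

Variable (w : chart R M n -> 'rV[R]_n -> 'M[R]_n).
Hypothesis hw : two_form A w.

(** [get] picks some chart and extension. The differentials in two charts differ by the Jacobian of
    the transition, and the coordinate expressions of [w] differ by the pull-back along it, so the
    value is the same for all choices. *)
Lemma pullbackE c F x u v : hull s x -> A c -> cdom c (h x) ->
  smooth_extension s x (cphi c \o h) F -> direction s u -> direction s v ->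
  pullback A w h s x u v = form_eval (w c (F x)) ('d F x u) ('d F x v).
Proof.
move=> sx Ac chx eF su sv; rewrite (smooth_extension_value sx eF) /= /pullback.
set P := (X in get X).
have [c' [F' [Ac' c'hx eF' ->]]] : P (get P) by apply: xgetPex;
  exists (form_eval (w c (cphi c (h x))) ('d F x u) ('d F x v)); exists c, F.
have [_ _ hw3] := hw.
have E1 := smooth_extension_transition sx Ac Ac' chx c'hx eF eF' su.
have E2 := smooth_extension_transition sx Ac Ac' chx c'hx eF eF' sv.
have E := hw3 c c' (h x) Ac Ac' chx c'hx.
apply: etrans (f_equal2 (form_eval _) E1 E2) _.
apply: etrans (esym (form_eval_pull _ _ _ _)) _.
by congr form_eval; exact: esym E.
Qed.

End extensions.

(** * Crystalline simplices *)

Lemma hull_dist (R : realType) (N : nat) (r : simplex R N) (x z : 'rV[R]_N) (C : R) :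
  (forall v, v \in r -> `|v - z| <= C) -> hull r x -> `|x - z| <= C.
Proof.
move=> rC [a [a0 a1 ->]].
have -> : \sum_(v <- r) a v *: v - z = \sum_(v <- r) a v *: (v - z).
  under [RHS]eq_bigr do rewrite scalerBr.
  by rewrite sumrB -scaler_suml a1 scale1r.
rewrite (le_trans (ler_norm_sum _ _ _)) // -[C]mul1r -a1 mulr_suml.
rewrite big_seq [leRHS]big_seq; apply: ler_sum => v vr.
by rewrite normrZ ger0_norm ?a0 // ler_wpM2l ?a0 ?rC.
Qed.

Section edges.
Variables (R : realType) (N : nat) (s : simplex R N) (ws : seq 'rV[R]_N) (m : nat).
Hypotheses (ws_uniq : uniq ws) (ws_size : size ws = m.+1).
Hypothesis ws_mem : forall v, (v \in ws) = (v \in s).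
Hypothesis indep : affinely_independent s.

Definition edge (j : nat) : 'rV[R]_N := ws`_j - ws`_j.+1.

Let ws_nth i : (i <= m)%N -> ws`_i \in s.
Proof. by move=> im; rewrite -ws_mem mem_nth // ws_size ltnS. Qed.

Lemma edge_direction (j : 'I_m) : direction s (edge j).
Proof. by apply: direction_sub; apply: ws_nth; rewrite // ltnW. Qed.

Lemma edge_free (c : 'I_m -> R) : \sum_(j < m) c j *: edge j = 0 -> forall j, c j = 0.
Proof.
move=> c0.
(* At [ws_i] this coefficient is [c_i - c_(i-1)], or [c_0] for [i = 0]. Affine independence makes it
   vanish, and induction along the path gives [c = 0]. *)
pose a (v : 'rV[R]_N) := \sum_(j < m) c j * ((v == ws`_j)%:R - (v == ws`_j.+1)%:R).
have a0 : \sum_(v <- s) a v = 0.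
  rewrite exchange_big big1 //= => j _; rewrite -mulr_sumr.
  by have [-> _] := vertex_sub_coef (ws_nth (ltn_ord j)) (ws_nth (ltnW (ltn_ord j))); rewrite mulr0.
have av : \sum_(v <- s) a v *: v = 0.
  rewrite -[RHS]c0; under eq_bigr do rewrite scaler_suml.
  rewrite exchange_big /=; apply: eq_bigr => j _.
  under eq_bigr do rewrite -scalerA.
  rewrite -scaler_sumr; congr (_ *: _).
  by have [_ <-] := vertex_sub_coef (ws_nth (ltn_ord j)) (ws_nth (ltnW (ltn_ord j))).
have aw i : (i <= m)%N -> a ws`_i = 0 by move=> im; apply: (indep a0 av); exact: ws_nth.
have eq_ws i j : (i <= m)%N -> (j <= m)%N -> (ws`_i == ws`_j) = (i == j).
  by move=> im jm; rewrite nth_uniq // ws_size ltnS.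
move=> [j jm]; elim: j jm => [|j IH] jm.
  have := aw 0%N isT; rewrite /a (bigD1 (Ordinal jm)) //= big1 => [|i /negbTE i0].
    by rewrite eqxx eq_ws // subr0 mulr1 addr0.
  have i0' : (0 == i :> nat)%N = false by rewrite eq_sym -[0%N]/(val (Ordinal jm)) val_eqE.
  by rewrite !eq_ws ?i0' ?subrr ?mulr0 // ltnW.
have jm' : (j < m)%N by exact: ltnW.
have := aw j.+1 jm'; rewrite /a (bigD1 (Ordinal jm)) //= (bigD1 (Ordinal jm')) /=; last first.
  by rewrite -val_eqE /= ltn_eqF.
rewrite big1 => [|i /andP[i1 i2]]; last first.
  have e1 : (j.+1 == i)%N = false.
    by apply/negbTE; rewrite eq_sym -[j.+1]/(val (Ordinal jm)) val_eqE.
  have e2 : (j.+1 == i.+1)%N = false.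
    by apply/negbTE; rewrite eqSS eq_sym -[j in _ != j]/(val (Ordinal jm')) val_eqE.
  by rewrite !eq_ws ?e1 ?e2 ?subrr ?mulr0 // ltnW.
rewrite (IH jm') mul0r !addr0 eqxx eq_ws // ?[in X in _ - X]ltn_eqF // subr0 mulr1.
exact.
Qed.

End edges.

Section crystal.
Variables (R : realType) (N : nat) (ws : seq 'rV[R]_N) (m l : nat).
Variables (k : {ffun 'I_m -> 'I_l}) (t : 'S_m).
Hypothesis l_gt0 : (0 < l)%N.

Definition crystal_vertex (i : nat) : 'rV[R]_N :=
  uncrystal ws (small_cube_simplex_vertex R k t i).

Let l_neq0 : l%:R != 0 :> R. Proof. by rewrite pnatr_eq0 -lt0n. Qed.

Lemma crystal_vertexE i : crystal_vertex i =
  ws`_m + \sum_(j < m) (l%:R^-1 * ((k j : nat)%:R + (i <= (t^-1)%g j)%N%:R)) *: edge ws j.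
Proof. by congr (_ + _); apply: eq_bigr => j _; rewrite !mxE. Qed.

Lemma crystal_vertex_sub i i' : crystal_vertex i - crystal_vertex i' =
  l%:R^-1 *: \sum_(j < m) ((i <= (t^-1)%g j)%N%:R - (i' <= (t^-1)%g j)%N%:R) *: edge ws j.
Proof.
rewrite !crystal_vertexE opprD addrACA subrr add0r -sumrB scaler_sumr.
by apply: eq_bigr => j _; rewrite -scalerBl scalerA; congr (_ *: _); ring.
Qed.

(** The indicators of [q <= t^-1 j] and [q + 1 <= t^-1 j] differ for [j = t q] only: each step along
    the path moves a single coordinate of the cube. *)
Lemma crystal_vertex_succ (q : 'I_m) :
  crystal_vertex q - crystal_vertex q.+1 = l%:R^-1 *: edge ws (t q).
Proof.
rewrite crystal_vertex_sub (bigD1 (t q)) //= permK leqnn ltnn subr0 scale1r.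
rewrite big1 ?addr0 // => j jq.
have : (t^-1)%g j != q by apply: contra_neq jq => <-; rewrite permKV.
rewrite leq_eqVlt -val_eqE eq_sym /= => /negbTE -> /=.
by rewrite subrr scale0r.
Qed.

Lemma crystal_vertex_dist i i' :
  `|crystal_vertex i - crystal_vertex i'| <= l%:R^-1 * \sum_(j < m) `|edge ws j|.
Proof.
rewrite crystal_vertex_sub normrZ ger0_norm ?invr_ge0 ?ler0n //.
rewrite ler_wpM2l ?invr_ge0 ?ler0n // (le_trans (ler_norm_sum _ _ _)) //.
apply: ler_sum => j _; rewrite normrZ ler_piMl //.
by do 2 case: (_ <= _)%N; rewrite /= ?subrr ?subr0 ?sub0r ?normrN ?normr1 ?normr0.
Qed.

Variable s : simplex R N.
Hypotheses (ws_uniq : uniq ws) (ws_size : size ws = m.+1).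
Hypothesis ws_mem : forall v, (v \in ws) = (v \in s).
Hypothesis indep : affinely_independent s.

Variable r : simplex R N.
Hypothesis r_crystal : forall v, v \in r -> exists2 i, (i <= m)%N & v = crystal_vertex i.

(** Written in the free family of edges, the relation says that [T q], the total weight of the
    vertices of index at most [q], vanishes for [q < m]; for [q = m] it is the sum of all weights.
    Differences of consecutive [T q] isolate single vertices. *)
Lemma crystal_indep : affinely_independent r.
Proof.
move=> a a0 av.
have [io ioP] : exists io : 'rV[R]_N -> nat, forall v, v \in r ->
    (io v <= m)%N /\ v = crystal_vertex (io v).
  have /choice[io H] v : exists i, v \in r -> (i <= m)%N /\ v = crystal_vertex i.
    have [vr|] := boolP (v \in r); last by exists 0%N.
    by have [i im vE] := r_crystal vr; exists i.
  by exists io.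
pose T q : R := \sum_(v <- r) a v * (io v <= q)%N%:R.
have TE : forall j : 'I_m, T ((t^-1)%g j) = 0.
  pose c (j : 'I_m) := \sum_(v <- r) a v * (l%:R^-1 * ((k j : nat)%:R + (io v <= (t^-1)%g j)%N%:R)).
  have c0 : \sum_(j < m) c j *: edge ws j = 0.
    rewrite -[RHS]av.
    transitivity (\sum_(v <- r) a v *: (ws`_m +
        \sum_(j < m) (l%:R^-1 * ((k j : nat)%:R + (io v <= (t^-1)%g j)%N%:R)) *: edge ws j)).
      under [RHS]eq_bigr do rewrite scalerDr.
      rewrite big_split /= -scaler_suml a0 scale0r add0r.
      under [RHS]eq_bigr do rewrite scaler_sumr.
      rewrite exchange_big /=; apply: eq_bigr => j _; rewrite scaler_suml.
      by apply: eq_bigr => v _; rewrite scalerA.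
    rewrite big_seq [RHS]big_seq; apply: eq_bigr => v vr.
    by congr (_ *: _); rewrite -crystal_vertexE; exact: esym (ioP v vr).2.
  move=> j; have := edge_free ws_uniq ws_size ws_mem indep c0 j.
  rewrite /c; under eq_bigr do rewrite mulrDr mulrDr mulrA mulrCA.
  rewrite big_split /= -!mulr_suml a0 !mul0r add0r -mulr_sumr => /eqP.
  by rewrite mulf_eq0 invr_eq0 (negbTE l_neq0) => /eqP.
have T0 q : (q <= m)%N -> T q = 0.
  rewrite leq_eqVlt => /predU1P[->|qm].
    rewrite /T -[RHS]a0 big_seq [RHS]big_seq; apply: eq_bigr => v vr.
    by rewrite (ioP v vr).1 mulr1.
  by have := TE (t (Ordinal qm)); rewrite permK.
have D0 q : (q <= m)%N -> \sum_(v <- r) a v * (io v == q)%:R = 0.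
  case: q => [|q] qm.
    rewrite -[RHS](T0 0%N isT); apply: eq_bigr => v _.
    by rewrite leqn0.
  transitivity (T q.+1 - T q); last by rewrite !T0 ?subrr // ltnW.
  rewrite /T -sumrB; apply: eq_bigr => v _; rewrite -mulrBr leq_eqVlt ltnS.
  have [->|] := eqVneq (io v) q.+1; first by rewrite ltnn subr0.
  by move=> _ /=; rewrite subrr.
move=> v vr; have := D0 _ (ioP v vr).1.
rewrite (bigD1_seq v) ?fset_uniq //= eqxx mulr1 big_seq_cond big1 ?addr0 // => v' /andP[v'r v'v].
case: eqVneq; rewrite ?mulr0 // => e.
by case/eqP : v'v; rewrite [v'](ioP v' v'r).2 [v](ioP v vr).2 e.
Qed.

Lemma crystal_dist x y : hull r x -> hull r y ->
  `|x - y| <= l%:R^-1 * \sum_(j < m) `|edge ws j|.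
Proof.
move=> rx ry; apply: (hull_dist _ rx) => v vr; rewrite distrC.
apply: (hull_dist _ ry) => v' v'r.
have [i _ ->] := r_crystal vr; have [i' _ ->] := r_crystal v'r.
exact: crystal_vertex_dist.
Qed.

End crystal.

(** The hull is the image of the standard simplex, a closed subset of a cube, under a continuous map
    of barycentric coordinates. *)
Lemma hull_compact (R : realType) (N : nat) (s : simplex R N) : compact (hull s).
Proof.
pose p := size (enum_fset s).
pose f (a : 'rV[R]_p) : 'rV[R]_N := \sum_(i < p) a 0 i *: (enum_fset s)`_i.
pose T := [set a : 'rV[R]_p | forall i, `[0, 1]%classic (a 0 i)] `&`
          (fun a : 'rV[R]_p => \sum_(i < p) a 0 i) @^-1` [set (1 : R)].
have sumE (W : nmodType) (F : 'rV[R]_N -> W) : \sum_(v <- s) F v = \sum_(i < p) F (enum_fset s)`_i.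
  by rewrite (big_nth 0) big_mkord.
have -> : hull s = f @` T.
  apply/seteqP; split=> [x [a [a0 a1 ->]]|x [a [aT a1] <-]].
    have s_i (i : 'I_p) : (enum_fset s)`_i \in s by exact: mem_nth.
    exists (\row_i a (enum_fset s)`_i); last first.
      by rewrite sumE; apply: eq_bigr => i _; rewrite mxE.
    split=> [i|] /=; last by rewrite -[RHS]a1 sumE; apply: eq_bigr => i _; rewrite mxE.
    rewrite mxE in_itv/= a0 //= -a1 sumE (bigD1 i) //= lerDl sumr_ge0 // => j _.
    exact: a0.
  exists (fun v => \sum_(i < p) a 0 i * ((enum_fset s)`_i == v)%:R).
  have nthE (i j : 'I_p) : ((enum_fset s)`_j == (enum_fset s)`_i) = (j == i).
    by rewrite nth_uniq // fset_uniq.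
  have E (i : 'I_p) : \sum_(j < p) a 0 j * ((enum_fset s)`_j == (enum_fset s)`_i)%:R = a 0 i.
    rewrite (bigD1 i) //= eqxx mulr1 big1 ?addr0 // => j /negbTE ji.
    by rewrite nthE ji mulr0.
  split=> [v _||].
  - by apply: sumr_ge0 => i _; rewrite mulr_ge0 ?ler0n //; have := aT i;
    rewrite /= in_itv/= => /andP[].
  - by rewrite sumE -[RHS]a1; apply: eq_bigr => i _; rewrite E.
  - by rewrite sumE; apply: eq_bigr => i _; rewrite E.
have coord i : continuous (fun a : 'rV[R]_p => a 0 i) by exact: coord_continuous.
apply: continuous_compact.
  apply: continuous_subspaceT => a; apply: continuous_bigsum => i.
  by apply: (@cvgZr_tmp _ _ _ (nbhs a) _ (fun b : 'rV[R]_p => b 0 i)); exact: (coord i a).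
apply: compact_closedI.
  by apply: (@rV_compact R p (fun=> `[0, 1]%classic)) => i; exact: segment_compact.
apply: (@preimage_closed _ _ (fun a : 'rV[R]_p => \sum_(i < p) a 0 i) [set (1 : R)]).
  by move=> a _; apply: (@continuous_bigsum R _ R^o) => i; exact: coord.
exact: (@closed_eq R 1).
Qed.

Section ordering.
Variables (R : realType) (N : nat) (K : set (simplex R N)) (vs : seq 'rV[R]_N).
Hypotheses (hK : simplicial_complex K) (hvs : vertex_ordering K vs).

Lemma ordered_vertices s : K s -> let ws := [seq v <- vs | v \in s] in
  [/\ uniq ws, size ws = #|` s| & forall v, (v \in ws) = (v \in s)].
Proof.
move=> Ks ws; have [uvs vsK] := hvs; have [_ Kface _] := hK.
have uws : uniq ws by exact: filter_uniq.
have mws v : (v \in ws) = (v \in s).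
  rewrite mem_filter andb_idr // => vs_; apply/vsK; apply: (Kface s) => //.
    by apply/fset0Pn; exists v; rewrite inE.
  by rewrite fsub1set.
split=> //; apply: perm_size; apply: uniq_perm => //; exact: fset_uniq.
Qed.

(** [K] is finite, since each of its simplices is a subset of the vertices listed in [vs]; so one
    bound on [l] serves all of them. *)
Lemma complex_near_finite (P : simplex R N -> nat -> Prop) :
  (forall s, K s -> \forall l \near \oo, P s l) ->
  \forall l \near \oo, forall s, K s -> P s l.
Proof.
move=> HP.
have : \forall l \near \oo, forall s, s \in enum_fset (fpowerset (seq_fset tt vs)) -> K s -> P s l.
  elim: (enum_fset _) => [|s0 S IH]; first by near=> l => s; rewrite in_nil.
  have [Ks0|nKs0] := pselect (K s0).
    near=> l => s; rewrite inE => /orP[/eqP ->|sS]; first by move=> _; near: l; exact: HP.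
    by move: s sS; near: l.
  near=> l => s; rewrite inE => /orP[/eqP -> /nKs0 //|sS].
  by move: s sS; near: l.
apply: filterS => l HPl s Ks; apply: HPl => //.
rewrite fpowersetE; apply/fsubsetP => v vs_; rewrite seq_fsetE.
have [_ vsK] := hvs; have [_ Kface _] := hK; apply/vsK; apply: (Kface s) => //.
  by apply/fset0Pn; exists v; rewrite inE.
by rewrite fsub1set.
Unshelve. all: by end_near. Qed.

End ordering.

(** * Norms of forms in a moving frame *)

Section bounds.
Variables (R : realType) (T : topologicalType).

Lemma continuous_bigprod (I : Type) (r : seq I) (F : I -> T -> R) x :
  (forall i, {for x, continuous (F i)}) ->
  {for x, continuous (fun y => \prod_(i <- r) F i y)}.
Proof.
move=> cF; elim: r => [|i r IH].
  rewrite (_ : (fun y => _) = (fun=> 1)); first exact: cvg_cst.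
  by apply/funext => y; rewrite big_nil.
rewrite (_ : (fun y => _) = (fun y => F i y * \prod_(j <- r) F j y)); first by apply: cvgM;
  [exact: cF|exact: IH].
by apply/funext => y; rewrite big_cons.
Qed.

Lemma continuous_det n (A : T -> 'M[R]_n) x :
  (forall i j, {for x, continuous (fun y => A y i j)}) ->
  {for x, continuous (fun y => \det (A y))}.
Proof.
move=> cA; apply: (@continuous_bigsum R T R^o) => s.
by apply: cvgM; [exact: cvg_cst|apply: continuous_bigprod => i; exact: cA].
Qed.

Lemma near_bounded (I : finType) (f : I -> T -> R) x :
  (forall i, {for x, continuous (f i)}) ->
  exists2 C, 0 <= C & \forall y \near x, forall i, `|f i y| <= C.
Proof.
move=> cf; exists (\sum_i (`|f i x| + 1)); first by apply: sumr_ge0 => i _; rewrite addr_ge0.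
apply: filter_forall => i.
have : \forall y \near x, `|f i y - f i x| < 1 by apply: cvgr_distC_lt (cf i) _ _.
apply: filterS => y fy; rewrite (bigD1 i) //= ler_wpDr ?sumr_ge0 //.
by rewrite -[f i y](subrK (f i x)) addrC (le_trans (ler_normD _ _)) // lerD2l ltW.
Qed.

(** By Cramer's rule the entries of the inverse are quotients of determinants, hence continuous at
    [x]. *)
Lemma near_invmx_bounded n (A : T -> 'M[R]_n) x :
  (forall i j, {for x, continuous (fun y => A y i j)}) -> A x \in unitmx ->
  exists2 C, 0 <= C & \forall y \near x, A y \in unitmx /\ forall i j, `|invmx (A y) i j| <= C.
Proof.
move=> cA Ax; have d0 : \det (A x) != 0 by rewrite -unitfE -unitmxE.
have cd := continuous_det cA.
have ci (ij : 'I_n * 'I_n) : {for x,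
  continuous (fun y => (\det (A y))^-1 * cofactor (A y) ij.2 ij.1)}.
  apply: cvgM; first exact: cvgV.
  apply: cvgM; first exact: cvg_cst.
  apply: continuous_det => i j.
  rewrite (_ : (fun y => _) = (fun y => A y (lift ij.2 i) (lift ij.1 j))); first exact: cA.
  by apply/funext => y; rewrite !mxE.
have [C C0 AC] := near_bounded ci; exists C => //.
have uA : \forall y \near x, A y \in unitmx.
  have : \forall y \near x, \det (A y) != 0 by exact: cvgr_neq0 cd d0.
  by apply: filterS => y; rewrite -unitfE -unitmxE.
apply: filterS2 uA AC => y uAy AyC; split=> // i j.
by have := AyC (i, j); rewrite /invmx uAy !mxE.
Qed.

End bounds.

Section inner_product.
Variables (R : realType) (n : nat) (q : 'M[R]_n -> 'M[R]_n -> R).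
Hypothesis q_lin : forall (a : R) B1 B2 B3,
  alternating B1 -> alternating B2 -> alternating B3 ->
  q (a *: B1 + B2) B3 = a * q B1 B3 + q B2 B3.
Hypothesis q_sym : forall B1 B2, alternating B1 -> alternating B2 -> q B1 B2 = q B2 B1.

Definition elementary_form (ij : 'I_n * 'I_n) : 'M[R]_n :=
  delta_mx ij.1 ij.2 - delta_mx ij.2 ij.1.

Lemma elementary_form_alternating ij : alternating (elementary_form ij).
Proof. by rewrite /alternating linearB /= !trmx_delta opprB. Qed.

Let alternating0 : alternating (0 : 'M[R]_n).
Proof. by rewrite /alternating trmx0 oppr0. Qed.

Let alternatingP (a : R) (B1 B2 : 'M[R]_n) :
  alternating B1 -> alternating B2 -> alternating (a *: B1 + B2).
Proof. by rewrite /alternating => a1 a2; rewrite linearP /= a1 a2 scalerN opprD. Qed.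

Let q0 B : alternating B -> q 0 B = 0.
Proof.
move=> aB; have := q_lin 1 alternating0 alternating0 aB.
rewrite scaler0 addr0 mul1r => /eqP; rewrite -subr_eq0 opprD addrA subrr sub0r oppr_eq0.
by move=> /eqP.
Qed.

Lemma alternating_sum (I : Type) (r : seq I) (a : I -> R) (B : I -> 'M[R]_n) :
  (forall i, alternating (B i)) -> alternating (\sum_(i <- r) a i *: B i).
Proof.
move=> aB; elim: r => [|i r IH]; first by rewrite big_nil; exact: alternating0.
by rewrite big_cons; exact: alternatingP.
Qed.

Lemma inner_sum (I : Type) (r : seq I) (a : I -> R) (B : I -> 'M[R]_n) B' :
  (forall i, alternating (B i)) -> alternating B' ->
  q (\sum_(i <- r) a i *: B i) B' = \sum_(i <- r) a i * q (B i) B'.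
Proof.
move=> aB aB'; elim: r => [|i r IH]; first by rewrite !big_nil q0.
by rewrite !big_cons q_lin ?IH //; exact: alternating_sum.
Qed.

(** The sum runs over ordered pairs, so each elementary form occurs twice up to sign; hence the
    factor one half. *)
Lemma alternating_decomposition (B : 'M[R]_n) : alternating B ->
  B = \sum_ij (2^-1 * B ij.1 ij.2) *: elementary_form ij.
Proof.
move=> aB.
have E : B = \sum_ij B ij.1 ij.2 *: delta_mx ij.1 ij.2.
  by rewrite {1}[B]matrix_sum_delta pair_bigA.
have E' : B^T = \sum_ij B ij.1 ij.2 *: delta_mx ij.2 ij.1.
  by rewrite {1}E linear_sum; apply: eq_bigr => ij _; rewrite linearZ /= trmx_delta.
under eq_bigr do rewrite -scalerA scalerBr.
rewrite -scaler_sumr sumrB -E -E' aB opprK -mulr2n -[B *+ 2]scaler_nat scalerA mulVf ?scale1r //.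
Qed.

Lemma inner_bound B (b C : R) : 0 <= C -> alternating B -> (forall i j, `|B i j| <= b) ->
  (forall ij kl, `|q (elementary_form ij) (elementary_form kl)| <= C) ->
  q B B <= (n%:R * n%:R * b) ^+ 2 * C.
Proof.
move=> C0 aB Bb qC; have aE := elementary_form_alternating.
have b0 ij : `|2^-1 * B ij.1 ij.2| <= b.
  rewrite normrM ger0_norm ?invr_ge0 // (le_trans _ (Bb ij.1 ij.2)) // ler_piMl //.
  by rewrite invf_le1 // ler1n.
have cardE (c : R) : \sum_(ij : 'I_n * 'I_n) c = n%:R * n%:R * c.
  by rewrite sumr_const card_prod card_ord -[LHS]mulr_natl natrM.
have sum_bound (F : 'I_n * 'I_n -> R) d : (forall ij, `|F ij| <= d) ->
  `|\sum_ij F ij| <= n%:R * n%:R * d.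
  by move=> Fd; rewrite -cardE (le_trans (ler_norm_sum _ _ _)) // ler_sum.
rewrite {1}(alternating_decomposition aB) inner_sum //.
apply: le_trans (ler_norm _) _.
have -> : (n%:R * n%:R * b) ^+ 2 * C = n%:R * n%:R * (b * (n%:R * n%:R * (b * C))) by ring.
apply: (sum_bound) => ij; rewrite normrM ler_pM // q_sym // {1}(alternating_decomposition aB)
  inner_sum //.
by apply: sum_bound => kl; rewrite normrM ler_pM.
Qed.

End inner_product.

(** The inverse frame recovers [B] from its values on the frame. Near [x] its entries and the inner
    products of elementary forms are bounded by constants, from which [D] is built. *)
Lemma near_frame_bound (R : realType) (T : topologicalType) (n : nat) (x : T)
    (Z : T -> 'M[R]_n) (q : T -> 'M[R]_n -> 'M[R]_n -> R) :
  (forall i j, {for x, continuous (fun y => Z y i j)}) -> Z x \in unitmx ->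
  (forall B1 B2, alternating B1 -> alternating B2 ->
    {for x, continuous (fun y => q y B1 B2)}) ->
  (\forall y \near x,
    (forall (a : R) B1 B2 B3, alternating B1 -> alternating B2 -> alternating B3 ->
      q y (a *: B1 + B2) B3 = a * q y B1 B3 + q y B2 B3) /\
    (forall B1 B2, alternating B1 -> alternating B2 -> q y B1 B2 = q y B2 B1)) ->
  exists2 D, 0 <= D & \forall y \near x, forall (B : 'M[R]_n) (d : R),
    alternating B -> 0 <= d -> (forall j k, `|(Z y *m B *m (Z y)^T) j k| <= d) ->
    Num.sqrt (q y B B) <= D * d.
Proof.
move=> cZ Zx cq q_ip.
have [C C0 ZC] := near_invmx_bounded cZ Zx.
have cqE (i : ('I_n * 'I_n) * ('I_n * 'I_n)) :
    {for x, continuous (fun y => q y (elementary_form R i.1) (elementary_form R i.2))}.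
  by apply: cq; exact: elementary_form_alternating.
have [C' C'0 qC'] := near_bounded cqE.
pose nn : R := n%:R * n%:R.
have nn0 : 0 <= nn by rewrite mulr_ge0.
exists (nn * (nn * C * C) * Num.sqrt C').
  by rewrite !mulr_ge0 ?sqrtr_ge0.
near=> y => B d aB d0 Bd.
have [Zy Yy] : Z y \in unitmx /\ forall i j, `|invmx (Z y) i j| <= C by near: y.
have [q1 q2] : (forall (a : R) B1 B2 B3, alternating B1 -> alternating B2 -> alternating B3 ->
      q y (a *: B1 + B2) B3 = a * q y B1 B3 + q y B2 B3) /\
    (forall B1 B2, alternating B1 -> alternating B2 -> q y B1 B2 = q y B2 B1) by near: y.
have qy ij kl : `|q y (elementary_form R ij) (elementary_form R kl)| <= C'.
  have : forall i, `|q y (elementary_form R i.1) (elementary_form R i.2)| <= C' by near: y.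
  by move=> /(_ (ij, kl)).
have sum_le (F : 'I_n -> R) c : (forall i, `|F i| <= c) -> `|\sum_i F i| <= n%:R * c.
  move=> Fc; apply: le_trans (ler_norm_sum _ _ _) _.
  apply: le_trans (ler_sum _ (fun i _ => Fc i)) _.
  by rewrite sumr_const card_ord -[leLHS]mulr_natl.
have Bb i j : `|B i j| <= nn * C * C * d.
  pose S := Z y *m B *m (Z y)^T; pose Y := invmx (Z y).
  have -> : B = Y *m S *m Y^T.
    by rewrite /S /Y !mulmxA mulVmx // mul1mx trmx_inv -mulmxA mulmxV ?mulmx1 // unitmx_tr.
  rewrite mxE; have -> : nn * C * C * d = n%:R * (n%:R * (C * d) * C) by rewrite /nn; ring.
  apply: (sum_le) => k; rewrite normrM ler_pM //; last by rewrite mxE; exact: Yy.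
  by rewrite mxE; apply: sum_le => l; rewrite normrM ler_pM // ?Yy ?Bd.
apply: le_trans (ler_wsqrtr (inner_bound q1 q2 C'0 aB Bb qy)) _.
rewrite sqrtrM ?sqr_ge0 // sqrtr_sqr ger0_norm; last by rewrite !mulr_ge0.
by rewrite le_eqVlt; apply/orP; left; apply/eqP; rewrite /nn; ring.
Unshelve. all: by end_near. Qed.

(** * Estimates on crystalline simplices *)

Section bilinear_bounds.
Variables (R : realType) (V : lmodType R) (C : set V) (f : V -> V -> R).
Hypothesis C_lin : forall a u v, C u -> C v -> C (a *: u + v).
Hypothesis C0 : C 0.
Hypothesis f_lin : forall a u1 u2 v, C u1 -> C u2 -> C v ->
  f (a *: u1 + u2) v = a * f u1 v + f u2 v.
Hypothesis f_alt : forall u v, C u -> C v -> f u v = - f v u.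

(** Whitney data are meaningful on [direction r] only, so bilinearity is assumed on a subspace [C]
    throughout. *)
Lemma bilinear0l v : C v -> f 0 v = 0.
Proof.
move=> Cv; have := f_lin 1 C0 C0 Cv.
rewrite scaler0 addr0 mul1r => /eqP; rewrite -subr_eq0 opprD addrA subrr sub0r oppr_eq0.
by move=> /eqP.
Qed.

Lemma bilinearZl a u v : C u -> C v -> f (a *: u) v = a * f u v.
Proof. by move=> Cu Cv; rewrite -[a *: u]addr0 f_lin // bilinear0l // addr0. Qed.

Lemma bilinearBl u1 u2 v : C u1 -> C u2 -> C v -> f (u1 - u2) v = f u1 v - f u2 v.
Proof. by move=> C1 C2 Cv; rewrite addrC -scaleN1r f_lin // mulN1r addrC. Qed.

Lemma subspace_sum (I : Type) (r : seq I) (c : I -> R) (e : I -> V) :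
  (forall i, C (e i)) -> C (\sum_(i <- r) c i *: e i).
Proof.
by move=> Ce; elim: r => [|i r IH]; rewrite ?big_nil ?big_cons //; exact: C_lin.
Qed.

Lemma bilinear_suml (I : Type) (r : seq I) (c : I -> R) (e : I -> V) v :
  (forall i, C (e i)) -> C v ->
  f (\sum_(i <- r) c i *: e i) v = \sum_(i <- r) c i * f (e i) v.
Proof.
move=> Ce Cv; elim: r => [|i r IH]; first by rewrite !big_nil bilinear0l.
by rewrite !big_cons f_lin ?IH //; exact: subspace_sum.
Qed.

Lemma bilinear_sum_bound m (e : 'I_m -> V) (c c' : 'I_m -> R) (d : R) :
  (forall i, C (e i)) -> (forall i, `|c i| <= 1) -> (forall i, `|c' i| <= 1) ->
  (forall i j, `|f (e i) (e j)| <= d) ->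
  `|f (\sum_i c i *: e i) (\sum_i c' i *: e i)| <= m%:R * (m%:R * d).
Proof.
move=> Ce c1 c'1 fd; have CS := subspace_sum (index_enum 'I_m) _ Ce.
have sum_le (F b : 'I_m -> R) k : (forall i, `|b i| <= 1) -> (forall i, `|F i| <= k) ->
    `|\sum_i b i * F i| <= m%:R * k.
  move=> b1 Fk; apply: le_trans (ler_norm_sum _ _ _) _.
  have bk i : `|b i * F i| <= k by rewrite normrM -[k]mul1r ler_pM.
  apply: le_trans (ler_sum _ (fun i _ => bk i)) _.
  by rewrite sumr_const card_ord -[leLHS]mulr_natl.
rewrite bilinear_suml //; apply: (sum_le) => // i.
rewrite f_alt // normrN bilinear_suml //; exact: sum_le.
Qed.

End bilinear_bounds.

Lemma direction_linear (R : realType) (N : nat) (r : simplex R N) (a : R) u v :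
  direction r u -> direction r v -> direction r (a *: u + v).
Proof.
move=> [b [b0 ->]] [c [c0 ->]]; exists (fun x => a * b x + c x); split.
  by rewrite big_split /= -mulr_sumr b0 c0 mulr0 addr0.
by rewrite scaler_sumr -big_split; apply: eq_bigr => x _ /=; rewrite scalerDl scalerA.
Qed.

Lemma direction0 (R : realType) (N : nat) (r : simplex R N) : direction r 0.
Proof.
by exists (fun=> 0); split; [rewrite big1|rewrite big1 // => x _; rewrite scale0r].
Qed.

Section crystal_bounds.
Variables (R : realType) (N : nat) (ws : seq 'rV[R]_N) (m l : nat).
Variables (k : {ffun 'I_m -> 'I_l}) (t : 'S_m).
Hypothesis l_gt0 : (0 < l)%N.
Let V := crystal_vertex ws k t.

(** A difference of two vertices is [1 / l] times a combination of edges with coefficients in {-1,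
    0, 1}; each argument contributes one factor [1 / l] and one factor [m]. *)
Lemma crystal_form_bound (f : 'rV[R]_N -> 'rV[R]_N -> R) d i1 i2 i3 i4 :
  (forall a u1 u2 v, f (a *: u1 + u2) v = a * f u1 v + f u2 v) ->
  (forall u v, f u v = - f v u) ->
  (forall i j : 'I_m, `|f (edge ws i) (edge ws j)| <= d) ->
  `|f (V i1 - V i2) (V i3 - V i4)| <= l%:R^-1 * (l%:R^-1 * (m%:R * (m%:R * d))).
Proof.
move=> f_lin f_alt fd.
have fl a u1 u2 v : setT u1 -> setT u2 -> setT v -> f (a *: u1 + u2) v = a * f u1 v + f u2 v by [].
have fa u v : setT u -> setT v -> f u v = - f v u by [].
have c1 i i' (j : 'I_m) : `|(i <= (t^-1)%g j)%N%:R - (i' <= (t^-1)%g j)%N%:R| <= 1 :> R.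
  by do 2 case: (_ <= _)%N; rewrite /= ?subrr ?subr0 ?sub0r ?normrN ?normr1 ?normr0.
rewrite !crystal_vertex_sub (bilinearZl _ fl) // normrM ger0_norm ?invr_ge0 //.
rewrite ler_wpM2l ?invr_ge0 // f_alt normrN (bilinearZl _ fl) // normrM ger0_norm ?invr_ge0 //.
rewrite ler_wpM2l ?invr_ge0 //.
by apply: (@bilinear_sum_bound _ _ setT f).
Qed.

Variable r : simplex R N.
Hypothesis r_crystal : forall v, v \in r -> exists2 i, (i <= m)%N & v = V i.

Let sub_vertices : {subset enum_fset r <= map V (iota 0 m.+1)}.
Proof.
by move=> v /r_crystal[i im ->]; apply: map_f; rewrite mem_iota.
Qed.

Lemma crystal_card : (#|` r| <= m.+1)%N.
Proof.
by have := uniq_leq_size (fset_uniq r) sub_vertices; rewrite size_map size_iota.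
Qed.

Hypothesis r_full : #|` r| = m.+1.

Lemma crystal_vertex_mem i : (i <= m)%N -> V i \in r.
Proof.
move=> im; have [|_ ->] := uniq_min_size (fset_uniq r) sub_vertices.
  by rewrite size_map size_iota -r_full.
by apply: map_f; rewrite mem_iota.
Qed.

Lemma edge_crystal (j : 'I_m) : let q := (t^-1)%g j in edge ws j = l%:R *: (V q - V q.+1).
Proof.
by rewrite /V crystal_vertex_succ permKV scalerA divff ?scale1r // pnatr_eq0 -lt0n.
Qed.

Lemma edge_crystal_direction (j : 'I_m) : direction r (edge ws j).
Proof.
rewrite edge_crystal -[_ *: _]addr0; apply: direction_linear; last exact: direction0.
by apply: direction_sub; apply: crystal_vertex_mem; rewrite // ltnW.
Qed.

(** Converse of [crystal_form_bound]: the factors [l] of the two edges absorb the [1 / l] of the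
    hypothesis. *)
Lemma edge_form_bound (f : 'rV[R]_N -> 'rV[R]_N -> R) d :
  (forall a u1 u2 v, direction r u1 -> direction r u2 -> direction r v ->
    f (a *: u1 + u2) v = a * f u1 v + f u2 v) ->
  (forall u v, direction r u -> direction r v -> f u v = - f v u) ->
  (forall a b c, a \in r -> b \in r -> c \in r ->
    `|f (b - a) (c - a)| <= l%:R^-1 * (l%:R^-1 * d)) ->
  forall i j : 'I_m, `|f (edge ws i) (edge ws j)| <= 4 * d.
Proof.
move=> f_lin f_alt fd i j.
have C0 := direction0 r.
have Vr (q : 'I_m) : V q \in r by apply: crystal_vertex_mem; rewrite ltnW.
have VSr (q : 'I_m) : V q.+1 \in r by exact: crystal_vertex_mem.
have V0 : V 0 \in r by exact: crystal_vertex_mem.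
(* The bound is known for vectors with a common origin, so an edge of the path is split as a
   difference of two vectors from [V 0]. This costs a factor 2 in each argument, whence the 4. *)
have step (q : 'I_m) v e : direction r v ->
    (forall a, a \in r -> `|f (a - V 0) v| <= l%:R^-1 * e) ->
      `|f (l%:R *: (V q - V q.+1)) v| <= 2 * e.
  move=> dv fe; rewrite (bilinearZl C0 f_lin) //; last by apply: direction_sub.
  have -> : V q - V q.+1 = (V q - V 0) - (V q.+1 - V 0) by rewrite opprB addrA subrK.
  rewrite (bilinearBl f_lin) //; [|by apply: direction_sub..].
  rewrite normrM ger0_norm // -ler_pdivlMl ?ltr0n //.
  apply: le_trans (ler_normB _ _) _; apply: le_trans (lerD (fe _ (Vr q)) (fe _ (VSr q))) _.
  by rewrite -mulrDr -mulr2n -[e *+ 2]mulr_natl.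
have -> : 4 * d = 2 * (2 * d) by rewrite mulrA -natrM.
have di := edge_crystal_direction i; have dj := edge_crystal_direction j.
rewrite [edge ws i]edge_crystal; apply: (step) => // a ar.
rewrite f_alt //; last by apply: direction_sub.
rewrite normrN mulrCA [edge ws j]edge_crystal; apply: step => [|b br].
  by apply: direction_sub.
rewrite f_alt ?normrN ; [|by apply: direction_sub..].
exact: fd.
Qed.

End crystal_bounds.

Section crystal_integral.
Variables (R : realType) (N : nat) (ws : seq 'rV[R]_N) (m l : nat).
Variables (k : {ffun 'I_m -> 'I_l}) (t : 'S_m) (r : simplex R N).
Hypothesis r_crystal : forall v, v \in r -> exists2 i, (i <= m)%N & v = crystal_vertex ws k t i.
Variables (B : set 'rV[R]_N) (be : 'rV[R]_N -> 'rV[R]_N -> 'rV[R]_N -> R).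
Hypothesis be_lin : forall x, B x -> forall a u1 u2 v,
  be x (a *: u1 + u2) v = a * be x u1 v + be x u2 v.
Hypothesis be_alt : forall x, B x -> forall u v, be x u v = - be x v u.
Hypothesis be_cont : forall u v x, B x -> {for x, continuous (fun y => be y u v)}.
Hypothesis r_B : hull r `<=` B.

Lemma crystal_integral_bound d a b c x : a \in r -> b \in r -> c \in r -> hull r x ->
  (forall y (i j : 'I_m), hull r y ->
    `|be y (edge ws i) (edge ws j) - be x (edge ws i) (edge ws j)| <= d) ->
  `|2 * tri_int be a b c - be x (b - a) (c - a)| <= l%:R^-1 * (l%:R^-1 * (m%:R * (m%:R * d))).
Proof.
move=> ar br cr rx bed.
have abc (y : R) p q : in_simplex p q y -> hull r (a + p *: (b - a) + q *: (c - a) + y *: (a - a)).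
  exact: tetrahedron_hull.
(* [tri_int_bound] is stated for a tetrahedron; [a] is repeated as its fourth vertex. *)
apply: (@tri_int_bound R 'rV[R]_N B be be_cont a b c a) => [p q y pqy|p q pq].
  by apply: r_B; exact: abc.
have ry := abc _ _ _ pq; set y := (X in be X _ _).
have [ia _ ->] := r_crystal ar; have [ib _ ->] := r_crystal br; have [ic _ ->] := r_crystal cr.
apply: (@crystal_form_bound R N ws m l k t (fun u v => be y u v - be x u v)).
- move=> e u1 u2 v; rewrite !be_lin; [ring|exact: r_B|exact: r_B].
- move=> u v; rewrite (be_alt (r_B ry)) (be_alt (r_B rx)); ring.
- by move=> i j; exact: bed.
Qed.

End crystal_integral.

Lemma alternating_form_pull (R : realType) m n (J : 'M[R]_(m, n)) (B : 'M[R]_n) :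
  alternating B -> alternating (form_pull J B).
Proof.
by rewrite /alternating /form_pull => aB; rewrite trmx_mul trmxK trmx_mul aB mulNmx mulmxN mulmxA.
Qed.

Lemma Ck_on_sub (R : realType) (V W : normedModType R) k (U U' : set V) (f : V -> W) :
  U' `<=` U -> Ck_on k U f -> Ck_on k U' f.
Proof.
move=> UU'; elim: k f => [|k IH] f /=; first by move=> cf x /UU'; exact: cf.
by move=> [df cf]; split=> [x /UU'|v]; [exact: df|exact: IH].
Qed.

(** * The triangulation in a single chart *)

Section local_form.
Variables (R : realType) (M : topologicalType) (n N : nat) (A : set (chart R M n)).
Variables (w : chart R M n -> 'rV[R]_n -> 'M[R]_n) (h : 'rV[R]_N -> M).
Hypotheses (hA : smooth_atlas A) (hw : two_form A w).
Variable s : simplex R N.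
Hypothesis emb : smooth_embedding A s h.

(** Near [x] a single chart and a single extension serve all points of the simplex, so that the
    pull-back becomes a form on an open set of the ambient space. *)
Lemma local_chart x : hull s x -> exists c F U,
  [/\ A c, open U /\ U x, smooth_on U F, forall y, U y -> cimg c (F y)
    & forall y, U y -> hull s y -> cdom c (h y) /\ F y = cphi c (h y)].
Proof.
move=> sx; have [ch _ ext _] := emb; have [+ _] := hA.
move=> /(_ (h x))[c Ac chx]; have [F eF] := ext _ _ sx Ac chx.
have [U [oU Ux sF FE]] := eF.
have cF : {for x, continuous F} by apply: differentiable_continuous;
  exact: smooth_extension_diff eF.
have nimg : \forall y \near x, cimg c (F y).
  apply: cF; apply: open_nbhs_nbhs; split; first exact: open_cimg.
  by rewrite (FE x Ux sx); exact: cphi_img.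
have ndom : \forall y \near x, hull s y -> cdom c (h y) by exact: near_cdom.
have nU : \forall y \near x, U y by exact: open_nbhs_nbhs.
exists c, F, [set y | U y /\ cimg c (F y) /\ (hull s y -> cdom c (h y))]^°.
split=> //.
- split; first exact: open_interior.
  by near=> y; do ![split]; near: y.
- move=> k; apply: (@Ck_on_sub _ _ _ _ U) (sF k) => y /interior_subset.
  by case.
- by move=> y /interior_subset[_ []].
- move=> y /interior_subset[Uy [_ cy]] sy; split; [exact: cy|exact: FE].
Unshelve. all: by end_near. Qed.

Variables (c : chart R M n) (F : 'rV[R]_N -> 'rV[R]_n) (U : set 'rV[R]_N).
Hypotheses (Ac : A c) (oU : open U) (sF : smooth_on U F).
Hypothesis F_ext : forall y, U y -> hull s y -> cdom c (h y) /\ F y = cphi c (h y).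

Variable r : simplex R N.
Hypotheses (rs : hull r `<=` hull s) (rU : hull r `<=` U).

Lemma local_extension y : hull r y -> smooth_extension r y (cphi c \o h) F.
Proof. by move=> ry; exists U; split=> // [|z Uz /rs sz]; [exact: rU|exact: (F_ext Uz sz).2]. Qed.

Let ch_r : {within hull r, continuous h}.
Proof. by have [ch _ _ _] := emb; exact: continuous_subspaceW ch. Qed.

Let r_dom y : hull r y -> cdom c (h y).
Proof. by move=> ry; have [] := F_ext (rU ry) (rs ry). Qed.

Lemma pullback_local y u v : hull r y -> direction r u -> direction r v ->
  pullback A w h r y u v = pulled_form F (w c) y u v.
Proof.
by move=> ry ru rv; apply: pullbackE => //; [exact: r_dom|exact: local_extension].
Qed.

Variable g : chart R M n -> 'rV[R]_n -> 'M[R]_n -> 'M[R]_n -> R.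
Hypothesis hg : euclidean_structure A g.

Lemma transported_norm_lt (be : 'rV[R]_N -> 'rV[R]_N -> R) (eps : R) y : hull r y -> 0 < eps ->
  (forall B, alternating B ->
    (forall u v, direction r u -> direction r v -> form_eval B ('d F y u) ('d F y v) = be u v) ->
    Num.sqrt (g c (F y) B B) < eps) ->
  transported_norm A g h r y be < eps.
Proof.
move=> ry eps0 Blt; rewrite /transported_norm; set P := (X in get X).
have [[e Pe]|nP] := pselect (exists e, P e); last first.
  (* [point] of [R] is [0], the value of [get] on the empty set *)
  have -> : get P = 0 by apply: getPN => e Pe; apply: nP; exists e.
  exact: eps0.
have [c' [F' [B' [[Ac' c'hy] eF' aB' B'be ->]]]] : P (get P) by apply: getPex; exists e.
have chy := r_dom ry; have eF := local_extension ry.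
have Fy : F y = cphi c (h y) := smooth_extension_value ry eF.
have [_ _ _ _ gT] := hg.
(* The chart chosen by [get] may differ from [c]; pulling [B'] back along the transition gives its
   expression in [c], with the same norm. *)
have := gT c c' (h y) Ac Ac' chy c'hy B' B' aB' aB'; rewrite -Fy => <-.
apply: Blt => [|u v ru rv].
  exact: alternating_form_pull.
rewrite form_eval_pull -(B'be u v ru rv).
have E u' : direction r u' -> 'd F y u' *m 'J (transition c c') (F y) = 'd F' y u'.
  move=> ru'; apply: etrans (congr1 (fun z => 'd F y u' *m 'J (transition c c') z) Fy) _.
  exact: esym (smooth_extension_transition hA ch_r ry Ac Ac' chy c'hy eF eF' ru').
by move: (E u ru) (E v rv) => -> ->.
Qed.

End local_form.

Section local_periods.
Variables (R : realType) (M : topologicalType) (n N : nat) (A : set (chart R M n)).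
Variables (w : chart R M n -> 'rV[R]_n -> 'M[R]_n) (h : 'rV[R]_N -> M).
Hypotheses (hA : smooth_atlas A) (hw : two_form A w).
Hypothesis w_closed : forall c x, A c -> cimg c x ->
  forall u1 u2 u3, ext_deriv (w c) x u1 u2 u3 = 0.
Variable s : simplex R N.
Hypothesis emb : smooth_embedding A s h.
Variables (c : chart R M n) (F : 'rV[R]_N -> 'rV[R]_n) (U : set 'rV[R]_N).
Hypotheses (Ac : A c) (oU : open U) (sF : smooth_on U F).
Hypothesis F_img : forall y, U y -> cimg c (F y).
Hypothesis F_ext : forall y, U y -> hull s y -> cdom c (h y) /\ F y = cphi c (h y).
Variable r : simplex R N.
Hypotheses (rs : hull r `<=` hull s) (rU : hull r `<=` U).

Let w_smooth : smooth_on (cimg c) (w c). Proof. by have [H _ _] := hw; exact: H. Qed.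
Let w_alt y : cimg c y -> alternating (w c y). Proof. by have [_ H _] := hw; exact: H. Qed.

Lemma periods_local p0 p1 p2 : p0 \in r -> p1 \in r -> p2 \in r ->
  periods (pullback A w h) p0 p1 p2 = tri_int (pulled_form F (w c)) p0 p1 p2.
Proof.
move=> r0 r1 r2; apply: eq_tri => p q p_ge0 q_ge0 pq.
pose t : simplex R N := [fset p0; p1; p2]%fset.
have tr : (t `<=` r)%fset.
  by apply/fsubsetP => v; rewrite !inE => /orP[/orP[]|] /eqP ->.
have [t0 t1 t2] : [/\ p0 \in t, p1 \in t & p2 \in t] by rewrite /t !inE !eqxx ?orbT.
have tU := subset_trans (hull_face tr) rU; have ts := subset_trans (hull_face tr) rs.
apply: (pullback_local hA hw emb Ac oU sF F_ext ts tU).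
- exact: triangle_hull.
- exact: direction_sub.
- exact: direction_sub.
Qed.

Lemma periods_cocycle : cocycle_on (periods (pullback A w h)) r.
Proof.
move=> p0 p1 p2 p3 r0 r1 r2 r3; rewrite !periods_local //.
have wc := fun y => @w_closed c y Ac.
apply: (@tri_int_cocycle R _ U (pulled_form F (w c))).
- by move=> x _ a u1 u2 v; exact: pulled_form_linear.
- by move=> x Ux u v; apply: (pulled_form_alt F_img w_alt).
- by move=> u v x Ux; apply: (pulled_form_continuous oU F_img sF w_smooth).
- by move=> u v e x Ux; apply: (pulled_form_derivable oU F_img sF w_smooth).
- by move=> u v e x Ux; apply: (pulled_form_continuous_derive oU F_img sF w_smooth).
- by move=> x Ux u1 u2 u3; apply: (pulled_form_closed oU F_img sF w_smooth w_alt wc).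
- by move=> x y z xyz; apply: rU; exact: tetrahedron_hull.
Qed.

Lemma periods_degenerate : degenerate0_on (periods (pullback A w h)) r.
Proof.
have be0 p u : hull r p -> pulled_form F (w c) p u u = 0.
  by move=> rp; have := pulled_form_alt F_img w_alt u u (rU rp); lra.
have be00 p u : pulled_form F (w c) p 0 u = 0.
  by rewrite /pulled_form linear0 /form_eval !mul0mx mxE.
have tri0 f : (forall p q : R, 0 <= p -> 0 <= q -> p + q <= 1 -> f p q = 0) -> tri 1 f = 0.
  by move=> f0; rewrite (eq_tri (g := fun _ _ => 0)) // tri_cst ?ler01 // mul0r.
move=> p q rp rq; split; rewrite periods_local //; apply: tri0 => a b a0 b0 ab.
- by apply: be0; exact: triangle_hull.
- by rewrite subrr be00.
- rewrite subrr (pulled_form_alt F_img w_alt) ?be00 ?oppr0 //.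
  by apply: rU; rewrite -(subrr p); exact: triangle_hull.
Qed.

End local_periods.

(** The edges are independent in [direction s], where the differential of an embedding is
    injective. *)
Lemma edge_frame_free (R : realType) (M : topologicalType) (m n N : nat) (A : set (chart R M n))
    (h : 'rV[R]_N -> M) (s : simplex R N) (ws : seq 'rV[R]_N) (x : 'rV[R]_N)
    (c : chart R M n) (F : 'rV[R]_N -> 'rV[R]_n) :
  smooth_embedding A s h -> affinely_independent s ->
  uniq ws -> size ws = m.+1 -> (forall v, (v \in ws) = (v \in s)) -> hull s x ->
  A c -> cdom c (h x) -> smooth_extension s x (cphi c \o h) F ->
  row_free (\matrix_(j < m) 'd F x (edge ws j)).
Proof.
move=> [_ _ _ inj] indep ws_uniq ws_size ws_mem sx Ac cx eF.
apply: inj_row_free => v vZ.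
have E : 'd F x (\sum_j v 0 j *: edge ws j) = 0.
  apply: etrans vZ; rewrite linear_sum mulmx_sum_row; apply: eq_bigr => j _.
  by rewrite linearZ rowK.
have dE : direction s (\sum_j v 0 j *: edge ws j).
  apply: (subspace_sum (@direction_linear _ _ s) (@direction0 _ _ s)) => j.
  exact: edge_direction.
have v0 := edge_free ws_uniq ws_size ws_mem indep (inj x c F sx Ac cx eF _ dE E).
by apply/rowP => j; rewrite mxE v0.
Qed.

(** Together with [crystal_card] it shows that a simplex of [K] containing an n-dimensional small
    simplex has dimension exactly [n]. *)
Lemma embedding_dim (R : realType) (M : topologicalType) (m n N : nat) (A : set (chart R M n))
    (h : 'rV[R]_N -> M) (s : simplex R N) (ws : seq 'rV[R]_N) (x : 'rV[R]_N) :
  smooth_atlas A -> smooth_embedding A s h -> affinely_independent s ->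
  uniq ws -> size ws = m.+1 -> (forall v, (v \in ws) = (v \in s)) -> hull s x -> (m <= n)%N.
Proof.
move=> [hA _] emb indep ws_uniq ws_size ws_mem sx; have [_ _ ext _] := emb.
have [c Ac cx] := hA (h x); have [F eF] := ext _ _ sx Ac cx.
have := edge_frame_free emb indep ws_uniq ws_size ws_mem sx Ac cx eF.
by rewrite /row_free => /eqP <-; exact: rank_leq_col.
Qed.

Lemma continuous_within_open (T U : topologicalType) (V : T -> U) (O : set U) (W : topologicalType)
    (f : U -> W) x : open O -> (\forall y \near x, O (V y)) -> {for x, continuous V} ->
  {within O, continuous f} -> {for x, continuous (f \o V)}.
Proof.
move=> oO nO cV /subspace_continuousP cf; have Ox := nbhs_singleton nO.
apply: cvg_comp (cf _ Ox) => B; rewrite /within /= => /cV HB.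
by apply: filterS2 HB nO => y; exact.
Qed.

(* The last clause concerns any form with the right integrals because
   [constant_approximation] is only known to have them once the first two
   clauses hold for all simplices of the subdivision. *)
Definition good_crystal (R : realType) (M : topologicalType) (n N : nat) (A : set (chart R M n))
    (w : chart R M n -> 'rV[R]_n -> 'M[R]_n)
    (g : chart R M n -> 'rV[R]_n -> 'M[R]_n -> 'M[R]_n -> R)
    (h : 'rV[R]_N -> M) (eps : R) (r : simplex R N) :=
  [/\ cocycle_on (periods (pullback A w h)) r,
      degenerate0_on (periods (pullback A w h)) r
    & #|` r| = n.+1 -> forall (al : whitney_data R N) y, hull r y ->
      (forall a u1 u2 v, direction r u1 -> direction r u2 -> direction r v ->
        al r y (a *: u1 + u2) v = a * al r y u1 v + al r y u2 v) ->
      (forall u v, direction r u -> direction r v -> al r y u v = - al r y v u) ->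
      (forall a b c, a \in r -> b \in r -> c \in r ->
        al r y (b - a) (c - a) = 2 * periods (pullback A w h) a b c) ->
      transported_norm A g h r y (fun u v => al r y u v - pullback A w h r y u v) < eps].

(** * The estimate near a point *)

Section local_estimate.
Variables (R : realType) (M : topologicalType) (n N : nat) (A : set (chart R M n)).
Variables (w : chart R M n -> 'rV[R]_n -> 'M[R]_n) (h : 'rV[R]_N -> M).
Hypotheses (hA : smooth_atlas A) (hw : two_form A w).
Hypothesis w_closed : forall c x, A c -> cimg c x ->
  forall u1 u2 u3, ext_deriv (w c) x u1 u2 u3 = 0.
Variable g : chart R M n -> 'rV[R]_n -> 'M[R]_n -> 'M[R]_n -> R.
Hypothesis hg : euclidean_structure A g.
Variables (s : simplex R N) (ws : seq 'rV[R]_N).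
Hypothesis emb : smooth_embedding A s h.
Hypotheses (ws_uniq : uniq ws) (ws_size : size ws = n.+1).
Hypothesis ws_mem : forall v, (v \in ws) = (v \in s).
Hypothesis indep : affinely_independent s.
Variables (eps : R) (x0 : 'rV[R]_N).
Hypotheses (eps0 : 0 < eps) (sx0 : hull s x0).

Let crystal l (k : {ffun 'I_n -> 'I_l}) (t : 'S_n) (r : simplex R N) :=
  (forall v, v \in r -> exists2 i, (i <= n)%N & v = crystal_vertex ws k t i) /\
  hull r `<=` hull s.

Section chart.
Variables (c : chart R M n) (F : 'rV[R]_N -> 'rV[R]_n) (U : set 'rV[R]_N).
Hypotheses (Ac : A c) (oU : open U) (Ux0 : U x0) (sF : smooth_on U F).
Hypothesis F_img : forall y, U y -> cimg c (F y).
Hypothesis F_ext : forall y, U y -> hull s y -> cdom c (h y) /\ F y = cphi c (h y).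

Let be := pulled_form F (w c).
Let w_smooth : smooth_on (cimg c) (w c). Proof. by have [H _ _] := hw; exact: H. Qed.
Let w_alt y : cimg c y -> alternating (w c y). Proof. by have [_ H _] := hw; exact: H. Qed.
Let nU : \forall y \near x0, U y. Proof. exact: open_nbhs_nbhs. Qed.

Definition frame (y : 'rV[R]_N) : 'M[R]_n := \matrix_(j < n) 'd F y (edge ws j).

Lemma frame_form y B (j k : 'I_n) : (frame y *m B *m (frame y)^T) j k =
  form_eval B ('d F y (edge ws j)) ('d F y (edge ws k)).
Proof.
rewrite form_evalE mxE; under eq_bigr do rewrite !mxE mulr_suml.
rewrite exchange_big; apply: eq_bigr => i _ /=; apply: eq_bigr => i' _.
by rewrite !mxE.
Qed.

Lemma frame_continuous i j : {for x0, continuous (fun y => frame y i j)}.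
Proof.
have E : \forall y \near x0, 'D_(edge ws i) F y 0 j = frame y i j.
  apply: filterS nU => y Uy; rewrite mxE deriveE //.
  by have [H _] := sF 1; exact: H.
apply: (near_eq_continuous E).
have cD : {for x0, continuous ('D_(edge ws i) F)} by have [_ H] := sF 1; exact: H.
apply: (@continuous_comp _ _ _ ('D_(edge ws i) F) (fun B : 'rV[R]_n => B 0 j)) => //.
exact: coord_continuous.
Qed.

Lemma frame_unit : frame x0 \in unitmx.
Proof.
rewrite -row_free_unit; have [cx0 _] := F_ext Ux0 sx0.
apply: (edge_frame_free emb indep ws_uniq ws_size ws_mem sx0 Ac cx0).
by exists U; split=> // y Uy sy; exact: (F_ext Uy sy).2.
Qed.

Lemma near_norm_bound : exists2 D, 0 <= D & \forall y \near x0, forall (B : 'M[R]_n) (d : R),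
  alternating B -> 0 <= d ->
  (forall j k : 'I_n, `|form_eval B ('d F y (edge ws j)) ('d F y (edge ws k))| <= d) ->
  Num.sqrt (g c (F y) B B) <= D * d.
Proof.
have [g_lin g_sym _ g_cont _] := hg.
have cF : {for x0, continuous F}.
  by apply: differentiable_continuous; have [H _] := sF 1; exact: H.
have [||D D0 HD] := near_frame_bound (q := fun y => g c (F y)) frame_continuous frame_unit.
- move=> B1 B2 a1 a2; apply: (continuous_within_open (O := cimg c) (f := fun z => g c z B1 B2))
  => //.
  + exact: open_cimg.
  + by apply: filterS nU => y; exact: F_img.
  + exact: g_cont.
- apply: filterS nU => y /F_img cy; split=> [a B1 B2 B3 a1 a2 a3|B1 B2 a1 a2]; first exact: g_lin.
  exact: g_sym.
exists D => //; apply: filterS HD => y HD B d aB d0 Bd; apply: HD => // j k.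
by rewrite frame_form.
Qed.

Lemma near_form_close (d : R) : 0 < d -> \forall y \near x0, forall i j : 'I_n,
  `|be y (edge ws i) (edge ws j) - be x0 (edge ws i) (edge ws j)| <= d.
Proof.
move=> d0.
have near_ij (ij : 'I_n * 'I_n) : \forall y \near x0,
    `|be y (edge ws ij.1) (edge ws ij.2) - be x0 (edge ws ij.1) (edge ws ij.2)| < d.
  have := pulled_form_continuous oU F_img sF w_smooth (u := edge ws ij.1) (v := edge ws ij.2) Ux0.
  by move=> /cvgr_distC_lt; exact.
have := @filter_forall _ _ _ _ (@nbhs_filter _ x0) near_ij.
by apply: filterS => y H i j; rewrite ltW // (H (i, j)).
Qed.

Lemma near_good_crystal_chart : exists2 rho, 0 < rho & forall l, (0 < l)%N ->
  forall k t r, @crystal l k t r -> hull r `<=` ball x0 rho ->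
  good_crystal A w g h eps r.
Proof.
have [D D0 HD] := near_norm_bound.
pose c4 : R := 4 * (n%:R * n%:R).
have c40 : 0 <= c4 by rewrite !mulr_ge0.
(* [edge_form_bound] and [crystal_integral_bound] turn an oscillation [kap] into at most [c4 * kap]
   on pairs of edges, and the norm costs a factor [D]; the summand 1 covers [D * c4 = 0]. *)
pose kap := eps / (D * c4 + 1).
have Dc : 0 < D * c4 + 1 by rewrite ltr_wpDl // mulr_ge0.
have kap0 : 0 < kap by rewrite divr_gt0.
have Dkap : D * (4 * (n%:R * (n%:R * kap))) < eps.
  have -> : D * (4 * (n%:R * (n%:R * kap))) = (D * c4) * kap by rewrite /c4; ring.
  by rewrite /kap mulrA ltr_pdivrMr // mulrC ltr_pM2l // ltrDl.
(* Half of [kap], as two points of the small simplex are compared through [x0]. *)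
have HC := near_form_close (divr_gt0 kap0 (ltr0Sn R 1)).
have /nbhs_ballP[rho /= rho0 Hrho] : nbhs x0 [set y | [/\ U y,
    forall (B : 'M[R]_n) (d : R), alternating B -> 0 <= d ->
      (forall j k : 'I_n, `|form_eval B ('d F y (edge ws j)) ('d F y (edge ws k))| <= d) ->
      Num.sqrt (g c (F y) B B) <= D * d
    & forall i j : 'I_n,
      `|be y (edge ws i) (edge ws j) - be x0 (edge ws i) (edge ws j)| <= kap / 2]].
  by apply: filterS3 nU HD HC => y Uy HDy HCy; split.
exists rho => // l l0 k t r [r_crystal rs] r_rho.
have {}r_rho y : hull r y -> _ := fun ry => Hrho y (r_rho y ry).
have rU : hull r `<=` U by move=> y /r_rho[].
have per := @periods_local _ _ _ _ A w h hA hw s emb c F U Ac oU sF F_ext r rs rU.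
split=> [||r_full al y ry al_lin al_alt alE].
- exact: (periods_cocycle hA hw w_closed emb Ac oU sF F_img F_ext rs rU).
- exact: (periods_degenerate hA hw emb Ac oU sF F_img F_ext rs rU).
apply: (transported_norm_lt hA emb Ac oU sF F_ext rs rU hg) => // B aB HB.
apply: le_lt_trans Dkap.
have [_ + _] := r_rho y ry; apply=> // [|j k'].
  by apply: mulr_ge0 => //; apply: mulr_ge0 => //; apply: mulr_ge0 => //; exact: ltW.
have pb u v := pullback_local hA hw emb Ac oU sF F_ext rs rU (u := u) (v := v) ry.
have dE := @edge_crystal_direction R N ws n l k t l0 r r_crystal r_full.
rewrite (HB _ _ (dE j) (dE k')).
apply: (edge_form_bound l0 r_crystal r_full (f := fun u v => al r y u v - pullback A w h r y u v)).
- move=> a u1 u2 v d1 d2 dv; rewrite al_lin // !pb //; last exact: direction_linear.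
  by rewrite pulled_form_linear; ring.
- move=> u v du dv; rewrite al_alt // !pb // (pulled_form_alt F_img w_alt _ _ (rU y ry)).
  by ring.
- move=> a b c' ar br cr; rewrite alE // per // pb; [|exact: direction_sub..].
  apply: (crystal_integral_bound r_crystal (B := U) (be := be)) => //.
  + by move=> x _ e u1 u2 v; exact: pulled_form_linear.
  + by move=> x Ux u v; exact: (pulled_form_alt F_img w_alt).
  + by move=> u v x Ux; exact: (pulled_form_continuous oU F_img sF w_smooth).
  + move=> y' i i' ry'; have [_ _ Hy] := r_rho y ry; have [_ _ Hy'] := r_rho y' ry'.
    rewrite [X in _ <= X]splitr -[X in `|X|](subrKA (be x0 (edge ws i) (edge ws i'))).
    apply: le_trans (ler_normD _ _) _; apply: lerD; first exact: Hy'.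
    by rewrite distrC; exact: Hy.
Qed.

End chart.

(** The statement is joint in [y] and [l], the shape in which compactness of [hull s] yields an [l]
    independent of [y]. A small simplex has diameter at most [C / l], below [rho / 2], so one that
    meets the ball of radius [rho / 2] lies in the ball of radius [rho]. *)
Lemma near_good_crystal : \forall y \near x0 & l \near \oo,
  forall k t r, @crystal l k t r -> hull r y -> good_crystal A w g h eps r.
Proof.
have [c [F [U [Ac [oU Ux0] sF F_img F_ext]]]] := local_chart hA emb sx0.
have [rho rho0 Hrho] := near_good_crystal_chart Ac oU Ux0 sF F_img F_ext.
pose C := \sum_(j < n) `|edge ws j|.
have C0 : 0 <= C by apply: sumr_ge0.
have lC : \forall l \near \oo, (0 < l)%N /\ l%:R^-1 * C < rho / 2.
  near=> l; have l0 : (0 < l)%N by near: l; exact: nbhs_infty_gt.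
  split=> //; rewrite ltr_pdivrMl ?ltr0n // -ltr_pdivrMr ?divr_gt0 //.
  by near: l; exact: nbhs_infty_gtr.
exists (ball x0 (rho / 2), [set l | (0 < l)%N /\ l%:R^-1 * C < rho / 2]).
  by split=> //; apply: nbhsx_ballx; rewrite divr_gt0.
move=> [y l] [/= x0y [l0 lC']] k t r [r_crystal rs] ry.
apply: (Hrho l l0 k t r) => // z rz.
have yz := crystal_dist r_crystal ry rz.
rewrite [rho]splitr; apply: (@ball_triangle _ _ y) => //.
by rewrite -ball_normE /ball_ /=; exact: le_lt_trans yz lC'.
Unshelve. all: by end_near. Qed.

End local_estimate.

(** * From local estimates to the whole subdivision *)

Section subdivision.
Variables (R : realType) (M : topologicalType) (n N : nat) (A : set (chart R M n)).
Variables (w : chart R M n -> 'rV[R]_n -> 'M[R]_n) (h : 'rV[R]_N -> M).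
Hypotheses (hA : smooth_atlas A) (hw : two_form A w).
Hypothesis w_closed : forall c x, A c -> cimg c x ->
  forall u1 u2 u3, ext_deriv (w c) x u1 u2 u3 = 0.
Variable g : chart R M n -> 'rV[R]_n -> 'M[R]_n -> 'M[R]_n -> R.
Hypothesis hg : euclidean_structure A g.
Variables (K : set (simplex R N)) (vs : seq 'rV[R]_N).
Hypotheses (hK : simplicial_complex K) (hvs : vertex_ordering K vs).
Hypothesis emb : forall s, K s -> smooth_embedding A s h.
Variable eps : R.
Hypothesis eps0 : 0 < eps.

Lemma infty_good_crystal : \forall l \near \oo, forall s, K s -> #|` s| = n.+1 ->
  forall (k : {ffun 'I_n -> 'I_l}) t (r : simplex R N), r != fset0 ->
  (forall v, v \in r -> exists2 i, (i <= n)%N &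
    v = crystal_vertex [seq v <- vs | v \in s] k t i) ->
  hull r `<=` hull s -> good_crystal A w g h eps r.
Proof.
apply: (complex_near_finite hK hvs) => s Ks.
have [sn|sn] := eqVneq #|` s| n.+1; last by apply: nearW => l /eqP; rewrite (negbTE sn).
have [ws_uniq ws_size ws_mem] := ordered_vertices hK hvs Ks; rewrite sn in ws_size.
have [/(_ s Ks)[_ indep] _ _] := hK.
have /compact_near_coveringP H := @hull_compact R N s.
have near_good x := near_good_crystal hA hw w_closed hg (emb Ks) ws_uniq ws_size ws_mem indep
  eps0 (x0 := x).
have FF : Filter \oo by exact: eventually_filter.
apply: filterS (H _ \oo _ FF near_good) => l Hl _ k t r /fset0Pn[v vr] r_crystal rs.
(* Any point of [r] selects the neighbourhood to use; a vertex will do. *)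
have rv := vertex_hull vr.
exact: (Hl v (rs v rv) k t r (conj r_crystal rs) rv).
Qed.

Variable l : nat.
Hypothesis l_gt0 : (0 < l)%N.
Hypothesis l_good : forall s, K s -> #|` s| = n.+1 ->
  forall (k : {ffun 'I_n -> 'I_l}) t (r : simplex R N), r != fset0 ->
  (forall v, v \in r -> exists2 i, (i <= n)%N &
    v = crystal_vertex [seq v <- vs | v \in s] k t i) ->
  hull r `<=` hull s -> good_crystal A w g h eps r.

Let L := crystalline_subdivision vs l K.

Lemma crystalline_face r t : L r -> t != fset0 -> (t `<=` r)%fset -> L t.
Proof.
move=> [_ [s [m [k [p [Ks top sm r_crystal rs]]]]]] t0 tr; split=> //.
exists s, m, k, p; split=> // [v /(fsubsetP tr)|]; first exact: r_crystal.
exact: subset_trans (hull_face tr) rs.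
Qed.

Lemma crystalline_indep r : L r -> affinely_independent r.
Proof.
move=> [_ [s [m [k [p [Ks _ sm r_crystal _]]]]]].
have [ws_uniq ws_size ws_mem] := ordered_vertices hK hvs Ks; rewrite sm in ws_size.
have [/(_ s Ks)[_ indep] _ _] := hK.
exact: (crystal_indep l_gt0 ws_uniq ws_size ws_mem indep r_crystal).
Qed.

Lemma crystalline_close :
  C0_close A g h L (constant_approximation A w h L) (pullback A w h) eps.
Proof.
move=> r x Lr r_n rx.
have [r0 [s [m [k [p [Ks top sm r_crystal rs]]]]]] := Lr.
have [ws_uniq ws_size ws_mem] := ordered_vertices hK hvs Ks; rewrite sm in ws_size.
have [/(_ s Ks)[_ indep] _ _] := hK.
have mn : m = n.
  apply/eqP; rewrite eqn_leq (embedding_dim hA (emb Ks) indep ws_uniq ws_size ws_mem (rs x rx)) /=.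
  by have := crystal_card r_crystal; rewrite r_n ltnS.
(* All simplices of maximal cardinality have dimension [n] once one of them has, so every simplex of
   [L], faces included, lies in a crystal covered by [l_good]. *)
have L_good r' : L r' -> good_crystal A w g h eps r'.
  move=> [r'0 [s' [m' [k' [p' [Ks' top' sm' r'_crystal r's]]]]]].
  have m'n : m' = n.
    have ss' : #|` s'| = #|` s| by apply: anti_leq; rewrite (top _ Ks') (top' _ Ks).
    by apply: etrans mn; move: ss'; rewrite sm sm' => -[].
  by subst m'; exact: (l_good Ks' sm' r'0 r'_crystal r's).
have L0 r' : L r' -> r' != fset0 by case.
have L_coc r' : L r' -> cocycle_on (periods (pullback A w h)) r' by move=> /L_good[].
have L_deg r' : L r' -> degenerate0_on (periods (pullback A w h)) r' by move=> /L_good[].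
(* The form [constant_form] witnesses existence, so the value of [get] is a genuine approximation,
   to which the last clause of [good_crystal] applies. *)
have [al_whitney al_const al_int] : is_constant_approximation A w h L (constant_approximation A w
  h L).
  apply: getPex; exists (constant_form (periods (pullback A w h))); split.
  - exact: (constant_form_whitney L0 crystalline_indep L_coc L_deg).
  - by [].
  - move=> t a b c Lt _ tE.
    exact: (constant_form_integral2 L0 crystalline_indep L_coc L_deg Lt tE).
have [_ _ Hr] := L_good r Lr.
have [al_lin al_alt _ _] := al_whitney.
apply: (Hr r_n _ x rx).
- by move=> a u1 u2 v; exact: al_lin.
- by move=> u v; exact: al_alt.
- move=> a b c ar br cr.
  exact: (constant_approximation_vertices crystalline_face L_deg al_whitney al_const al_int Lr rx
    ar br cr).
Qed.

End subdivision.

Theorem theorem0p3 (R : realType) (M : topologicalType) (n : nat)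
    (A : set (chart R M n)) (hM : closed_manifold A)
    (w : chart R M n -> 'rV[R]_n -> 'M[R]_n) (hw : symplectic_form A w)
    (g : chart R M n -> 'rV[R]_n -> 'M[R]_n -> 'M[R]_n -> R)
    (hg : euclidean_structure A g)
    (N : nat) (K : set (simplex R N)) (h : 'rV[R]_N -> M)
    (hK : smooth_triangulation A K h)
    (vs : seq 'rV[R]_N) (hvs : vertex_ordering K vs)
    (eps : R) (heps : 0 < eps) :
  exists2 l : nat, (1 <= l)%N &
    let L := crystalline_subdivision vs l K in
    C0_close A g h L (constant_approximation A w h L) (pullback A w h) eps.
Proof.
have [_ _ _ hA] := hM; have [w_form w_closed _] := hw; have [K_complex _ emb] := hK.
have Hl := infty_good_crystal hA w_form w_closed hg K_complex hvs emb heps.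
have Hl0 : \forall l \near \oo, (0 < l)%N by exact: nbhs_infty_gt.
have [l [l0 l_good]] := filter_ex (filterI Hl0 Hl).
exists l => //=.
exact: (crystalline_close hA K_complex hvs emb l0 l_good).
Qed.
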